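(* Let $\mathcal G$ be a finite group and let $G\subset\mathcal G$ be a set of generators of $\mathcal G$ that is closed under inverses ($\delta^{-1}\in G$ for all $\delta\in G$) and conjugacy-invariant ($g\delta g^{-1}\in G$ for all $\delta\in G$, $g\in\mathcal G$). Let $c:\mathcal G\times G\to(0,\infty)$ and let $\pi$ be a probability measure on $\mathcal G$ with $c(x,\delta)\pi(x)=c(\delta x,\delta^{-1})\pi(\delta x)$ for all $x\in\mathcal G$, $\delta\in G$. Let $(\mathcal G,Q,\pi)$ be the associated Markov triple, with generator $L\psi(x)=\sum_{\delta\in G}(\psi(\delta x)-\psi(x))c(x,\delta)$. Set $$\alpha_1:=\max\Big\{\log\tfrac{c(\delta x,\delta)}{c(x,\delta)}:\ x\in\mathcal G,\ \delta\in G,\ \delta\ne\delta^{-1}\Big\},$$ $$\alpha_2:=\max\Big\{\log\tfrac{c(\delta x,\eta)}{c(x,\eta)},\ \log\tfrac{c(\delta x,\delta\eta\delta^{-1})}{c(x,\eta)}:\ x\in\mathcal G,\ \delta,\eta\in G,\ \delta\ne\eta,\eta^{-1}\Big\},$$ $$\beta:=\max\Big\{\tfrac{c(x,\eta)}{c(x,\delta)}:\ x\in\mathcal G,\ \delta,\eta\in G\Big\},\qquad c_*:=\min\{c(x,\delta):x\in\mathcal G,\delta\in G\}.$$ (1) Suppose there is $\delta\in G$ with $\delta\ne\delta^{-1}$ (so that $\alpha_1$ is defined). If $\varepsilon:=e^{\alpha_1}+\beta(|G|-2)\big(e^{2\alpha_2}-1\big)\le1$, then $\mathrm{Ric}(\mathcal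 G,Q,\pi)\ge(1-\varepsilon)2c_*$. (2) If $\delta=\delta^{-1}$ for all $\delta\in G$ and $\varepsilon':=\beta(|G|-1)\big(e^{2\alpha_2}-1\big)\le1$, then $\mathrm{Ric}(\mathcal G,Q,\pi)\ge(1-\varepsilon')2c_*$. (If the set defining $\alpha_2$ is empty, put $\alpha_2:=0$.)
   Context: Elements $\delta\in G$ act on $\mathcal G$ by left multiplication $x\mapsto\delta x$. The rates are $Q(x,y)=\sum_{\delta\in G:\,\delta x=y}c(x,\delta)$ for $y\neq x$, $Q(x,x)=0$; the chain is irreducible and reversible with respect to $\pi$. Entropic Ricci curvature. Let $\mathcal X$ be a finite set (here $\mathcal X=\mathcal G$), $Q$ irreducible rates on $\mathcal X$, reversible w.r.t. the strictly positive probability measure $\pi$. Let $\mathscr P(\mathcal X)=\{\rho\in[0,\infty)^{\mathcal X}:\sum_x\rho(x)\pi(x)=1\}$ and $\theta(s,t)=\int_0^1 s^\alpha t^{1-\alpha}\,d\alpha$. For $\rho_0,\rho_1\in\mathscr P(\mathcal X)$ define $$\mathcal W(\rho_0,\rho_1)^2=\inf_{\rho,\psi}\ \frac12\int_0^1\sum_{x,y\in\mathcal X}(\psi_t(x)-\psi_t(y))^2\,\theta(\rho_t(x),\rho_t(y))\,Q(x,y)\pi(x)\,dt,$$ the infimum running over all sufficiently regular curves (say $\rho$ piecewise $C^1$, $\psi$ measurable) $\rho:[0,1]\to\mathscr P(\mathcal X)$, $\psi:[0,1]\to\mathbb R^{\mathcal X}$ with $\frac{d}{dt}\rho_t(x)+\sum_{y}(\psi_t(y)-\psi_t(x))\theta(\rho_t(x),\rho_t(y))Q(x,y)=0$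 for all $x$, and with $\rho|_{t=0}=\rho_0$, $\rho|_{t=1}=\rho_1$. This is a distance. The entropy is $\mathcal H(\rho)=\sum_x\pi(x)\rho(x)\log\rho(x)$. A constant speed geodesic is a curve $(\rho_t)_{t\in[0,1]}$ in $\mathscr P(\mathcal X)$ with $\mathcal W(\rho_s,\rho_t)=|s-t|\mathcal W(\rho_0,\rho_1)$ for all $s,t$. One writes $\mathrm{Ric}(\mathcal X,Q,\pi)\ge\kappa$ if for every constant speed geodesic and all $t\in[0,1]$, $$\mathcal H(\rho_t)\le(1-t)\mathcal H(\rho_0)+t\mathcal H(\rho_1)-\frac\kappa2t(1-t)\mathcal W(\rho_0,\rho_1)^2.$$ *)

(* Defs.v *)
From HB Require Import structures.
From mathcomp Require Import all_boot all_order all_algebra all_fingroup.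
From mathcomp Require Import all_classical all_reals all_analysis.

Set Implicit Arguments.
Unset Strict Implicit.
Unset Printing Implicit Defensive.

Import Order.TTheory GRing.Theory Num.Theory.
Import numFieldNormedType.Exports.

Local Open Scope classical_set_scope.
Local Open Scope ring_scope.

Section EntropicRicci.
Context {R : realType} {X : finType}.
Implicit Types (Q : X -> X -> R) (pi : X -> R) (f : X -> R).
Implicit Types (rho psi : R -> X -> R).

Definition logmean (s t : R) : R :=
  \int[lebesgue_measure]_(a in `[0, 1]) (s `^ a * t `^ (1 - a)).

Definition is_prob pi : Prop := (forall x, 0 <= pi x) /\ \sum_x pi x = 1.

(* The densities with respect to pi. *)
Definition density pi f : Prop :=
  (forall x, 0 <= f x) /\ \sum_x f x * pi x = 1.

Definition C1 (g : R -> R) : Prop :=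
  (forall t, derivable g t 1) /\ continuous (derive1 g).

(* With s = [:: s_1; ...; s_n], 0 < s_1 < ... < s_n = 1 and s_0 = 0, each
   coordinate of rho is C^1 up to the endpoints on every closed piece
   [s_i, s_(i+1)]; in particular rho is continuous on [0, 1]. *)
Definition piecewise_C1 (s : seq R) rho : Prop :=
  itv_partition 0 1 s /\
  forall i, (i < size s)%N -> forall x, exists2 g, C1 g &
    forall t : R, t \in `[nth 0 (0 :: s) i, nth 0 s i] -> rho t x = g t.

(* The continuity equation is required off the break points of rho, where its
   derivative need not exist. *)
Definition admissible Q pi f0 f1 rho psi : Prop :=
  (forall t : R, t \in `[0, 1] -> density pi (rho t)) /\
  (forall x, measurable_fun `[0 : R, 1 : R] (fun t : R => psi t x)) /\
  (exists2 s, piecewise_C1 s rho &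
    forall t : R, t \in `]0, 1[ -> t \notin s -> forall x,
      derive1 (rho ^~ x) t
      + \sum_y (psi t y - psi t x) * logmean (rho t x) (rho t y) * Q x y = 0) /\
  rho 0 = f0 /\ rho 1 = f1.

Definition curve_action Q pi rho psi : \bar R :=
  (2^-1%:E * \int[lebesgue_measure]_(t in `[0%R, 1%R])
    (\sum_x \sum_y (psi t x - psi t y) ^+ 2
       * logmean (rho t x) (rho t y) * Q x y * pi x)%:E)%E.

(* The square root of the infimum, kept in \bar R so that its finiteness is not
   built into the definition. *)
Definition W Q pi f0 f1 : \bar R :=
  sqrte (ereal_inf [set a | exists rho psi,
    admissible Q pi f0 f1 rho psi /\ a = curve_action Q pi rho psi]).

Definition entropy pi f : R := \sum_x pi x * f x * ln (f x).

Definition constant_speed_geodesic Q pi rho : Prop :=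
  (forall t : R, t \in `[0, 1] -> density pi (rho t)) /\
  (forall s t : R, s \in `[0, 1] -> t \in `[0, 1] ->
     W Q pi (rho s) (rho t) = (`|s - t|%:E * W Q pi (rho 0%R) (rho 1%R))%E).

Definition Ric_ge Q pi (kappa : R) : Prop :=
  forall rho, constant_speed_geodesic Q pi rho ->
  forall t : R, t \in `[0, 1] ->
  ((entropy pi (rho t))%:E <=
     ((1 - t) * entropy pi (rho 0) + t * entropy pi (rho 1))%:E
     - (kappa / 2 * t * (1 - t))%:E * W Q pi (rho 0%R) (rho 1%R) ^+ 2)%E.

End EntropicRicci.

Section GroupRates.
Context {R : realType} {gT : finGroupType}.
Implicit Types (G : {set gT}) (c : gT -> gT -> R).

Definition group_rates G c (x y : gT) : R :=
  if y == x then 0 else \sum_(d in G | (d * x)%g == y) c x d.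

(* The sets below are finite, so sup and inf are the maximum and the minimum
   when they are nonempty; sup of the empty set is 0. *)
Definition alpha1 G c : R :=
  sup [set r | exists x d : gT,
    [/\ d \in G, d != d^-1%g & r = ln (c (d * x)%g d / c x d)]].

Definition alpha2 G c : R :=
  sup [set r | exists x d e : gT,
    [/\ d \in G, e \in G, d != e, d != e^-1%g &
        r = ln (c (d * x)%g e / c x e) \/
        r = ln (c (d * x)%g (d * e * d^-1)%g / c x e)]].

Definition beta G c : R :=
  sup [set r | exists x d e : gT,
    [/\ d \in G, e \in G & r = c x e / c x d]].

Definition cmin G c : R :=
  inf [set r | exists x d : gT, d \in G /\ r = c x d].

End GroupRates.

(* Main.v *)
(** Writing [Gamma_a] for the Bochner quadratic form built on a geometric mean
    [s^a t^(1-a)], commuting squares of group moves [d], [e] pair up its terms into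
    nonnegative quantities, at the cost of the defect of the rates along the
    squares; this gives [Gamma_a >= kappa A_a] for every [a], where [A_a] is the
    corresponding action. Since the logarithmic mean is the integral of the
    geometric means, the heat semigroup [P_t] satisfies
    [A(rho, P_t psi) <= e^(-2 kappa t) A(P_t rho, psi)]; dually, it contracts
    the Onsager norm of tangent vectors. Flowing the point [r] of a curve for a
    time proportional to [r] adds the gradient of the entropy to the velocity, so
    that the action of the new curve controls the entropy at its end. Doing so
    along both halves of a geodesic, for small times, and comparing with the
    length of the geodesic gives the convexity of the entropy. *)
Require Import Defs.
From HB Require Import structures.
From mathcomp Require Import all_boot all_order all_algebra all_fingroup.
From mathcomp Require Import all_classical all_reals all_analysis.
From mathcomp Require Import measurable_realfun.
From mathcomp Require Import ring lra.

Set Implicit Arguments.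
Unset Strict Implicit.
Unset Printing Implicit Defensive.

Import Order.TTheory GRing.Theory Num.Theory.
Import numFieldNormedType.Exports.

Local Open Scope classical_set_scope.
Local Open Scope ring_scope.

(** The obstacle is the boundary of the simplex: where a density vanishes, the logarithmic mean
    degenerates and the entropy has infinite slope. Heating for a short time [e] moves every curve
    into the interior, and [e] is removed only in the final inequalities, by continuity of the
    semigroup and of [t ln t]. Tangent vectors are measured by duality, since contraction is then
    the gradient estimate tested at a heated function, and adding the entropy gradient is a
    completed square. The symmetrised geometric means have explicit derivatives; the Bochner
    inequality uses only their symmetry, positivity, monotonicity, homogeneity and concavity. Part
    (1) is a borderline case: summing the rates over all translates gives [alpha1 >= 0], so
    [eps <= 1] forces [eps = 1], the rates lose their defect along squares, and the bound is
    nonnegative curvature. In part (2) the positive curvature comes from moving back and forth along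
    an involution; these moves also pay for the defect along squares, whence the factor
    [1 - eps']. *)

Section Calculus.
Context {R : realType}.

Lemma is_derive_bigsum (I : Type) (r : seq I) (f : I -> R -> R) (df : I -> R)
    (t : R) :
  (forall i, is_derive t 1 (f i) (df i)) ->
  is_derive t 1 (fun t => \sum_(i <- r) f i t) (\sum_(i <- r) df i).
Proof.
move=> fdf; elim: r => [|i r IH].
  rewrite big_nil; have -> : (fun t => \sum_(i <- [::]) f i t) = cst 0.
    by apply/funext => u; rewrite big_nil.
  exact: is_derive_cst.
rewrite big_cons; have -> : (fun t => \sum_(i <- i :: r) f i t)
    = f i + (fun t => \sum_(i <- r) f i t).
  by apply/funext => u; rewrite big_cons.
exact: is_deriveD.
Qed.

Lemma cvg_bigsum (I T : Type) (F : set_system T) {FF : Filter F} (r : seq I)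
    (f : I -> T -> R) (l : I -> R) :
  (forall i, f i @ F --> l i) ->
  (fun t => \sum_(i <- r) f i t) @ F --> \sum_(i <- r) l i.
Proof.
move=> fl; elim: r => [|i r IH].
  rewrite big_nil; under eq_cvg do rewrite big_nil; exact: cvg_cst.
by rewrite big_cons; under eq_cvg do rewrite big_cons; exact: cvgD.
Qed.

Lemma is_derive_continuous (f : R -> R) (df t : R) :
  is_derive t 1 f df -> {for t, continuous f}.
Proof.
by move=> fdf; apply/differentiable_continuous/derivable1_diffP.
Qed.

Lemma derivable_is_derive (f : R -> R) (df t : R) :
  derivable f t 1 -> derive1 f t = df -> is_derive t 1 f df.
Proof. by move=> fd <-; rewrite derive1E; exact/derivableP. Qed.

Lemma is_deriveMl (k : R) (f : R -> R) (df t : R) :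
  is_derive t 1 f df -> is_derive t 1 (fun t => k * f t) (k * df).
Proof. exact: is_deriveZ. Qed.

Lemma is_deriveMr (k : R) (f : R -> R) (df t : R) :
  is_derive t 1 f df -> is_derive t 1 (fun t => f t * k) (df * k).
Proof.
move=> fd; rewrite mulrC; under eq_fun do rewrite mulrC; exact: is_deriveMl.
Qed.

Lemma is_derive_mul (f g : R -> R) (df dg t : R) :
  is_derive t 1 f df -> is_derive t 1 g dg ->
  is_derive t 1 (fun t => f t * g t) (df * g t + f t * dg).
Proof.
move=> fd gd; have H := @is_deriveM _ _ f g t 1 df dg fd gd.
by apply: is_derive_eq H _; rewrite /GRing.scale /=; ring.
Qed.

Lemma is_derive_chain (f g : R -> R) (df dg t : R) :
  is_derive (g t) 1 f df -> is_derive t 1 g dg ->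
  is_derive t 1 (fun t => f (g t)) (df * dg).
Proof. by move=> fd gd; exact: (@is_derive1_comp _ f g t df dg). Qed.

Lemma le_of_derive_ge0 (f df : R -> R) (a b : R) : a <= b ->
  {within `[a, b], continuous f} ->
  (forall t, a < t < b -> is_derive t 1 f (df t)) ->
  (forall t, a < t < b -> 0 <= df t) -> f a <= f b.
Proof.
move=> ab fc fd df0.
have h t : t \in `]a, b[ -> a < t < b by rewrite in_itv.
have D t : t \in `]a, b[ -> derivable f t 1 by move=> /h /fd [].
have E t : t \in `]a, b[ -> 0 <= derive1 f t.
  by move=> /h H; have Ht := fd _ H; rewrite derive1E derive_val df0.
by apply: (ger0_derive1_le_cc D E fc) => //; rewrite in_itv /= lexx ?ab.
Qed.

End Calculus.

(** * The heat semigroup as a matrix exponential *)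

Section HeatKernel.
Context {R : realType} {X : finType}.
Implicit Types (Q : X -> X -> R) (f : X -> R).

Definition generator Q f x := \sum_y Q x y * (f y - f x).

Definition jump_rate Q := 1 + \sum_x \sum_y Q x y.

(* The generator plus [jump_rate Q] times the identity: its entries are
   nonnegative, which makes the positivity of the semigroup evident. *)
Definition jump Q x y :=
  Q x y + (x == y)%:R * (jump_rate Q - \sum_z Q x z).

Fixpoint jump_pow Q k x y :=
  if k is k'.+1 then \sum_z jump Q x z * jump_pow Q k' z y else (x == y)%:R.

Definition heat_coef Q x y (k : nat) := jump_pow Q k x y / k`!%:R.

(** An entry of [e^(tL)], with [L] the generator: as [jump] is [L] plus [jump_rate] times the
    identity, [e^(tL)] is [e^(-jump_rate t)] times the exponential series of [jump]. *)
Definition heat_kernel Q (t : R) x y :=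
  expR (- (jump_rate Q * t)) * limn (pseries (heat_coef Q x y) t).

Definition heat Q (t : R) f x := \sum_y heat_kernel Q t x y * f y.

Context (Q : X -> X -> R).
Hypothesis Q_ge0 : forall x y, 0 <= Q x y.

Lemma sum_delta x f : \sum_y (x == y)%:R * f y = f x.
Proof.
rewrite (bigD1 x) //= eqxx mul1r big1 ?addr0 // => y yx.
by rewrite eq_sym (negbTE yx) mul0r.
Qed.

Lemma jump_rate_gt x : 1 <= jump_rate Q - \sum_z Q x z.
Proof.
rewrite /jump_rate -addrA lerDl subr_ge0 [leRHS](bigD1 x) //= lerDl.
by apply: sumr_ge0 => y _; apply: sumr_ge0.
Qed.

Lemma jump_ge0 x y : 0 <= jump Q x y.
Proof.
by rewrite addr_ge0 // mulr_ge0 // (le_trans ler01) // jump_rate_gt.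
Qed.

Lemma sum_jump x f :
  \sum_y jump Q x y * f y = generator Q f x + jump_rate Q * f x.
Proof.
under eq_bigr do rewrite mulrDl -mulrA.
rewrite big_split /= (sum_delta x (fun y => _ * f y)) /generator.
under [in RHS]eq_bigr do rewrite mulrBr.
by rewrite sumrB -mulr_suml; ring.
Qed.

Lemma jump_pow_ge0 k x y : 0 <= jump_pow Q k x y.
Proof.
elim: k x => [|k IH] x /=; first by [].
by apply: sumr_ge0 => z _; rewrite mulr_ge0 // jump_ge0.
Qed.

Lemma sum_jump_pow k x : \sum_y jump_pow Q k x y = jump_rate Q ^+ k.
Proof.
elim: k x => [|k IH] x /=.
  by rewrite expr0 -[RHS](sum_delta x (fun=> 1)); apply: eq_bigr => y _; rewrite mulr1.
rewrite exchange_big /=; under eq_bigr do rewrite -mulr_sumr IH.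
rewrite sum_jump /generator big1 ?add0r ?exprS // => y _.
by rewrite subrr mulr0.
Qed.

Lemma jump_pow_le k x y : jump_pow Q k x y <= jump_rate Q ^+ k.
Proof.
rewrite -(sum_jump_pow k x) (bigD1 y) //= lerDl.
by apply: sumr_ge0 => z _; exact: jump_pow_ge0.
Qed.

Lemma jump_powSr k x y :
  jump_pow Q k.+1 x y = \sum_z jump_pow Q k x z * jump Q z y.
Proof.
elim: k x => [|k IH] x.
  rewrite /= sum_delta (bigD1 y) //= eqxx mulr1 big1 ?addr0 //.
  by move=> z /negbTE ->; rewrite mulr0.
rewrite [LHS]/=; under eq_bigr do rewrite -/(jump_pow Q k.+1 _ y) IH mulr_sumr.
rewrite exchange_big /=; apply: eq_bigr => z _.
by rewrite mulr_suml; apply: eq_bigr => w _; rewrite mulrA.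
Qed.

Lemma jump_pow_sym (pi : X -> R) k x y :
  (forall x y, Q x y * pi x = Q y x * pi y) ->
  jump_pow Q k x y * pi x = jump_pow Q k y x * pi y.
Proof.
move=> rev; have jr z w : jump Q z w * pi z = jump Q w z * pi w.
  rewrite /jump !mulrDl rev; congr (_ + _); rewrite [w == z]eq_sym.
  by case: eqP => [->|]; rewrite ?mul0r.
elim: k x y => [|k IH] x y.
  by rewrite /= [y == x]eq_sym; case: eqP => [->|]; rewrite ?mul0r.
rewrite jump_powSr /= !mulr_suml; apply: eq_bigr => z _.
transitivity (jump_pow Q k z x * (jump Q z y * pi z)); last by rewrite jr; ring.
by rewrite mulrAC IH; ring.
Qed.

Lemma jump_rate_ge0 : 0 <= jump_rate Q.
Proof. by rewrite addr_ge0 // sumr_ge0 // => x _; exact: sumr_ge0. Qed.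

Lemma cvg_heat_coef x y t : cvgn (pseries (heat_coef Q x y) t).
Proof.
apply: normed_cvg.
apply: (@series_le_cvg _ _ (exp_coeff (jump_rate Q * `|t|))).
- by move=> n /=.
- by move=> n; rewrite exp_coeff_ge0 // mulr_ge0 // jump_rate_ge0.
- move=> n /=; rewrite /exp_coeff /= !normrM normfV normrX exprMn.
  rewrite normr_nat [`|jump_pow _ _ _ _|]ger0_norm ?jump_pow_ge0 //.
  rewrite [leLHS]mulrAC ler_wpM2r ?invr_ge0 //.
  by rewrite ler_wpM2r ?exprn_ge0 // jump_pow_le.
- exact: is_cvg_series_exp_coeff.
Qed.

(** This is [d/dt e^(tJ) = J e^(tJ)] at the level of coefficients, with [J] for [jump]: the factor
    [k + 1] of the formal derivative cancels against the factorial. *)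
Lemma pseries_diffs_heat_coef x y :
  pseries_diffs (heat_coef Q x y) =
  fun k => \sum_z jump Q x z * heat_coef Q z y k.
Proof.
apply/funext => k; rewrite /pseries_diffs /heat_coef factS natrM invfM.
rewrite mulrCA [X in _ * X]mulrA divff ?pnatr_eq0 // mul1r /= mulr_suml.
by apply: eq_bigr => z _; rewrite mulrA.
Qed.

Lemma pseries_sumE (I : finType) (a : I -> R) (c : I -> nat -> R) t :
  (forall i, cvgn (pseries (c i) t)) ->
  pseries (fun k => \sum_i a i * c i k) t @ \oo -->
    \sum_i a i * limn (pseries (c i) t).
Proof.
move=> cc.
have -> : pseries (fun k => \sum_i a i * c i k) t =
    fun n => \sum_i a i * pseries (c i) t n.
  apply/funext => n; rewrite /pseries /series /=.
  under eq_bigr do rewrite mulr_suml.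
  rewrite exchange_big /=; apply: eq_bigr => i _.
  by rewrite mulr_sumr; apply: eq_bigr => k _; rewrite mulrA.
by apply: cvg_bigsum => i; apply: cvgMr; exact: cc.
Qed.

Lemma cvg_pseries_diffs_heat_coef x y t :
  pseries (pseries_diffs (heat_coef Q x y)) t @ \oo -->
  \sum_z jump Q x z * limn (pseries (heat_coef Q z y) t).
Proof.
rewrite pseries_diffs_heat_coef; apply: pseries_sumE => z; exact: cvg_heat_coef.
Qed.

Lemma is_derive_heat_series x y (t : R) :
  is_derive t 1 (fun t => limn (pseries (heat_coef Q x y) t))
    (\sum_z jump Q x z * limn (pseries (heat_coef Q z y) t)).
Proof.
(* Termwise differentiation at [t] requires the series and its first two formal derivatives to
   converge at a point of larger modulus, here [|t| + 1]. *)
have H := @pseries_snd_diffs R (heat_coef Q x y) (`|t| + 1) t.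
apply: is_derive_eq (H _ _ _ _) _.
- exact: cvg_heat_coef.
- apply/cvg_ex; eexists; exact: cvg_pseries_diffs_heat_coef.
- apply/cvg_ex; exists (\sum_z jump Q x z *
    limn (pseries (pseries_diffs (heat_coef Q z y)) (`|t| + 1))).
  have -> : pseries_diffs (pseries_diffs (heat_coef Q x y)) =
      fun k => \sum_z jump Q x z * pseries_diffs (heat_coef Q z y) k.
    rewrite [in LHS]pseries_diffs_heat_coef; apply/funext => k.
    rewrite /pseries_diffs mulr_sumr; apply: eq_bigr => z _.
    by rewrite mulrCA.
  apply: pseries_sumE => z; apply/cvg_ex; eexists.
  exact: cvg_pseries_diffs_heat_coef.
- by rewrite [ltRHS]ger0_norm ?addr_ge0 // ltrDl.
- exact/cvg_lim/cvg_pseries_diffs_heat_coef.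
Qed.

Lemma is_derive_heat_kernel x y (t : R) :
  is_derive t 1 (fun t => heat_kernel Q t x y)
    (generator Q (fun z => heat_kernel Q t z y) x).
Proof.
have E : is_derive t 1 (fun t => expR (- (jump_rate Q * t)))
    (expR (- (jump_rate Q * t)) * - jump_rate Q).
  apply: (@is_derive_chain _ expR (fun t => - (jump_rate Q * t))).
  under eq_fun do rewrite -mulNr.
  by apply: is_derive_eq (is_deriveMl _ (is_derive_id t 1)) _; rewrite mulr1.
apply: is_derive_eq (is_derive_mul E (is_derive_heat_series x y t)) _.
rewrite sum_jump /heat_kernel; set e := expR _.
have -> : generator Q (fun z => e * limn (pseries (heat_coef Q z y) t)) x =
    e * generator Q (fun z => limn (pseries (heat_coef Q z y) t)) x.
  by rewrite /generator mulr_sumr; apply: eq_bigr => z _; ring.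
by ring.
Qed.

Lemma heat_kernel0 x y : heat_kernel Q 0 x y = (x == y)%:R.
Proof.
rewrite /heat_kernel mulr0 oppr0 expR0 mul1r; apply: lim_near_cst => //.
near=> n; rewrite -[n]prednK; last by near: n.
rewrite /pseries /series /= big_nat_recl //= big1_seq ?addr0.
  by rewrite /heat_coef /= invr1 !mulr1.
by move=> i _; rewrite exprS mul0r mulr0.
Unshelve. all: by end_near. Qed.

(** All terms are nonnegative, so each is a lower bound of the sum. The term [k = 0] gives
    nonnegativity of the kernel; the term whose index is the length of a path gives strict
    positivity. *)
Lemma heat_series_ge x y k t : 0 <= t ->
  heat_coef Q x y k * t ^+ k <= limn (pseries (heat_coef Q x y) t).
Proof.
move=> t0; apply: limr_ge; first exact: cvg_heat_coef.
near=> n; rewrite /pseries /series /= (bigD1_seq k) //= ?iota_uniq //.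
  rewrite lerDl; apply: sumr_ge0 => i _.
  by rewrite mulr_ge0 ?exprn_ge0 // divr_ge0 // jump_pow_ge0.
by rewrite mem_index_iota /=; near: n; exact: nbhs_infty_gt.
Unshelve. all: by end_near. Qed.

Lemma heat_kernel_ge0 t x y : 0 <= t -> 0 <= heat_kernel Q t x y.
Proof.
move=> t0; rewrite mulr_ge0 ?expR_ge0 //.
apply: le_trans (heat_series_ge x y 0 t0).
by rewrite expr0 mulr1 divr_ge0 // jump_pow_ge0.
Qed.

Lemma heat_kernel_gt0 t x y : 0 < t ->
  connect (fun x y => 0 < Q x y) x y -> 0 < heat_kernel Q t x y.
Proof.
move=> t0 xy; rewrite mulr_gt0 ?expR_gt0 //.
have [k k0] : exists k, 0 < jump_pow Q k x y.
  have /connectP[p] := xy; elim: p x {xy} => [|z p IH] x /=.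
    by move=> _ ->; exists 0%N; rewrite /= eqxx.
  move=> /andP[xz pz] /(IH _ pz)[k k0]; exists k.+1.
  rewrite /= (bigD1 z) //= ltr_wpDr //.
    by apply: sumr_ge0 => w _; rewrite mulr_ge0 ?jump_ge0 ?jump_pow_ge0.
  rewrite mulr_gt0 // ltr_wpDr // mulr_ge0 //.
  by rewrite (le_trans ler01) // jump_rate_gt.
apply: lt_le_trans (heat_series_ge x y k (ltW t0)).
by rewrite mulr_gt0 ?exprn_gt0 // divr_gt0 // ltr0n fact_gt0.
Qed.

Lemma heat_kernel_sym (pi : X -> R) t x y :
  (forall x y, Q x y * pi x = Q y x * pi y) ->
  heat_kernel Q t x y * pi x = heat_kernel Q t y x * pi y.
Proof.
move=> rev; rewrite /heat_kernel -!mulrA; congr (_ * _).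
have H z w : limn (pseries (heat_coef Q z w) t) * pi z =
    limn (pseries (fun k => heat_coef Q z w k * pi z) t).
  apply/esym/cvg_lim => //.
  have -> : pseries (fun k => heat_coef Q z w k * pi z) t =
      fun n => pseries (heat_coef Q z w) t n * pi z.
    apply/funext => n; rewrite /pseries /series /= mulr_suml.
    by apply: eq_bigr => i _; rewrite mulrAC.
  by apply: cvgMl; exact: cvg_heat_coef.
rewrite !H; congr (limn (pseries _ t)); apply/funext => k.
by rewrite /heat_coef mulrAC (jump_pow_sym _ _ _ rev) mulrAC.
Qed.

Lemma is_derive_heat f x (t : R) :
  is_derive t 1 (fun t => heat Q t f x) (generator Q (heat Q t f) x).
Proof.
apply: is_derive_eq.
  by apply: is_derive_bigsum => y; apply: is_deriveMr; exact: is_derive_heat_kernel.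
rewrite /generator; under eq_bigr do rewrite mulr_suml.
rewrite exchange_big /=; apply: eq_bigr => z _.
rewrite /heat -sumrB mulr_sumr; apply: eq_bigr => y _; ring.
Qed.

Lemma heat0 f x : heat Q 0 f x = f x.
Proof. by rewrite /heat; under eq_bigr do rewrite heat_kernel0; exact: sum_delta. Qed.

(** The rows of the [k]-th power of [jump] sum to [jump_rate ^+ k], so the rows of the series sum to
    an exponential that cancels the prefactor. *)
Lemma heat_cst t (k : R) x : heat Q t (fun=> k) x = k.
Proof.
rewrite /heat -mulr_suml -[RHS]mul1r; congr (_ * _).
rewrite /heat_kernel -mulr_sumr.
have -> : \sum_y limn (pseries (heat_coef Q x y) t) = expR (jump_rate Q * t).
  have H := @pseries_sumE X (fun=> 1) (heat_coef Q x) t (fun y => @cvg_heat_coef x y t).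
  under eq_bigr do rewrite -[limn _]mul1r.
  rewrite -(cvg_lim _ H) //; congr (limn _); apply/funext => n.
  rewrite /pseries /series /=; apply: eq_bigr => k0 _.
  under eq_bigr do rewrite mul1r.
  by rewrite /heat_coef -mulr_suml sum_jump_pow /exp_coeff /= exprMn mulrAC.
by rewrite -expRD addNr expR0.
Qed.

End HeatKernel.

(** * Weighted geometric means and their symmetrisation *)

Section GeometricMean.
Context {R : realType}.
Implicit Types (a s t u v : R).

Definition gmean a s t := expR (a * ln s + (1 - a) * ln t).

Lemma powR_gmean a s t : 0 < s -> 0 < t -> s `^ a * t `^ (1 - a) = gmean a s t.
Proof. by move=> s0 t0; rewrite /powR !gt_eqF // -expRD. Qed.

Lemma gmean_gt0 a s t : 0 < gmean a s t.
Proof. exact: expR_gt0. Qed.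

Lemma gmeanM a (k : R) s t : 0 < k -> 0 < s -> 0 < t ->
  gmean a (k * s) (k * t) = k * gmean a s t.
Proof.
move=> k0 s0 t0; rewrite /gmean !lnM ?posrE //.
rewrite -[X in X * expR _](@lnK _ k) ?posrE // -expRD; congr expR; ring.
Qed.

Lemma gmean_le a s t u v : 0 <= a <= 1 -> 0 < s -> 0 < t ->
  s <= u -> t <= v -> gmean a s t <= gmean a u v.
Proof.
move=> /andP[a0 a1] s0 t0 su tv; rewrite ler_expR lerD // ler_wpM2l ?subr_ge0 //.
  by rewrite ler_ln ?posrE // (lt_le_trans s0).
by rewrite ler_ln ?posrE // (lt_le_trans t0).
Qed.

(* The supporting hyperplane at [(s, t)] of the concave function [gmean a]. *)
Lemma gmean_tangent a s t u v : 0 <= a <= 1 ->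
  0 < s -> 0 < t -> 0 < u -> 0 < v ->
  gmean a u v <= gmean a s t * (a * (u / s) + (1 - a) * (v / t)).
Proof.
move=> /andP[a0 a1] s0 t0 u0 v0.
have lnle (x : R) : 0 < x -> ln x <= x - 1.
  by move=> x0; have := expR_ge1Dx (ln x); rewrite lnK // -lerBrDl; lra.
have q0 : 0 < gmean a u v / gmean a s t by rewrite divr_gt0 ?gmean_gt0.
set q := gmean a u v / gmean a s t in q0 *.
rewrite -ler_pdivrMl ?gmean_gt0 // mulrC -/q.
have lq : ln q = a * ln (u / s) + (1 - a) * ln (v / t).
  rewrite /q !ln_div ?posrE ?gmean_gt0 // /gmean !expRK; ring.
have H1 := lnle (u / s / q) (divr_gt0 (divr_gt0 u0 s0) q0).
have H2 := lnle (v / t / q) (divr_gt0 (divr_gt0 v0 t0) q0).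
have lnq (x : R) : 0 < x -> ln (x / q) = ln x - ln q.
  by move=> x0; rewrite ln_div ?posrE.
rewrite lnq ?divr_gt0 // in H1; rewrite lnq ?divr_gt0 // in H2.
have H : 0 <= (a * (u / s) + (1 - a) * (v / t)) / q - 1.
  have := lerD (ler_wpM2l a0 H1) (ler_wpM2l (_ : 0 <= 1 - a) H2).
  rewrite subr_ge0 => /(_ a1).
  have -> : (a * (u / s) + (1 - a) * (v / t)) / q =
      a * (u / s / q) + (1 - a) * (v / t / q) by ring.
  have -> : a * (ln (u / s) - ln q) + (1 - a) * (ln (v / t) - ln q) = 0.
    by rewrite lq; ring.
  lra.
by rewrite subr_ge0 ler_pdivlMr // mul1r in H.
Qed.

Definition smean a s t := (gmean a s t + gmean a t s) / 2.

(** The partial derivative of [smean a] in its first argument; by symmetry [smean1 a t s] is the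
    other one. *)
Definition smean1 a s t := (a * gmean a s t + (1 - a) * gmean a t s) / s / 2.

Lemma smeanC a s t : smean a s t = smean a t s.
Proof. by rewrite /smean addrC. Qed.

Lemma smean_gt0 a s t : 0 < smean a s t.
Proof. by rewrite divr_gt0 // addr_gt0 ?gmean_gt0. Qed.

Lemma smean1_ge0 a s t : 0 <= a <= 1 -> 0 < s -> 0 <= smean1 a s t.
Proof.
move=> /andP[a0 a1] s0; rewrite divr_ge0 // divr_ge0 ?(ltW s0) //.
by apply: addr_ge0; rewrite mulr_ge0 ?subr_ge0 // ltW ?gmean_gt0.
Qed.

Lemma smean_euler a s t : 0 < s -> 0 < t ->
  smean1 a s t * s + smean1 a t s * t = smean a s t.
Proof.
move=> s0 t0; rewrite /smean1 /smean; have := gt_eqF s0; have := gt_eqF t0.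
by move=> /negbT ? /negbT ?; field; apply/andP; split.
Qed.

(** Concavity; by Euler's identity the supporting plane at [(s, t)] passes through the origin, so it
    has no constant term. *)
Lemma smean_tangent a s t u v : 0 <= a <= 1 ->
  0 < s -> 0 < t -> 0 < u -> 0 < v ->
  smean a u v <= smean1 a s t * u + smean1 a t s * v.
Proof.
move=> a01 s0 t0 u0 v0.
have H1 := gmean_tangent a01 s0 t0 u0 v0.
have H2 := gmean_tangent a01 t0 s0 v0 u0.
have -> : smean1 a s t * u + smean1 a t s * v =
    (gmean a s t * (a * (u / s) + (1 - a) * (v / t))
     + gmean a t s * (a * (v / t) + (1 - a) * (u / s))) / 2.
  rewrite /smean1; have := gt_eqF s0; have := gt_eqF t0.
  by move=> /negbT ? /negbT ?; field; apply/andP; split.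
by rewrite ler_wpM2r // lerD.
Qed.

Lemma is_derive_gmean a (f g : R -> R) (df dg t : R) :
  0 < f t -> 0 < g t -> is_derive t 1 f df -> is_derive t 1 g dg ->
  is_derive t 1 (fun t => gmean a (f t) (g t))
    (gmean a (f t) (g t) * (a * (df / f t) + (1 - a) * (dg / g t))).
Proof.
move=> f0 g0 fd gd; rewrite /gmean.
apply: (@is_derive_chain _ expR (fun t => a * ln (f t) + (1 - a) * ln (g t))).
apply: is_derive_eq (is_deriveD (is_deriveMl a _) (is_deriveMl (1 - a) _)) _.
- exact: is_derive_chain (is_derive1_ln f0) fd.
- exact: is_derive_chain (is_derive1_ln g0) gd.
- by rewrite ![_^-1 * _]mulrC.
Qed.

Lemma is_derive_smean a (f g : R -> R) (df dg t : R) :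
  0 < f t -> 0 < g t -> is_derive t 1 f df -> is_derive t 1 g dg ->
  is_derive t 1 (fun t => smean a (f t) (g t))
    (smean1 a (f t) (g t) * df + smean1 a (g t) (f t) * dg).
Proof.
move=> f0 g0 fd gd.
apply: is_derive_eq (is_deriveMr 2^-1 (is_deriveD
  (is_derive_gmean a f0 g0 fd gd) (is_derive_gmean a g0 f0 gd fd))) _.
rewrite /smean1; have := gt_eqF f0; have := gt_eqF g0.
by move=> /negbT ? /negbT ?; field; apply/andP; split.
Qed.

End GeometricMean.

(** * The logarithmic mean *)

Section LogMean.
Context {R : realType}.
Implicit Types (a s t u v : R).
Notation mu := (@lebesgue_measure R).

Lemma continuous_gmean s t : continuous (fun a => gmean a s t).
Proof.
move=> a; apply: continuous_comp; last exact: continuous_expR.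
apply: cvgD; apply: cvgM; try exact: cvg_cst; try exact: cvg_id.
by apply: cvgB; [exact: cvg_cst|exact: cvg_id].
Qed.

Lemma integrable_gmean s t : mu.-integrable `[0, 1] (EFin \o (fun a => gmean a s t)).
Proof.
apply: continuous_compact_integrable; first exact: segment_compact.
exact/continuous_subspaceT/continuous_gmean.
Qed.

(** As a function of [a], [gmean a s t] is the exponential of an affine function of slope
    [ln s - ln t], so the integrand times this slope is an exact derivative. *)
Lemma Rintegral_gmean s t :
  (ln s - ln t) * (\int[mu]_(a in `[0, 1]) gmean a s t) = expR (ln s) - expR (ln t).
Proof.
rewrite -RintegralZl //; last exact: integrable_gmean.
rewrite /Rintegral (@continuous_FTC2 R _ (fun a => gmean a s t)) //.
- by rewrite /gmean subrr subr0 !mul0r !mul1r add0r addr0.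
- apply/continuous_subspaceT => a; apply: cvgMr; exact: continuous_gmean.
- split.
  + move=> a _; have [] // : is_derive a 1 (fun a => gmean a s t)
      ((ln s - ln t) * gmean a s t).
    rewrite /gmean mulrC; apply: (@is_derive_chain _ expR).
    have -> : (fun a => a * ln s + (1 - a) * ln t)
        = (fun a => (ln s - ln t) * a + ln t) by apply/funext => x; ring.
    apply: is_derive_eq (is_deriveD (is_deriveMl _ (is_derive_id a 1))
      (is_derive_cst (ln t) a 1)) _; by rewrite addr0 mulr1.
  + by apply: cvg_at_right_filter; exact: continuous_gmean.
  + by apply: cvg_at_left_filter; exact: continuous_gmean.
- move=> a _; rewrite derive1E.
  have H : is_derive a 1 (fun a => gmean a s t) ((ln s - ln t) * gmean a s t).
    rewrite /gmean mulrC; apply: (@is_derive_chain _ expR).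
    have -> : (fun a => a * ln s + (1 - a) * ln t)
        = (fun a => (ln s - ln t) * a + ln t) by apply/funext => x; ring.
    apply: is_derive_eq (is_deriveD (is_deriveMl _ (is_derive_id a 1))
      (is_derive_cst (ln t) a 1)) _; by rewrite addr0 mulr1.
  by rewrite derive_val.
Qed.

Lemma logmeanE s t : 0 < s -> 0 < t ->
  logmean s t = \int[mu]_(a in `[0, 1]) gmean a s t.
Proof.
by move=> s0 t0; apply: eq_Rintegral => a _; rewrite powR_gmean.
Qed.

Lemma logmean_ln s t : 0 < s -> 0 < t -> s - t = logmean s t * (ln s - ln t).
Proof.
by move=> s0 t0; rewrite logmeanE // mulrC Rintegral_gmean !lnK.
Qed.

Lemma logmeanxx s : 0 < s -> logmean s s = s.
Proof.
move=> s0; rewrite logmeanE //.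
have -> : (fun a => gmean a s s) = cst s.
  by apply/funext => a; rewrite /gmean -mulrDl addrCA subrr addr0 mul1r lnK.
by rewrite Rintegral_cst //= lebesgue_measure_itv /= lte01 /= oppr0 addr0 mulr1.
Qed.

Lemma logmean_neq s t : 0 < s -> 0 < t -> s != t ->
  logmean s t = (s - t) / (ln s - ln t).
Proof.
move=> s0 t0 st; rewrite [X in X / _]logmean_ln // mulfK // subr_eq0.
by apply: contra st => /eqP /ln_inj -> //.
Qed.

Lemma logmeanC_pos s t : 0 < s -> 0 < t -> logmean s t = logmean t s.
Proof.
move=> s0 t0; have [->//|st] := eqVneq s t.
rewrite !logmean_neq // 1?eq_sym //.
by rewrite -(opprB s t) -(opprB (ln s) (ln t)) invrN mulrNN.
Qed.

Lemma logmean0l t : logmean 0 t = 0.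
Proof.
(* At [a = 0] the integrand contains [0 ^ 0 = 1]; dropping this endpoint leaves the zero
   function. *)
rewrite /logmean -Rintegral_itv_obnd_cbnd; last first.
  apply: (@eq_integrable _ _ _ _ _ _ (cst 0%E)) => //; last exact: integrable0.
  move=> a; rewrite inE /= in_itv /= => /andP[a0 _].
  by rewrite powR0 ?mul0r // gt_eqF.
under eq_Rintegral => a.
  rewrite inE /= in_itv /= => /andP[a0 _]; rewrite powR0 ?mul0r ?gt_eqF //.
  over.
by rewrite Rintegral_cst //= mul0r.
Qed.

Lemma logmean0r s : logmean s 0 = 0.
Proof.
rewrite /logmean -Rintegral_itv_bndo_bndc; last first.
  apply: (@eq_integrable _ _ _ _ _ _ (cst 0%E)) => //; last exact: integrable0.
  move=> a; rewrite inE /= in_itv /= => /andP[_ a1].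
  by rewrite powR0 ?mulr0 // subr_eq0 gt_eqF.
under eq_Rintegral => a.
  rewrite inE /= in_itv /= => /andP[_ a1]; rewrite powR0 ?mulr0 ?subr_eq0 ?gt_eqF //.
  over.
by rewrite Rintegral_cst //= mul0r.
Qed.

Lemma logmean_ge0 s t : 0 <= logmean s t.
Proof. by apply: Rintegral_ge0 => a _; rewrite mulr_ge0 // powR_ge0. Qed.

Lemma logmeanC s t : 0 <= s -> 0 <= t -> logmean s t = logmean t s.
Proof.
rewrite !le_eqVlt => /predU1P[<-|s0]; first by rewrite logmean0l logmean0r.
by move=> /predU1P[<-|t0]; [rewrite logmean0l logmean0r|exact: logmeanC_pos].
Qed.

Lemma logmean_le s t u v : 0 <= s -> 0 <= t -> s <= u -> t <= v ->
  logmean s t <= logmean u v.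
Proof.
rewrite [0 <= s]le_eqVlt => /predU1P[<-|s0]; first by rewrite logmean0l logmean_ge0.
rewrite [0 <= t]le_eqVlt => /predU1P[<-|t0]; first by rewrite logmean0r logmean_ge0.
move=> su tv; have u0 := lt_le_trans s0 su; have v0 := lt_le_trans t0 tv.
rewrite !logmeanE //.
apply: le_Rintegral => //; try exact: integrable_gmean.
by move=> a; rewrite /= in_itv /= => a01; exact: gmean_le.
Qed.

Lemma logmeanM k s t : 0 < k -> 0 < s -> 0 < t ->
  logmean (k * s) (k * t) = k * logmean s t.
Proof.
move=> k0 s0 t0; rewrite !logmeanE ?mulr_gt0 // -RintegralZl //.
  by apply: eq_Rintegral => a _; rewrite gmeanM.
exact: integrable_gmean.
Qed.

Lemma logmean_gt0 s t : 0 < s -> 0 < t -> 0 < logmean s t.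
Proof.
move=> s0 t0; have m0 : 0 < Num.min s t by rewrite lt_min s0.
apply: (lt_le_trans m0); rewrite -[leLHS](logmeanxx m0).
by apply: logmean_le; rewrite ?(ltW m0) // ge_min lexx ?orbT.
Qed.

Lemma cvg_logmean (T : Type) (F : set_system T) {FF : Filter F}
    (f g : T -> R) s t : 0 < s -> 0 < t -> f @ F --> s -> g @ F --> t ->
  (fun x => logmean (f x) (g x)) @ F --> logmean s t.
Proof.
move=> s0 t0 fs gt; have th0 := logmean_gt0 s0 t0.
(* Monotonicity and homogeneity squeeze the mean between the multiples
   [1 - e] and [1 + e] of its limit. *)
apply/cvgrPdist_le => /= d d0.
pose e := Num.min (1 / 2) (d / logmean s t).
have e0 : 0 < e by rewrite lt_min !divr_gt0.
have e1 : e < 1 by rewrite gt_min ltr_pdivrMr // mul1r ltr1n.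
have ed : e * logmean s t <= d by rewrite -ler_pdivlMr // ge_min lexx orbT.
near=> x.
have fx1 : (1 - e) * s <= f x.
  apply: ltW; near: x; apply: (cvgr_gt s) => //; by rewrite gtr_pMl // gtrDl oppr_lt0.
have fx2 : f x <= (1 + e) * s.
  apply: ltW; near: x; apply: (cvgr_lt s) => //; by rewrite ltr_pMl // ltrDl.
have gx1 : (1 - e) * t <= g x.
  apply: ltW; near: x; apply: (cvgr_gt t) => //; by rewrite gtr_pMl // gtrDl oppr_lt0.
have gx2 : g x <= (1 + e) * t.
  apply: ltW; near: x; apply: (cvgr_lt t) => //; by rewrite ltr_pMl // ltrDl.
have p1 : 0 < 1 - e by rewrite subr_gt0.
have p2 : 0 < 1 + e by rewrite addr_gt0.
have s1 := mulr_gt0 p1 s0; have t1 := mulr_gt0 p1 t0.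
have L := logmean_le (ltW s1) (ltW t1) fx1 gx1.
have U := logmean_le (le_trans (ltW s1) fx1) (le_trans (ltW t1) gx1) fx2 gx2.
rewrite !logmeanM // in L U; rewrite ler_norml.
rewrite mulrBl mul1r lerBlDr in L; rewrite mulrDl mul1r in U; apply/andP; split.
  by rewrite lerBrDr addrC lerBlDr (le_trans U) // lerD2l.
by rewrite lerBlDr addrC (le_trans L) // lerD2l.
Unshelve. all: by end_near. Qed.

End LogMean.

(** * The weighted Dirichlet form, the generator and their interplay *)

Section WeightedForm.
Context {R : realType} {X : finType}.
Variables (Q : X -> X -> R) (pi : X -> R).
Implicit Types (th : R -> R -> R) (rho phi psi f g v : X -> R) (s t : R).

Definition inner f g := \sum_x f x * g x * pi x.

Definition dform th rho phi psi :=
  2^-1 * \sum_x \sum_y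
    (phi x - phi y) * (psi x - psi y) * th (rho x) (rho y) * (Q x y * pi x).

Definition energy rho psi := dform logmean rho psi psi.

(* [n] bounds the squared norm of the tangent vector [v] at [rho], by duality. *)
Definition speed_le rho v n :=
  forall phi, 2 * inner phi v - energy rho phi <= n.

Lemma innerDl f g v : inner (fun x => f x + g x) v = inner f v + inner g v.
Proof. by rewrite /inner -big_split; apply: eq_bigr => x _ /=; ring. Qed.

Lemma innerDr f g v : inner v (fun x => f x + g x) = inner v f + inner v g.
Proof. by rewrite /inner -big_split; apply: eq_bigr => x _ /=; ring. Qed.

Lemma innerZl (k : R) f v : inner (fun x => k * f x) v = k * inner f v.
Proof. by rewrite /inner mulr_sumr; apply: eq_bigr => x _; ring. Qed.

Lemma innerZr (k : R) f v : inner v (fun x => k * f x) = k * inner v f.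
Proof. by rewrite /inner mulr_sumr; apply: eq_bigr => x _; ring. Qed.

Lemma inner1 v : inner (fun=> 1) v = \sum_x v x * pi x.
Proof. by apply: eq_bigr => x _; rewrite mul1r. Qed.

Lemma dformC th rho phi psi : dform th rho phi psi = dform th rho psi phi.
Proof.
by congr (_ * _); apply: eq_bigr => x _; apply: eq_bigr => y _; ring.
Qed.

Lemma dformDl th rho f g psi :
  dform th rho (fun x => f x + g x) psi = dform th rho f psi + dform th rho g psi.
Proof.
rewrite /dform -mulrDr -big_split; congr (_ * _); apply: eq_bigr => x _ /=.
by rewrite -big_split; apply: eq_bigr => y _ /=; ring.
Qed.

Lemma dformZl th rho (k : R) f psi :
  dform th rho (fun x => k * f x) psi = k * dform th rho f psi.
Proof.
rewrite /dform mulrCA; congr (2^-1 * _); rewrite mulr_sumr; apply: eq_bigr => x _ /=.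
by rewrite mulr_sumr; apply: eq_bigr => y _ /=; ring.
Qed.

Lemma energyZ rho (k : R) psi :
  energy rho (fun x => k * psi x) = k ^+ 2 * energy rho psi.
Proof. by rewrite /energy dformZl dformC dformZl; ring. Qed.

Lemma energyD rho f g :
  energy rho (fun x => f x + g x) = energy rho f + 2 * dform logmean rho f g + energy rho g.
Proof.
by rewrite /energy dformDl 2!(dformC logmean rho _ (fun x => _ + _)) !dformDl
  (dformC _ _ g f); ring.
Qed.

Hypothesis Q_ge0 : forall x y, 0 <= Q x y.
Hypothesis pi_ge0 : forall x, 0 <= pi x.
Hypothesis rev : forall x y, Q x y * pi x = Q y x * pi y.

Lemma energy_ge0 rho psi : 0 <= energy rho psi.
Proof.
rewrite mulr_ge0 //; apply: sumr_ge0 => x _; apply: sumr_ge0 => y _.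
apply: mulr_ge0; last exact: mulr_ge0.
by apply: mulr_ge0; [rewrite -expr2 sqr_ge0|exact: logmean_ge0].
Qed.

Lemma energy_le rho rho' psi : (forall x, 0 <= rho x <= rho' x) ->
  energy rho psi <= energy rho' psi.
Proof.
move=> le; apply: ler_wpM2l; first by rewrite invr_ge0.
apply: ler_sum => x _; apply: ler_sum => y _; apply: ler_wpM2r; first exact: mulr_ge0.
apply: ler_wpM2l; first by rewrite -expr2 sqr_ge0.
by have /andP[? ?] := le x; have /andP[? ?] := le y; exact: logmean_le.
Qed.

(* Reversibility makes both ends of an edge contribute equally. *)
Lemma sum_edge_sym (a b : X -> X -> R) :
  (forall x y, b x y = a y x) ->
  \sum_x \sum_y (a x y + b x y) * (Q x y * pi x) =
  2 * \sum_x \sum_y a x y * (Q x y * pi x).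
Proof.
move=> ba; under eq_bigr do under eq_bigr do rewrite mulrDl.
under eq_bigr do rewrite big_split /=; rewrite big_split /=.
rewrite mulr_natl mulr2n; congr (_ + _); rewrite exchange_big /=.
by apply: eq_bigr => x _; apply: eq_bigr => y _; rewrite ba rev.
Qed.

Lemma inner_generator phi f :
  inner phi (generator Q f) =
  - (2^-1 * \sum_x \sum_y (phi x - phi y) * (f x - f y) * (Q x y * pi x)).
Proof.
pose a x y := phi x * (f x - f y).
have H := @sum_edge_sym a (fun x y => a y x) (fun _ _ => erefl).
transitivity (- \sum_x \sum_y a x y * (Q x y * pi x)).
  rewrite /inner /generator -sumrN; apply: eq_bigr => x _.
  rewrite -sumrN mulr_sumr mulr_suml; apply: eq_bigr => y _; rewrite /a; ring.
congr (- _); apply: (mulfI (_ : 2 != 0 :> R)) => //.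
rewrite -H mulrA divff // mul1r; apply: eq_bigr => x _; apply: eq_bigr => y _.
by rewrite /a; ring.
Qed.

(** The logarithmic mean turns differences of [rho] into differences of [ln rho]. This is what makes
    the heat flow the gradient flow of the entropy. *)
Lemma inner_generator_ln phi rho : (forall x, 0 < rho x) ->
  inner phi (generator Q rho) = - dform logmean rho phi (fun x => ln (rho x)).
Proof.
move=> rho0; rewrite inner_generator /dform; congr (- (_ * _)).
apply: eq_bigr => x _; apply: eq_bigr => y _; rewrite (@logmean_ln _ (rho x)) //.
by ring.
Qed.

Lemma inner_heat t phi psi :
  inner phi (heat Q t psi) = inner (heat Q t phi) psi.
Proof.
rewrite /inner /heat; under eq_bigr do rewrite mulr_sumr mulr_suml.
rewrite exchange_big /=; apply: eq_bigr => x _.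
rewrite !mulr_suml; apply: eq_bigr => y _.
have E := heat_kernel_sym Q_ge0 t y x rev.
transitivity (phi y * psi x * (heat_kernel Q t y x * pi y)); first by ring.
by rewrite E; ring.
Qed.

Lemma heatD t f g x : heat Q t (fun x => f x + g x) x = heat Q t f x + heat Q t g x.
Proof. by rewrite /heat -big_split; apply: eq_bigr => y _ /=; ring. Qed.

Lemma heatZ t (k : R) f x : heat Q t (fun x => k * f x) x = k * heat Q t f x.
Proof. by rewrite /heat mulr_sumr; apply: eq_bigr => y _ /=; ring. Qed.

Lemma heat_ge0 t f x : 0 <= t -> (forall x, 0 <= f x) -> 0 <= heat Q t f x.
Proof.
by move=> t0 f0; apply: sumr_ge0 => y _; rewrite mulr_ge0 ?heat_kernel_ge0.
Qed.

Lemma heat_pos t f x : 0 <= t -> (forall x, 0 < f x) -> 0 < heat Q t f x.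
Proof.
move=> t0 f0; have k0 y : 0 <= heat_kernel Q t x y * f y.
  by rewrite mulr_ge0 ?heat_kernel_ge0 // ltW.
(* If the sum vanished, so would the whole row of the kernel, whereas it sums to 1. This includes
   [t = 0], where connectedness of the chain gives nothing. *)
rewrite lt_neqAle sumr_ge0 // andbT eq_sym; apply/eqP => /eqP.
rewrite psumr_eq0 // => /allP h0; have := heat_cst Q_ge0 t 1 x.
rewrite /heat big1 => [/eqP|y _]; first by rewrite eq_sym oner_eq0.
have := h0 y (mem_index_enum y); rewrite /= mulf_eq0 (gt_eqF (f0 y)) orbF.
by move=> /eqP ->; rewrite mul0r.
Qed.

(** The product rule gives one term for each end of an edge; reversibility merges the two, which
    removes the factor 1/2 of the form and leaves only the derivative at the first vertex. *)
Lemma is_derive_dform th th1 (r p : R -> X -> R) (dr dp : X -> R) (t : R) :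
  (forall (f g : R -> R) (df dg : R), 0 < f t -> 0 < g t -> is_derive t 1 f df ->
    is_derive t 1 g dg -> is_derive t 1 (fun t => th (f t) (g t))
      (th1 (f t) (g t) * df + th1 (g t) (f t) * dg)) ->
  (forall u w, th u w = th w u) ->
  (forall x, 0 < r t x) ->
  (forall x, is_derive t 1 (r ^~ x) (dr x)) ->
  (forall x, is_derive t 1 (p ^~ x) (dp x)) ->
  is_derive t 1 (fun s => dform th (r s) (p s) (p s))
    (\sum_x \sum_y (th1 (r t x) (r t y) * dr x * (p t x - p t y) ^+ 2
       + 2 * th (r t x) (r t y) * (p t x - p t y) * dp x) * (Q x y * pi x)).
Proof.
move=> thd thC r0 rd pd.
have D x y : is_derive t 1 (fun s => p s x - p s y) (dp x - dp y).
  exact: is_deriveB.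
have T x y := thd _ _ _ _ (r0 x) (r0 y) (rd x) (rd y).
have H1 x y := is_deriveMr (Q x y * pi x)
  (is_derive_mul (is_derive_mul (D x y) (D x y)) (T x y)).
apply: is_derive_eq (is_deriveMl 2^-1 (is_derive_bigsum _
  (fun x => is_derive_bigsum _ (fun y => H1 x y)))) _.
pose a x y := th1 (r t x) (r t y) * dr x * (p t x - p t y) ^+ 2
       + 2 * th (r t x) (r t y) * (p t x - p t y) * dp x.
have H := @sum_edge_sym a (fun x y => a y x) (fun _ _ => erefl).
apply: (mulfI (_ : 2 != 0 :> R)) => //; rewrite -H mulrA divff // mul1r.
apply: eq_bigr => x _; apply: eq_bigr => y _; rewrite /a (thC (r t y)) /=.
by congr (_ * _); ring.
Qed.

End WeightedForm.

(** * From the Bochner inequality to the gradient estimate *)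

Section GradientEstimate.
Context {R : realType} {X : finType}.
Variables (Q : X -> X -> R) (pi : X -> R) (kappa : R).
Implicit Types (rho phi psi v : X -> R) (a s t : R).
Hypothesis Q_ge0 : forall x y, 0 <= Q x y.
Hypothesis pi_ge0 : forall x, 0 <= pi x.
Hypothesis rev : forall x y, Q x y * pi x = Q y x * pi y.

(** By [is_derive_dform], the right-hand side is the derivative of the form when [rho] moves with
    velocity [L rho] and [psi] with velocity [- L psi], [L] being the generator. *)
Definition bochner (th th1 : R -> R -> R) :=
  forall rho psi, (forall x, 0 < rho x) ->
  2 * kappa * dform Q pi th rho psi psi <=
  \sum_x \sum_y (th1 (rho x) (rho y) * generator Q rho x * (psi x - psi y) ^+ 2
    - 2 * th (rho x) (rho y) * (psi x - psi y) * generator Q psi x)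
      * (Q x y * pi x).

Lemma gradient_estimate_smean a rho psi t :
  bochner (smean a) (smean1 a) -> 0 <= t -> (forall x, 0 < rho x) ->
  dform Q pi (smean a) rho (heat Q t psi) (heat Q t psi) <=
  expR (- (2 * kappa * t)) * dform Q pi (smean a) (heat Q t rho) psi psi.
Proof.
move=> be t0 rho0.
(* Interpolation along the semigroup: the density is heated as the function is cooled, and the
   Bochner inequality makes the form, multiplied by [e^(- 2 kappa s)], nondecreasing in [s]. *)
pose r s := heat Q s rho; pose p s := heat Q (t - s) psi.
pose B s := \sum_x \sum_y (smean1 a (r s x) (r s y) * generator Q (r s) x
    * (p s x - p s y) ^+ 2 + 2 * smean a (r s x) (r s y) * (p s x - p s y)
    * - generator Q (p s) x) * (Q x y * pi x).
have Ad s : 0 <= s -> is_derive s 1 (fun s => dform Q pi (smean a) (r s) (p s) (p s)) (B s).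
  move=> s0; apply: is_derive_dform => //.
  - by move=> f g df dg; exact: is_derive_smean.
  - by move=> u w; rewrite smeanC.
  - by move=> x; exact: heat_pos.
  - by move=> x; exact: is_derive_heat.
  - move=> x; apply: is_derive_eq.
      apply: (@is_derive_chain _ (fun u => heat Q u psi x) (fun s => t - s)).
      exact: is_derive_heat.
    by rewrite /p; ring.
have Ed s : is_derive s 1 (fun s => expR (- (2 * kappa * s)))
    (expR (- (2 * kappa * s)) * - (2 * kappa)).
  apply: (@is_derive_chain _ expR (fun s => - (2 * kappa * s))).
  under eq_fun do rewrite -mulNr.
  by apply: is_derive_eq (is_deriveMl _ (is_derive_id s 1)) _; rewrite mulr1.
have Fd s (s0 : 0 <= s) := is_derive_mul (Ed s) (Ad s s0).
have : expR (- (2 * kappa * 0)) * dform Q pi (smean a) (r 0) (p 0) (p 0) <=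
    expR (- (2 * kappa * t)) * dform Q pi (smean a) (r t) (p t) (p t).
  apply: (@le_of_derive_ge0 R (fun s => expR (- (2 * kappa * s)) *
      dform Q pi (smean a) (r s) (p s) (p s)) (fun s => expR (- (2 * kappa * s)) *
      - (2 * kappa) * dform Q pi (smean a) (r s) (p s) (p s) +
      expR (- (2 * kappa * s)) * B s) 0 t t0).
  - apply: derivable_within_continuous => s; rewrite in_itv /= => /andP[s0 _].
    by have [] := Fd s s0.
  - by move=> s /andP[s0 _]; exact/Fd/ltW.
  - move=> s /andP[s0 _]; rewrite -mulrA -mulrDr mulr_ge0 ?expR_ge0 //.
    rewrite mulNr addrC subr_ge0.
    apply: (le_trans (be (r s) (p s) (fun x => heat_pos Q_ge0 x (ltW s0) rho0))).
    rewrite /B le_eqVlt; apply/orP; left; apply/eqP.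
    by apply: eq_bigr => x _; apply: eq_bigr => y _; congr (_ * _); ring.
have e0 u : heat Q 0 u = u by apply/funext => x; exact: heat0.
have p0 : p 0 = heat Q t psi by rewrite /p subr0.
have pt : p t = psi by rewrite /p subrr e0.
have r0 : r 0 = rho by exact: e0.
by rewrite p0 pt r0 mulr0 oppr0 expR0 mul1r.
Qed.

Notation mu := (@lebesgue_measure R).

Lemma integrable_smean s t : mu.-integrable `[0, 1] (EFin \o (fun a => smean a s t)).
Proof.
apply: continuous_compact_integrable; first exact: segment_compact.
apply/continuous_subspaceT => a; apply: cvgMl.
by apply: cvgD; exact: continuous_gmean.
Qed.

Lemma Rintegral_smean (s t : R) : 0 < s -> 0 < t ->
  \int[mu]_(a in `[0, 1]) smean a s t = logmean s t.
Proof.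
move=> s0 t0; under eq_Rintegral do rewrite /smean mulrC.
rewrite RintegralZl //=; last first.
  apply: continuous_compact_integrable; first exact: segment_compact.
  by apply/continuous_subspaceT => a; apply: cvgD; exact: continuous_gmean.
rewrite RintegralD //; try exact: integrable_gmean.
by rewrite -!logmeanE // (logmeanC_pos t0 s0); field.
Qed.

Lemma Rintegral_sum (I : Type) (r : seq I) (f : I -> R -> R) :
  (forall i, mu.-integrable `[0, 1] (EFin \o f i)) ->
  mu.-integrable `[0, 1] (EFin \o (fun a => \sum_(i <- r) f i a)) /\
  \int[mu]_(a in `[0, 1]) (\sum_(i <- r) f i a) =
  \sum_(i <- r) \int[mu]_(a in `[0, 1]) f i a.
Proof.
move=> fi; elim: r => [|i r [IH1 IH2]].
  have -> : (fun a => \sum_(i <- [::]) f i a) = cst 0.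
    by apply/funext => a; rewrite big_nil.
  by rewrite big_nil; split; [exact: integrable0|rewrite Rintegral_cst //= mul0r].
have -> : (fun a => \sum_(i <- i :: r) f i a) =
    (fun a => f i a + \sum_(i <- r) f i a).
  by apply/funext => a; rewrite big_cons.
rewrite big_cons RintegralD // IH2; split => //.
exact: (integrableD _ (fi i) IH1).
Qed.

Lemma Rintegral_dform_smean rho psi : (forall x, 0 < rho x) ->
  mu.-integrable `[0, 1] (EFin \o (fun a => dform Q pi (smean a) rho psi psi)) /\
  \int[mu]_(a in `[0, 1]) dform Q pi (smean a) rho psi psi = energy Q pi rho psi.
Proof.
move=> rho0.
pose c (z : X * X) := 2^-1 * ((psi z.1 - psi z.2) * (psi z.1 - psi z.2) * (Q z.1 z.2 * pi z.1)).
have E th : dform Q pi th rho psi psi = \sum_z c z * th (rho z.1) (rho z.2).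
  rewrite /dform pair_big /= mulr_sumr; apply: eq_bigr => z _; rewrite /c; ring.
have -> : (fun a => dform Q pi (smean a) rho psi psi) =
  (fun a => \sum_z c z * smean a (rho z.1) (rho z.2)) by apply/funext => a; exact: E.
have H z : mu.-integrable `[0, 1] (EFin \o (fun a => c z * smean a (rho z.1) (rho z.2))).
  exact: (integrableZl _ (c z) (integrable_smean _ _)).
have [H1 H2] := Rintegral_sum (index_enum (X * X)%type) H.
split => //; rewrite H2 /energy E; apply: eq_bigr => z _.
by rewrite RintegralZl ?Rintegral_smean //; exact: integrable_smean.
Qed.

Hypothesis be : forall a, 0 <= a <= 1 -> bochner (smean a) (smean1 a).

Lemma gradient_estimate_pos rho psi t : 0 <= t -> (forall x, 0 < rho x) ->
  energy Q pi rho (heat Q t psi) <=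
  expR (- (2 * kappa * t)) * energy Q pi (heat Q t rho) psi.
Proof.
move=> t0 rho0; have hrho0 x := heat_pos Q_ge0 x t0 rho0.
have [i1 <-] := Rintegral_dform_smean (heat Q t psi) rho0.
have [i2 <-] := Rintegral_dform_smean psi hrho0.
rewrite -RintegralZl //; apply: le_Rintegral => //.
  exact: (integrableZl _ (expR (- (2 * kappa * t))) i2).
move=> a; rewrite /= in_itv /= => a01; apply: gradient_estimate_smean => //.
exact: be.
Qed.

Lemma cvg_energy (T : Type) (F : set_system T) {FF : Filter F}
    (r p : T -> X -> R) rho psi : (forall x, 0 < rho x) ->
  (forall x, r ^~ x @ F --> rho x) -> (forall x, p ^~ x @ F --> psi x) ->
  (fun z => energy Q pi (r z) (p z)) @ F --> energy Q pi rho psi.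
Proof.
move=> rho0 rr pp; apply: cvgMr; apply: cvg_bigsum => x; apply: cvg_bigsum => y.
apply: cvgMl; apply: cvgM; last exact: cvg_logmean.
by apply: cvgM; apply: cvgB.
Qed.

(** A vanishing density is lifted by a constant [e]. The semigroup fixes constants and the energy
    increases with the density, so the positive case applies; positivity of the heated density lets
    [e] tend to 0 on the right. *)
Lemma gradient_estimate rho psi t : 0 <= t ->
  (forall x, 0 <= rho x) -> (forall x, 0 < heat Q t rho x) ->
  energy Q pi rho (heat Q t psi) <=
  expR (- (2 * kappa * t)) * energy Q pi (heat Q t rho) psi.
Proof.
move=> t0 rho0 hrho0.
have lim : (fun e => expR (- (2 * kappa * t)) *
      energy Q pi (fun x => heat Q t rho x + e) psi) @ 0^'+ -->
    expR (- (2 * kappa * t)) * energy Q pi (heat Q t rho) psi.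
  apply: cvgMr; apply: cvg_energy => // x; last exact: cvg_cst.
  rewrite -[X in _ --> X]addr0; apply: cvgD; first exact: cvg_cst.
  by apply: cvg_at_right_filter; exact: cvg_id.
apply: (cvgr_to_ge lim); near=> e.
have e0 : 0 < e by near: e; exact: nbhs_right_gt.
apply: (@le_trans _ _ (energy Q pi (fun x => rho x + e) (heat Q t psi))).
  by apply: energy_le => // x; rewrite rho0 lerDl ltW.
have -> : (fun x => heat Q t rho x + e) = heat Q t (fun x => rho x + e).
  by apply/funext => x; rewrite heatD (heat_cst Q_ge0).
by apply: gradient_estimate_pos => // x; rewrite ltr_wpDl.
Unshelve. all: by end_near. Qed.

(* Dually, the semigroup contracts the norm of tangent vectors. *)
Lemma heat_speed_le rho v n t : 0 <= t ->
  (forall x, 0 <= rho x) -> (forall x, 0 < heat Q t rho x) ->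
  speed_le Q pi rho v n ->
  speed_le Q pi (heat Q t rho) (heat Q t v) (expR (- (2 * kappa * t)) * n).
Proof.
move=> t0 rho0 hrho0 vn phi; set e := expR _.
have e0 : 0 < e by exact: expR_gt0.
rewrite (inner_heat Q_ge0 rev); have G := gradient_estimate phi t0 rho0 hrho0.
have := vn (fun x => e^-1 * heat Q t phi x); rewrite innerZl energyZ => H.
have := ler_wpM2l (ltW e0) H; apply: le_trans.
have -> : e * (2 * (e^-1 * inner pi (heat Q t phi) v) -
    e^-1 ^+ 2 * energy Q pi rho (heat Q t phi)) =
    2 * inner pi (heat Q t phi) v - e^-1 * energy Q pi rho (heat Q t phi).
  by field; rewrite gt_eqF.
by rewrite lerD2l lerN2 ler_pdivrMl.
Qed.

End GradientEstimate.

(** * Continuity of determinants and adjugates *)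

Section MatrixLimits.
Context {R : realType}.

Lemma cvg_bigprod (I T : Type) (F : set_system T) {FF : Filter F} (r : seq I)
    (f : I -> T -> R) (l : I -> R) :
  (forall i, f i @ F --> l i) ->
  (fun t => \prod_(i <- r) f i t) @ F --> \prod_(i <- r) l i.
Proof.
move=> fl; elim: r => [|i r IH].
  rewrite big_nil; under eq_cvg do rewrite big_nil; exact: cvg_cst.
by rewrite big_cons; under eq_cvg do rewrite big_cons; exact: cvgM.
Qed.

Lemma cvg_det (T : Type) (F : set_system T) {FF : Filter F} n
    (A : T -> 'M[R]_n) (B : 'M[R]_n) :
  (forall i j, (fun t => A t i j) @ F --> B i j) ->
  (fun t => \det (A t)) @ F --> \det B.
Proof.
move=> AB; apply: cvg_bigsum => s; apply: cvgMr; apply: cvg_bigprod => i.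
exact: AB.
Qed.

Lemma cvg_adj (T : Type) (F : set_system T) {FF : Filter F} n
    (A : T -> 'M[R]_n) (B : 'M[R]_n) i j :
  (forall i j, (fun t => A t i j) @ F --> B i j) ->
  (fun t => (\adj (A t)) i j) @ F --> (\adj B) i j.
Proof.
move=> AB; rewrite mxE; under eq_cvg do rewrite mxE; apply: cvgMr.
by apply: cvg_det => k l; rewrite !mxE; under eq_cvg do rewrite !mxE; exact: AB.
Qed.

End MatrixLimits.

(** * Solving the continuity equation for the potential *)

Section Potential.
Context {R : realType} {X : finType}.
Variables (Q : X -> X -> R) (pi : X -> R).
Implicit Types (rho phi psi v : X -> R).
Hypothesis Q_ge0 : forall x y, 0 <= Q x y.
Hypothesis pi_gt0 : forall x, 0 < pi x.
Hypothesis pi_sum : \sum_x pi x = 1.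
Hypothesis rev : forall x y, Q x y * pi x = Q y x * pi y.
Hypothesis irr : forall x y, connect (fun x y => 0 < Q x y) x y.

Let pi_ge0 x : 0 <= pi x. Proof. exact: ltW. Qed.

(** The velocity that the continuity equation assigns to the potential [psi] at [rho]. *)
Definition weighted_div rho psi x :=
  \sum_y (psi x - psi y) * logmean (rho x) (rho y) * Q x y.

Lemma inner_weighted_div rho phi psi : (forall x, 0 <= rho x) ->
  inner pi phi (weighted_div rho psi) = dform Q pi logmean rho phi psi.
Proof.
move=> rho0; pose a x y := phi x * (psi x - psi y) * logmean (rho x) (rho y).
have H := @sum_edge_sym _ _ _ _ rev a (fun x y => a y x) (fun _ _ => erefl).
transitivity (\sum_x \sum_y a x y * (Q x y * pi x)).
  apply: eq_bigr => x _; rewrite mulr_sumr mulr_suml.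
  by apply: eq_bigr => y _; rewrite /a; ring.
apply: (mulfI (_ : 2 != 0 :> R)) => //; rewrite -H /dform mulrA divff // mul1r.
apply: eq_bigr => x _; apply: eq_bigr => y _.
by rewrite /a (logmeanC (rho0 y) (rho0 x)); ring.
Qed.

(** Completing the square: the gap between the two sides is the energy of [phi - psi]. *)
Lemma speed_le_weighted_div rho psi : (forall x, 0 <= rho x) ->
  speed_le Q pi rho (weighted_div rho psi) (energy Q pi rho psi).
Proof.
move=> rho0 phi; rewrite inner_weighted_div // -subr_ge0.
have := energy_ge0 Q_ge0 pi_ge0 rho (fun x => phi x + -1 * psi x).
rewrite energyD energyZ dformC dformZl dformC; congr (_ <= _); ring.
Qed.

(* The rank-one term makes the weighted Laplacian invertible. *)
Definition laplace_mx rho : 'M[R]_#|X| := \matrix_(i, j)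
  let z := enum_val i in let x := enum_val j in
  (x == z)%:R * (\sum_y logmean (rho x) (rho y) * Q x y)
  - logmean (rho x) (rho z) * Q x z + pi z.

Lemma laplace_mxE rho i j : laplace_mx rho i j =
  (enum_val j == enum_val i)%:R *
    (\sum_y logmean (rho (enum_val j)) (rho y) * Q (enum_val j) y)
  - logmean (rho (enum_val j)) (rho (enum_val i)) * Q (enum_val j) (enum_val i)
  + pi (enum_val i).
Proof. by rewrite mxE. Qed.

(** The solution is written with the adjugate, so that its continuity in [rho] and [v] is that of
    polynomials in the entries and of one inverse. *)
Definition potential rho v z : R :=
  (\det (laplace_mx rho))^-1 *
  \sum_i v (enum_val i) * (\adj (laplace_mx rho)) i (enum_rank z).

Lemma mul_laplace_mx rho (u : 'rV[R]_#|X|) x :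
  (u *m laplace_mx rho) 0 (enum_rank x) =
  weighted_div rho (fun z => u 0 (enum_rank z)) x
  + \sum_z u 0 (enum_rank z) * pi z.
Proof.
rewrite mxE; transitivity (\sum_z u 0 (enum_rank z) *
    ((x == z)%:R * (\sum_y logmean (rho x) (rho y) * Q x y)
     - logmean (rho x) (rho z) * Q x z + pi z)).
  rewrite [RHS](reindex _ (onW_bij _ (@enum_val_bij X))) /=.
  by apply: eq_bigr => i _; rewrite !mxE enum_valK enum_rankK.
under eq_bigr do rewrite mulrDr; rewrite big_split /=; congr (_ + _).
under eq_bigr do rewrite mulrBr; rewrite sumrB.
have -> : \sum_z u 0 (enum_rank z) *
      ((x == z)%:R * (\sum_y logmean (rho x) (rho y) * Q x y)) =
    u 0 (enum_rank x) * (\sum_y logmean (rho x) (rho y) * Q x y).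
  rewrite -[RHS](sum_delta x (fun z => u 0 (enum_rank z) *
    (\sum_y logmean (rho x) (rho y) * Q x y))).
  by apply: eq_bigr => z _; rewrite mulrCA.
rewrite mulr_sumr -sumrB.
by apply: eq_bigr => y _; ring.
Qed.

Lemma energy0_cst rho psi x y : (forall x, 0 < rho x) ->
  energy Q pi rho psi = 0 -> psi x = psi y.
Proof.
move=> rho0 e0.
have t0 a b : 0 <= (psi a - psi b) * (psi a - psi b) * logmean (rho a) (rho b) * (Q a b * pi a).
  apply: mulr_ge0; last exact: mulr_ge0.
  by apply: mulr_ge0; [rewrite -expr2 sqr_ge0|exact: logmean_ge0].
have step a b : 0 < Q a b -> psi a = psi b.
  move=> Qab; move: e0 => /eqP; rewrite /energy /dform mulf_eq0 invr_eq0 pnatr_eq0 /=.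
  rewrite psumr_eq0 => [/allP /(_ a (mem_index_enum _)) /=|z _]; last by apply: sumr_ge0.
  rewrite psumr_eq0 // => /allP /(_ b (mem_index_enum _)) /=.
  rewrite !mulf_eq0 (gt_eqF Qab) (gt_eqF (pi_gt0 a)) (gt_eqF (logmean_gt0 (rho0 a) (rho0 b))).
  by rewrite !orbF orbb subr_eq0 => /eqP.
have /connectP[p] := irr x y; elim: p x => [|z p IH] x /=; first by move=> _ ->.
by move=> /andP[/step -> pz] /(IH _ pz).
Qed.

(** Pairing the kernel equation with its solution [psi] gives energy plus squared mean equal to 0.
    Zero energy makes [psi] constant by irreducibility, and zero mean makes that constant 0. *)
Lemma laplace_mx_unit rho : (forall x, 0 < rho x) -> laplace_mx rho \in unitmx.
Proof.
move=> rho0; have rho0' x := ltW (rho0 x).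
rewrite -row_free_unit; apply: inj_row_free => u uN0.
pose psi z := u 0 (enum_rank z); pose s := \sum_z psi z * pi z.
have H x : weighted_div rho psi x + s = 0.
  by rewrite -(mul_laplace_mx rho u x) uN0 mxE.
have E : energy Q pi rho psi + s ^+ 2 = 0.
  rewrite /energy -(inner_weighted_div psi psi rho0') expr2 {1}/s mulr_suml -big_split.
  rewrite big1 // => x _ /=.
  by rewrite -[RHS](mulr0 (psi x * pi x)) -(H x); ring.
have e0 := energy_ge0 Q_ge0 pi_ge0 rho psi.
have s0 : s ^+ 2 = 0.
  by apply/eqP; rewrite eq_le sqr_ge0 andbT -E lerDr.
have psiE x y : psi x = psi y.
  by apply: (energy0_cst _ _ rho0); rewrite s0 addr0 in E.
apply/rowP => i; rewrite mxE -[i]enum_valK -/(psi _).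
have : s = psi (enum_val i).
  by rewrite /s -[RHS]mulr1 -pi_sum mulr_sumr; apply: eq_bigr => z _; rewrite (psiE z (enum_val i)).
by move=> <-; apply/eqP; rewrite -sqrf_eq0 s0.
Qed.

Lemma potentialE rho v x : (forall x, 0 < rho x) -> \sum_x v x * pi x = 0 ->
  weighted_div rho (potential rho v) x = v x.
Proof.
move=> rho0 v0; have rho0' z := ltW (rho0 z).
have detN : \det (laplace_mx rho) != 0.
  by rewrite -unitfE -unitmxE laplace_mx_unit.
pose w : 'rV[R]_#|X| := \row_i v (enum_val i).
pose u := (\det (laplace_mx rho))^-1 *: (w *m \adj (laplace_mx rho)).
have uN : u *m laplace_mx rho = w.
  by rewrite -scalemxAl -mulmxA mul_adj_mx mul_mx_scalar scalerA mulVf // scale1r.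
have uE z : u 0 (enum_rank z) = potential rho v z.
  by rewrite !mxE; congr (_ * _); apply: eq_bigr => i _; rewrite mxE.
pose s := \sum_z potential rho v z * pi z.
have H z : weighted_div rho (potential rho v) z + s = v z.
  have := mul_laplace_mx rho u z; rewrite uN mxE enum_rankK => ->.
  rewrite /s; congr (_ + _); first by apply: eq_bigr => y _; rewrite !uE.
  by apply: eq_bigr => y _; rewrite uE.
(* Averaging the equation against [pi]: the divergence and [v] both have mean zero, hence so has the
   rank-one correction. *)
have s0 : s = 0.
  have e0 : \sum_z weighted_div rho (potential rho v) z * pi z = 0.
    rewrite -inner1 inner_weighted_div // /dform big1 ?mulr0 // => z _.
    by apply: big1 => y _; rewrite subrr !mul0r.
  rewrite -[s]mulr1 -pi_sum mulr_sumr -[LHS]add0r -{1}e0 -big_split /=.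
  by rewrite -[RHS]v0; apply: eq_bigr => z _; rewrite -mulrDl H.
by rewrite -(H x) s0 addr0.
Qed.

Lemma inner_potential rho v : (forall x, 0 < rho x) -> \sum_x v x * pi x = 0 ->
  inner pi (potential rho v) v = energy Q pi rho (potential rho v).
Proof.
move=> rho0 v0; rewrite /energy -inner_weighted_div => [|x]; last exact: ltW.
by apply: eq_bigr => x _; rewrite potentialE.
Qed.

Lemma speed_le_potential rho v : (forall x, 0 < rho x) ->
  \sum_x v x * pi x = 0 ->
  speed_le Q pi rho v (energy Q pi rho (potential rho v)).
Proof.
move=> rho0 v0.
have := @speed_le_weighted_div rho (potential rho v) (fun x => ltW (rho0 x)).
by congr speed_le; apply/funext => x; rewrite potentialE.
Qed.

Lemma cvg_potential (T : Type) (F : set_system T) {FF : Filter F}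
    (r w : T -> X -> R) rho v z : (forall x, 0 < rho x) ->
  (forall x, r ^~ x @ F --> rho x) -> (forall x, w ^~ x @ F --> v x) ->
  (fun t => potential (r t) (w t) z) @ F --> potential rho v z.
Proof.
move=> rho0 rr ww.
have N i j : (fun t => laplace_mx (r t) i j) @ F --> laplace_mx rho i j.
  rewrite laplace_mxE (funext (fun t => laplace_mxE (r t) i j)).
  apply: cvgD; last exact: cvg_cst.
  apply: cvgB; last by apply: cvgMl; exact: cvg_logmean.
  apply: cvgMr; apply: cvg_bigsum => y.
  by apply: cvgMl; exact: cvg_logmean.
apply: cvgM.
  apply: cvgV; last exact: cvg_det.
  by rewrite -unitfE -unitmxE laplace_mx_unit.
by apply: cvg_bigsum => i; apply: cvgM; [exact: ww|exact: cvg_adj].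
Qed.

End Potential.

(** * Integrals bounded by increments of primitives *)

Section IntegralBounds.
Context {R : realType}.
Notation mu := (@lebesgue_measure R).

Lemma itv_shrink (a b e t : R) : 0 < e -> a + e <= t -> t <= b - e -> a < t < b.
Proof. by move=> e0 h1 h2; apply/andP; split; lra. Qed.

Lemma bigcup_itv_cc (a b : R) : a < b ->
  \bigcup_n `[a + (b - a) / n.+2%:R, b - (b - a) / n.+2%:R]%classic = `]a, b[%classic.
Proof.
move=> ab; have ba : 0 < b - a by rewrite subr_gt0.
apply/seteqP; split => [t [n _]|t] /=.
  have p : 0 < (b - a) / n.+2%:R by rewrite divr_gt0.
  by rewrite !in_itv /= => /andP[h1 h2]; exact: itv_shrink h2.
rewrite in_itv /= => /andP[h1 h2].
have m0 : 0 < Num.min (t - a) (b - t) by rewrite lt_min !subr_gt0 h1.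
have [n _ hn] := near_infty_natSinv_lt (PosNum (divr_gt0 m0 ba)).
have {hn} := hn n (leqnn n); rewrite /= => hn.
have {}hn : (b - a) / n.+2%:R <= Num.min (t - a) (b - t).
  rewrite mulrC -ler_pdivlMr // (le_trans _ (ltW hn)) //.
  by rewrite lef_pV2 ?posrE // ler_nat.
move: hn; rewrite le_min => /andP[h3 h4].
exists n => //=; rewrite in_itv /=; apply/andP; split.
  by rewrite addrC -lerBrDr.
by rewrite lerBrDl -lerBrDr.
Qed.

(** The integrand [h] may blow up at the ends, where a curve can reach the boundary of the simplex.
    On compact subintervals [F] minus a primitive of [h] is nondecreasing; monotone convergence then
    exhausts the open interval. *)
Lemma integral_le_increment (F F' h : R -> R) (a b : R) : a < b -> continuous F ->
  (forall t, a < t < b -> is_derive t 1 F (F' t)) ->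
  (forall t, a < t < b -> 0 <= h t <= F' t) ->
  (forall t, a < t < b -> {for t, continuous h}) ->
  (\int[mu]_(t in `]a, b[) (h t)%:E <= (F b - F a)%:E)%E.
Proof.
move=> ab Fc Fd hF hc.
have inc c d : a <= c -> c <= d -> d <= b -> F c <= F d.
  move=> ac cd db; apply: (@le_of_derive_ge0 R F F' c d cd).
  - exact: continuous_subspaceT.
  - by move=> t /andP[ct td]; apply: Fd; rewrite (le_lt_trans ac) // (lt_le_trans td).
  - move=> t /andP[ct td]; have /andP[h0 h1] : 0 <= h t <= F' t.
      by apply: hF; rewrite (le_lt_trans ac) // (lt_le_trans td).
    exact: le_trans h1.
have hcc c d : a < c -> d < b -> {within `[c, d], continuous h}.
  move=> ac db; apply: continuous_in_subspaceT => t; rewrite inE /= in_itv /=.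
  by move=> /andP[ct td]; apply: hc; rewrite (lt_le_trans ac) // (le_lt_trans td).
have step c d : a < c -> c < d -> d < b ->
    (\int[mu]_(t in `[c, d]) (h t)%:E <= (F b - F a)%:E)%E.
  move=> ac cd db.
  have ih : mu.-integrable `[c, d] (EFin \o h).
    by apply: continuous_compact_integrable; [exact: segment_compact|exact: hcc].
  pose G x := \int[mu]_(t in `[c, x]) h t.
  have Gc : {within `[c, d], continuous G}.
    exact: (parameterized_integral_continuous (ltW cd) ih).
  have Gd t : c < t < d -> is_derive t 1 G (h t).
    move=> /andP[ct td]; have htc : {for t, continuous h}.
      by apply: hc; rewrite (lt_trans ac) // (lt_trans td).
    have [D E] := continuous_FTC1_closed td ih ct htc.
    exact: derivable_is_derive D E.
  have le : F c - G c <= F d - G d.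
    apply: (@le_of_derive_ge0 R (fun t => F t - G t) (fun t => F' t - h t) c d (ltW cd)).
    - move=> t; apply: cvgB; last exact: Gc.
      exact: (@continuous_subspaceT _ _ _ _ Fc).
    - move=> t ctd; apply: is_deriveB; last exact: Gd.
      have /andP[ct td] := ctd.
      by apply: Fd; rewrite (lt_trans ac) // (lt_trans td).
    - move=> t /andP[ct td]; rewrite subr_ge0.
      by have /andP[] : 0 <= h t <= F' t by apply: hF; rewrite (lt_trans ac) // (lt_trans td).
  have G0 : G c = 0 by rewrite /G set_itv1 Rintegral_set1.
  have -> : (\int[mu]_(t in `[c, d]) (h t)%:E = (G d)%:E)%E.
    by rewrite /G /Rintegral fineK //; exact: integrable_fin_num.
  rewrite lee_fin; have := inc a c (lexx _) (ltW ac) (ltW (lt_trans cd db)).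
  have := inc d b (ltW (lt_trans ac cd)) (ltW db) (lexx _).
  by rewrite G0 in le; lra.
have ba : 0 < b - a by rewrite subr_gt0.
rewrite -bigcup_itv_cc //.
pose S n : set (measurableTypeR R) := `[a + (b - a) / n.+2%:R, b - (b - a) / n.+2%:R]%classic.
have p n : 0 < (b - a) / n.+2%:R by rewrite divr_gt0.
have q n : (b - a) / n.+2%:R <= (b - a) / 2%:R.
  by rewrite ler_pM2l // lef_pV2 ?posrE // ler_nat.
have Sab n t : S n t -> a < t < b.
  by rewrite /S /= in_itv /= => /andP[h1 h2]; exact: itv_shrink (p n) h1 h2.
have lim := @ge0_nondecreasing_set_cvg_integral _ (measurableTypeR R) R S (EFin \o h) mu.
apply: (cvge_to_le (lim _ _ _ _)).
- apply/nondecreasing_seqP => n; rewrite subsetEset => t; rewrite /S /= !in_itv /=.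
  have : (b - a) / n.+3%:R <= (b - a) / n.+2%:R.
    by rewrite ler_pM2l // lef_pV2 ?posrE // ler_nat.
  move=> H /andP[h1 h2]; apply/andP; split.
    by rewrite (le_trans _ h1) // lerD2l.
  by rewrite (le_trans h2) // lerD2l lerN2.
- by move=> n; exact: measurable_itv.
- move=> n; apply/measurable_EFinP; apply: subspace_continuous_measurable_fun.
    exact: measurable_itv.
  by apply: hcc; [rewrite ltrDl|rewrite ltrBlDr ltrDl]; exact: p.
- by move=> n t /Sab tab; rewrite lee_fin; have /andP[] := hF _ tab.
- apply: nearW => n; rewrite /S; have p0 := p n; have q0 := q n.
  move: p0 q0; set e := (b - a) / n.+2%:R => p0 q0.
  have : a + e <= b - e by lra.
  rewrite le_eqVlt => /predU1P[<-|cd].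
    rewrite set_itv1 integral_set1 lee_fin subr_ge0.
    by apply: inc => //; exact: ltW.
  by apply: step => //; lra.
Qed.

Definition clamp (a b t : R) : R := Num.max a (Num.min t b).

Lemma clamp_id (a b t : R) : a <= t <= b -> clamp a b t = t.
Proof. by move=> /andP[at_ tb]; rewrite /clamp min_l // max_r. Qed.

Lemma clamp_itv (a b t : R) : a <= b -> a <= clamp a b t <= b.
Proof. by move=> ab; rewrite /clamp le_max lexx /= ge_max ab ge_min lexx orbT. Qed.

Lemma continuous_clamp (a b : R) : continuous (clamp a b).
Proof.
move=> t; have H : {for t, continuous (fun u : R => Num.min u b : R^o)}.
  exact: (@continuous_min _ _ (fun u => u) (cst b)  t (@cvg_id _ _) (@cvg_cst _ _ _ _ _)).
exact: (@continuous_max _ _ (cst a) (fun u => Num.min u b) t (@cvg_cst _ _ _ _ _) H).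
Qed.

Lemma exists_primitive (n : R -> R) (a b : R) : a < b -> continuous n ->
  exists F, [/\ continuous F, forall t, a < t < b -> is_derive t 1 F (n t) &
    (\int[mu]_(t in `[a, b]) (n t)%:E)%E = (F b - F a)%:E].
Proof.
move=> ab nc.
(* Starting at [a - 1] makes [a] an interior point, so that [G] is differentiable on all of
   [[a, b]]; composing with [clamp] extends it continuously to the line. *)
pose G x := \int[mu]_(t in `[a - 1, x]) n t.
have Gd t : a - 1 < t -> is_derive t 1 G (n t).
  move=> at_; have [||D E] := @continuous_FTC1_closed R n (a - 1) t (t + 1) _ _ at_ (nc t).
  - by rewrite ltrDl.
  - apply: continuous_compact_integrable; first exact: segment_compact.
    exact: continuous_subspaceT.
  - exact: derivable_is_derive D E.
pose F t := G (clamp a b t).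
have Fc : continuous F.
  move=> t; apply: (@continuous_comp _ _ _ (clamp a b) G); first exact: continuous_clamp.
  apply: (is_derive_continuous (Gd _ _)).
  by have /andP[h _] := clamp_itv t (ltW ab); rewrite (lt_le_trans _ h) // ltrBlDr ltrDl.
have Fd t : a < t < b -> is_derive t 1 F (n t).
  move=> /andP[at_ tb]; apply: (@near_eq_is_derive _ _ _ G).
    near=> u; rewrite /F clamp_id //; apply/andP; split; apply: ltW.
      by near: u; exact: lt_nbhsr.
    by near: u; exact: lt_nbhsl.
  by apply: Gd; rewrite (lt_trans _ at_) // ltrBlDr ltrDl.
exists F; split => //; apply: continuous_FTC2 => //.
- exact: continuous_subspaceT.
- split.
  + by move=> t; rewrite in_itv /= => /Fd[].
  + by apply: cvg_at_right_filter; exact: Fc.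
  + by apply: cvg_at_left_filter; exact: Fc.
- move=> t; rewrite in_itv /= => /Fd H.
  by rewrite derive1E derive_val.
Unshelve. all: by end_near. Qed.

End IntegralBounds.

(** * Continuity and derivative of the entropy *)

Section Entropy.
Context {R : realType}.

(** Follows from [ln u <= u] at [u = t^(-1/2)], and gives a modulus of continuity of [t ln t] at 0.
    For [t <= 0] the logarithm is 0 by convention. *)
Lemma xlnx_le (t : R) : `|t| < 1 -> `|t * ln t| <= 2 * Num.sqrt `|t|.
Proof.
move=> t1; have [t0|t0] := leP t 0.
  by rewrite ln0 // mulr0 normr0 mulr_ge0.
rewrite (gtr0_norm t0) in t1 *; have s0 : 0 < Num.sqrt t by rewrite sqrtr_gt0.
have tE : t = Num.sqrt t ^+ 2 by rewrite sqr_sqrtr // ltW.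
have s1 : Num.sqrt t <= 1 by rewrite -sqrtr1 ler_sqrt // ltW.
have l1 : ln (Num.sqrt t)^-1 <= (Num.sqrt t)^-1.
  have := expR_ge1Dx (ln (Num.sqrt t)^-1); rewrite lnK ?posrE ?invr_gt0 //.
  by apply: le_trans; rewrite lerDr.
have l2 : ln t = - (2 * ln (Num.sqrt t)^-1).
  by rewrite {1}tE lnXn // lnV ?posrE // mulrN opprK mulr_natl.
have l0 : 0 <= ln (Num.sqrt t)^-1 by rewrite lnV ?posrE // oppr_ge0 ln_le0.
rewrite l2 mulrN normrN ger0_norm ?mulr_ge0 ?(ltW t0) //.
rewrite mulrCA ler_pM2l // {1}tE expr2 -mulrA.
rewrite -[leRHS]mulr1 ler_pM2l // -(mulfV (lt0r_neq0 s0)) ler_pM2l //.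
Qed.

Lemma continuous_xlnx : continuous (fun t : R => t * ln t).
Proof.
move=> t; have [t0|t0|->] := ltgtP t 0.
- apply/cvgrPdist_le => /= e e0; near=> u.
  rewrite (ln0 (ltW t0)) (@ln0 _ u) ?mulr0 ?subrr ?normr0 ?(ltW e0) //.
  by apply: ltW; near: u; exact: lt_nbhsl.
- by apply: cvgM; [exact: cvg_id|exact: continuous_ln].
- rewrite /continuous_at mul0r; apply/cvgr0Pnorm_le => /= e e0.
  have lim : (fun u : R => 2 * Num.sqrt `|u|) @ (0 : R) --> 2 * Num.sqrt `|0 : R|.
    apply: cvgMr; apply: (@continuous_comp _ _ _ (@Num.norm _ R) (@Num.sqrt R)).
      exact: norm_continuous.
    exact: sqrt_continuous.
  rewrite normr0 sqrtr0 mulr0 in lim.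
  near=> u; apply: (le_trans (xlnx_le _)).
    by near: u; apply: (cvgr0_norm_lt (fun u : R => u)) => //; exact: cvg_id.
  by near: u; exact: (cvgr_le 0 lim).
Unshelve. all: by end_near. Qed.

Lemma cvg_entropy (X : finType) (pi : X -> R) (T : Type) (F : set_system T)
    {FF : Filter F} (r : T -> X -> R) (rho : X -> R) :
  (forall x, r ^~ x @ F --> rho x) ->
  (fun t => entropy pi (r t)) @ F --> entropy pi rho.
Proof.
move=> rr; apply: cvg_bigsum => x; under eq_cvg do rewrite -mulrA.
rewrite -mulrA; apply: cvgMr.
exact: (cvg_comp _ _ (rr x) (@continuous_xlnx (rho x))).
Qed.

Lemma is_derive_entropy (X : finType) (pi : X -> R) (r : R -> X -> R)
    (dr : X -> R) (t : R) : (forall x, 0 < r t x) ->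
  (forall x, is_derive t 1 (r ^~ x) (dr x)) ->
  is_derive t 1 (fun s => entropy pi (r s))
    (inner pi (fun x => ln (r t x) + 1) dr).
Proof.
move=> r0 rd; apply: is_derive_bigsum => x.
have L := is_derive_chain (is_derive1_ln (r0 x)) (rd x).
apply: is_derive_eq (is_derive_mul (is_deriveMl (pi x) (rd x)) L) _.
by have /negbT ? := gt_eqF (r0 x); field.
Qed.

Lemma C1_is_derive (f df : R -> R) :
  (forall t : R, is_derive t 1 f (df t)) -> continuous df ->
  C1 f /\ forall t, derive1 f t = df t.
Proof.
move=> fd dc; have E t : derive1 f t = df t.
  by rewrite derive1E; have := fd t => H; rewrite derive_val.
split=> //; split => [t|]; first by have [] := fd t.
by have -> : derive1 f = df by exact/funext.
Qed.

Lemma is_derive_C1 (f : R -> R) (t : R) : C1 f -> is_derive t 1 f (derive1 f t).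
Proof. by move=> [fd _]; exact: derivable_is_derive. Qed.

End Entropy.

(** * Curves with controlled action and their concatenation *)

Section Routes.
Context {R : realType} {X : finType}.
Variables (Q : X -> X -> R) (pi : X -> R).
Implicit Types (f g h rho phi psi v : X -> R) (a b m A B s t : R) (gam : R -> X -> R).
Hypothesis Q_ge0 : forall x y, 0 <= Q x y.
Hypothesis pi_gt0 : forall x, 0 < pi x.
Hypothesis rev : forall x y, Q x y * pi x = Q y x * pi y.
Hypothesis irr : forall x y, connect (fun x y => 0 < Q x y) x y.

Let pi_ge0 x : 0 <= pi x. Proof. exact: ltW. Qed.

Lemma energy_cst rho (k : R) : energy Q pi rho (fun=> k) = 0.
Proof.
rewrite /energy /dform big1 ?mulr0 // => x _.
by apply: big1 => y _; rewrite subrr !mul0r.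
Qed.

Lemma speed_le_ge0 rho v (n : R) : speed_le Q pi rho v n -> 0 <= n.
Proof.
move=> /(_ (fun=> 0)); rewrite energy_cst subr0; congr (_ <= _).
by rewrite /inner big1 ?mulr0 // => x _; rewrite !mul0r.
Qed.

Lemma speed_leW rho v (n n' : R) : n <= n' -> speed_le Q pi rho v n ->
  speed_le Q pi rho v n'.
Proof. by move=> nn' vn phi; exact: le_trans (vn phi) nn'. Qed.

(* Testing against large constants. *)
Lemma speed_le_mean0 rho v (n : R) : speed_le Q pi rho v n ->
  \sum_x v x * pi x = 0.
Proof.
have kE (k : R) : inner pi (fun=> k) v = k * \sum_x v x * pi x.
  by rewrite /inner mulr_sumr; apply: eq_bigr => x _; rewrite mulrA.
move=> vn; apply/eqP/negPn/negP => m0; set m := \sum_x _ in m0.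
have := vn (fun=> (n + 1) / (2 * m)); rewrite energy_cst subr0 kE -/m.
have -> : 2 * ((n + 1) / (2 * m) * m) = n + 1 by field.
by rewrite gerDl ler10.
Qed.

Lemma speed_leZ rho v (n k : R) : speed_le Q pi rho v n ->
  speed_le Q pi rho (fun x => k * v x) (k ^+ 2 * n).
Proof.
have [->|k0] := eqVneq k 0 => vn phi.
  rewrite innerZr expr0n /= !mul0r mulr0 sub0r oppr_le0.
  exact: energy_ge0.
have := vn (fun x => k^-1 * phi x); rewrite innerZl energyZ.
rewrite -(ler_pM2l (_ : 0 < k ^+ 2)) ?exprn_even_gt0 // innerZr.
by congr (_ <= _); field.
Qed.

(* Adding [generator rho], the gradient of minus the entropy, costs at most
   twice the decrease of the entropy. *)
Lemma speed_le_generator rho v (n k : R) : (forall x, 0 < rho x) ->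
  speed_le Q pi rho v n ->
  speed_le Q pi rho (fun x => generator Q rho x + k * v x)
    (k ^+ 2 * n - 2 * inner pi (fun x => ln (rho x))
       (fun x => generator Q rho x + k * v x)).
Proof.
move=> rho0 vn phi; pose l x := ln (rho x).
have := speed_leZ k vn (fun x => phi x + l x).
rewrite !innerDr !innerDl energyD !inner_generator_ln // -/l.
have := energy_ge0 Q_ge0 pi_ge0 rho l; rewrite /energy; lra.
Qed.

(** The action is recorded through a primitive [F] of a bound [F'] on the squared speed: time
    changes and entropy terms then act on [F] directly, and [F'] may be unbounded near the ends
    while [F] stays continuous. *)
Definition controlled gam a b A :=
  [/\ a < b, forall x, C1 (gam ^~ x),
      forall t, a <= t <= b -> density pi (gam t) &
      exists F F' : R -> R, [/\ continuous F,
        forall t, a < t < b -> is_derive t 1 F (F' t) /\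
          speed_le Q pi (gam t) (fun x => derive1 (gam ^~ x) t) (F' t) &
        F b - F a <= A]].

(** Positivity is asked on the open interval only, since the heat flow may start from, and its
    reversal end at, a density with zeros. *)
Definition link a b A f g := exists gam, [/\ controlled gam a b A,
  gam a = f, gam b = g & forall t, a < t < b -> forall x, 0 < gam t x].

Inductive route : R -> R -> R -> (X -> R) -> (X -> R) -> Prop :=
| route_link a b A f g : link a b A f g -> route a b A f g
| route_cons a m b A B f g h :
    link a m A f g -> route m b B g h -> route a b (A + B) f h.

Lemma linkW a b A A' f g : A <= A' -> link a b A f g -> link a b A' f g.
Proof.
move=> AA' [gam [[ab gC gd [F [F' [Fc Fd FA]]]] ga gb g0]].
exists gam; split => //; split => //; exists F, F'; split => //.
exact: le_trans AA'.
Qed.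

Lemma routeW a b A A' f g : A <= A' -> route a b A f g -> route a b A' f g.
Proof.
move=> + r; elim: r A' => {a b A f g} [a b A f g l A' /linkW /(_ l)|].
  exact: route_link.
move=> a m b A B f g h l r IH A' AB; rewrite -[A'](subrKC A).
by apply: route_cons l (IH _ _); rewrite lerBrDl.
Qed.

Lemma route_cat a m b A B f g h :
  route a m A f g -> route m b B g h -> route a b (A + B) f h.
Proof.
move=> r; elim: r b B h => {a m A f g} [a m A f g l b B h r|].
  exact: route_cons r.
by move=> a m b A B f g h l r IH c C k /IH; rewrite -addrA; exact: route_cons.
Qed.

Lemma route_lt a b A f g : route a b A f g -> a < b.
Proof.
elim=> {a b A f g} [a b A f g [gam [[]]] //|a m b A B f g h [gam [[am _ _ _] _ _ _]] _].
exact: lt_trans.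
Qed.

Lemma controlled_comp gam a b A (k c a' b' : R) : k != 0 -> a' < b' ->
  (forall s, a' <= s <= b' -> a <= k * s + c <= b) ->
  (forall s, a' < s < b' -> a < k * s + c < b) ->
  (k * a' + c, k * b' + c) = (if 0 < k then (a, b) else (b, a)) ->
  controlled gam a b A ->
  controlled (fun s => gam (k * s + c)) a' b' (`|k| * A).
Proof.
move=> k0 ab' le lt e [ab gC gd [F [F' [Fc Fd FA]]]].
have ld s : is_derive s 1 (fun s => k * s + c) k.
  apply: (is_derive_eq (is_deriveD (is_deriveMl k (is_derive_id s 1))
    (is_derive_cst c s 1))).
  by rewrite mulr1 addr0.
have lc : continuous (fun s => k * s + c).
  by move=> s; exact: (is_derive_continuous (ld s)).
have gcd x s : is_derive s 1 (fun s => gam (k * s + c) x)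
    (derive1 (gam ^~ x) (k * s + c) * k).
  exact: is_derive_chain (is_derive_C1 _ (gC x)) (ld s).
have gcc x : continuous (fun s => derive1 (gam ^~ x) (k * s + c) * k).
  move=> s; apply: cvgMl; apply: continuous_comp; first exact: lc.
  by have [_] := gC x; exact.
have gcC x := C1_is_derive (gcd x) (gcc x).
split => //; first by move=> x; exact: (gcC x).1.
  by move=> t /le /gd.
(* The velocity is multiplied by [k] and its squared norm by [k^2], a primitive of which is
   [k F(k s + c)]. For [k < 0] the ends are exchanged as well, so the cost is multiplied by [|k|] in
   both cases. *)
exists (fun s => k * F (k * s + c)), (fun s => k * (F' (k * s + c) * k)); split.
- move=> s; apply: cvgMr; apply: continuous_comp; first exact: lc.
  exact: Fc.
- move=> s /lt /Fd[Fds vn]; split.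
    by apply: is_deriveMl; exact: is_derive_chain Fds (ld s).
  have := speed_leZ k vn.
  have -> : (fun x => derive1 (fun s => gam (k * s + c) x) s) =
      (fun x => k * derive1 (gam ^~ x) (k * s + c)).
    by apply/funext => x; rewrite (gcC x).2 mulrC.
  by congr speed_le; ring.
- rewrite -mulrBr; case: ifPn e => [k1 [-> ->]|k1 [-> ->]].
    by rewrite gtr0_norm // ler_pM2l.
  have k2 : k < 0 by rewrite lt_neqAle k0 leNgt.
  by rewrite ltr0_norm // mulNr -mulrN ler_nM2l // lerNl opprB.
Qed.

Lemma link_affine a b A f g (k c a' b' : R) : 0 < k ->
  k * a' + c = a -> k * b' + c = b -> link a b A f g -> link a' b' (k * A) f g.
Proof.
move=> k0 ea eb [gam [gct ga gb g0]]; have [ab _ _ _] := gct.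
have lt s : a' < s < b' -> a < k * s + c < b.
  by rewrite -ea -eb !ltrD2r !ltr_pM2l.
exists (fun s => gam (k * s + c)); split; rewrite ?ea ?eb //.
  have -> : k * A = `|k| * A by rewrite gtr0_norm.
  apply: controlled_comp gct => //.
  - by rewrite gt_eqF.
  - by rewrite -(ltr_pM2l k0) -(ltrD2r c) ea eb.
  - by move=> s; rewrite -ea -eb !lerD2r !ler_pM2l.
  - by rewrite k0 ea eb.
by move=> t /lt; exact: g0.
Qed.

Lemma link_rev a b A f g : link a b A f g -> link (- b) (- a) A g f.
Proof.
move=> [gam [gct ga gb g0]]; have [ab _ _ _] := gct.
exists (fun s => gam (-1 * s + 0)); split; rewrite ?mulN1r ?opprK ?addr0 //.
  have -> : A = `|-1| * A by rewrite normrN1 mul1r.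
  apply: controlled_comp gct => //.
  - by rewrite ltrN2.
  - by move=> s; rewrite mulN1r addr0 lerNl lerNr andbC.
  - by move=> s; rewrite mulN1r addr0 ltrNl ltrNr andbC.
  - by rewrite oppr_gt0 ltr10 !mulN1r !opprK !addr0.
by move=> t tab x; apply: g0; rewrite mulN1r addr0 ltrNl ltrNr andbC.
Qed.

Lemma route_affine a b A f g (k c a' b' : R) : 0 < k ->
  k * a' + c = a -> k * b' + c = b -> route a b A f g -> route a' b' (k * A) f g.
Proof.
move=> k0 + + r; elim: r a' b' => {a b A f g} [a b A f g l a' b' ea eb|].
  exact/route_link/(link_affine k0 ea eb l).
move=> a m b A B f g h l r IH a' b' ea eb; rewrite mulrDr.
have em : k * ((m - c) / k) + c = m by field; rewrite gt_eqF.
exact: route_cons (link_affine k0 ea em l) (IH _ _ em eb).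
Qed.

Lemma route_rev a b A f g : route a b A f g -> route (- b) (- a) A g f.
Proof.
elim=> {a b A f g} [a b A f g l|a m b A B f g h l r IH].
  exact/route_link/link_rev.
by rewrite addrC; apply: route_cat IH (route_link (link_rev l)).
Qed.

End Routes.

(** * Heating a curve progressively along its parameter *)

Section HeatedRoutes.
Context {R : realType} {X : finType}.
Variables (Q : X -> X -> R) (pi : X -> R) (kappa : R).
Implicit Types (f g h rho phi psi v : X -> R) (a b m A B s t r : R) (gam : R -> X -> R).
Hypothesis Q_ge0 : forall x y, 0 <= Q x y.
Hypothesis pi_gt0 : forall x, 0 < pi x.
Hypothesis pi_sum : \sum_x pi x = 1.
Hypothesis rev : forall x y, Q x y * pi x = Q y x * pi y.
Hypothesis irr : forall x y, connect (fun x y => 0 < Q x y) x y.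
Hypothesis kappa_ge0 : 0 <= kappa.
Hypothesis be : forall a, 0 <= a <= 1 -> bochner Q pi kappa (smean a) (smean1 a).

Let pi_ge0 x : 0 <= pi x. Proof. exact: ltW. Qed.

Notation route := (route Q pi).
Notation link := (link Q pi).
Notation controlled := (controlled Q pi).
Notation mu := (@lebesgue_measure R).

Lemma heat_density r f : 0 <= r -> density pi f -> density pi (heat Q r f).
Proof.
move=> r0 [f0 f1]; split=> [x|]; first exact: heat_ge0.
rewrite -inner1 inner_heat //.
have -> : heat Q r (fun=> 1) = fun=> 1 by apply/funext => x; exact: heat_cst.
by rewrite inner1.
Qed.

Lemma heat_density_gt0 r f x : 0 < r -> density pi f -> 0 < heat Q r f x.
Proof.
move=> r0 [f0 f1]; have /existsP[y fy] : [exists y, 0 < f y].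
  apply: contraT => /existsPn fN.
  move: f1; rewrite big1 => [/eqP|y _]; first by rewrite eq_sym oner_eq0.
  have /eqP -> : f y == 0 by rewrite eq_le f0 leNgt fN.
  by rewrite mul0r.
rewrite /heat (bigD1 y) //= ltr_wpDr //.
  by apply: sumr_ge0 => z _; rewrite mulr_ge0 ?heat_kernel_ge0 // ltW.
by rewrite mulr_gt0 // heat_kernel_gt0.
Qed.

Lemma continuous_heat_kernel x y : continuous (fun r => heat_kernel Q r x y).
Proof. by move=> r; exact: (is_derive_continuous (is_derive_heat_kernel Q_ge0 x y r)). Qed.

Lemma cvg_heat (T : Type) (F : set_system T) {FF : Filter F} (u : T -> R)
    (w : T -> X -> R) r f x : u @ F --> r -> (forall x, w ^~ x @ F --> f x) ->
  (fun z => heat Q (u z) (w z) x) @ F --> heat Q r f x.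
Proof.
move=> ur wf; apply: cvg_bigsum => y; apply: cvgM => //.
exact: (cvg_comp _ _ ur (@continuous_heat_kernel x y r)).
Qed.

Lemma is_derive_heat_path gam (dgam : X -> R) x r :
  (forall y, is_derive r 1 (gam ^~ y) (dgam y)) ->
  is_derive r 1 (fun r => heat Q r (gam r) x)
    (generator Q (heat Q r (gam r)) x + heat Q r dgam x).
Proof.
move=> gd; apply: (is_derive_eq (is_derive_bigsum _ (fun y =>
  is_derive_mul (is_derive_heat_kernel Q_ge0 x y r) (gd y)))).
rewrite big_split /=; congr (_ + _).
rewrite /generator; under eq_bigr do rewrite mulr_suml.
rewrite exchange_big /=; apply: eq_bigr => z _.
by rewrite /heat -sumrB mulr_sumr; apply: eq_bigr => y _; ring.
Qed.

Lemma cvg_generator (T : Type) (F : set_system T) {FF : Filter F}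
    (w : T -> X -> R) f x : (forall x, w ^~ x @ F --> f x) ->
  (fun z => generator Q (w z) x) @ F --> generator Q f x.
Proof.
by move=> wf; apply: cvg_bigsum => y; apply: cvgMr; apply: cvgB.
Qed.

Lemma C1_heat_path gam x : (forall y, C1 (gam ^~ y)) ->
  C1 (fun r => heat Q r (gam r) x) /\
  forall r, derive1 (fun r => heat Q r (gam r) x) r =
    generator Q (heat Q r (gam r)) x + heat Q r (fun y => derive1 (gam ^~ y) r) x.
Proof.
move=> gC; apply: C1_is_derive => r.
  by apply: is_derive_heat_path => y; exact: is_derive_C1.
have gc y : gam ^~ y @ r --> gam r y.
  exact: (is_derive_continuous (is_derive_C1 r (gC y))).
apply: cvgD.
  by apply: cvg_generator => y; apply: cvg_heat => //; exact: cvg_id.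
apply: cvg_heat; first exact: cvg_id.
by move=> y; have [_] := gC y; exact.
Qed.

Lemma C1_comp (f p : R -> R) : C1 f -> C1 p -> C1 (fun r => f (p r)) /\
  forall r, derive1 (fun r => f (p r)) r = derive1 f (p r) * derive1 p r.
Proof.
move=> fC pC; apply: C1_is_derive => [r|r].
  exact: is_derive_chain (is_derive_C1 _ fC) (is_derive_C1 _ pC).
apply: cvgM; last by have [_] := pC; exact.
apply: continuous_comp; last by have [_] := fC; exact.
exact: (is_derive_continuous (is_derive_C1 r pC)).
Qed.

(* A time change whose speed compensates the contraction rate of [heat]. *)
Definition heat_clock r : R := r + kappa * r ^+ 2.

Lemma is_derive_heat_clock r : is_derive r 1 heat_clock (1 + 2 * kappa * r).
Proof.
apply: (is_derive_eq (is_deriveD (is_derive_id r 1)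
  (is_deriveMl kappa (is_derive_mul (is_derive_id r 1) (is_derive_id r 1))))).
ring.
Qed.

Lemma C1_heat_clock : C1 heat_clock /\
  forall r, derive1 heat_clock r = 1 + 2 * kappa * r.
Proof.
apply: C1_is_derive; first exact: is_derive_heat_clock.
by move=> r; apply: cvgD; [exact: cvg_cst|apply: cvgMr; exact: cvg_id].
Qed.

Lemma heat_clock_lt r r' : 0 <= r -> r < r' -> heat_clock r < heat_clock r'.
Proof.
move=> r0 rr'; have r'0 := le_trans r0 (ltW rr').
by rewrite /heat_clock ltr_leD // ler_wpM2l // ler_pXn2r ?nnegrE // ltW.
Qed.

Lemma heat_clock_le r r' : 0 <= r -> r <= r' -> heat_clock r <= heat_clock r'.
Proof.
move=> r0; rewrite le_eqVlt => /predU1P[->//|rr']; exact/ltW/heat_clock_lt.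
Qed.

Lemma heat_clock_surj m : 0 <= m -> exists2 r, 0 <= r & heat_clock r = m.
Proof.
move=> m0; pose q := Num.sqrt (1 + 4 * kappa * m).
have q0 : 0 <= q by exact: sqrtr_ge0.
have p0 : 0 <= 1 + 4 * kappa * m by rewrite addr_ge0 ?mulr_ge0.
have qq : q ^+ 2 = 1 + 4 * kappa * m by rewrite sqr_sqrtr.
have q1 : 0 < 1 + q by rewrite ltr_wpDr.
(* The nonnegative root of [kappa r^2 + r = m], in rationalised form so as to cover [kappa = 0]. *)
exists (2 * m / (1 + q)); first by rewrite divr_ge0 ?mulr_ge0 // ltW.
rewrite /heat_clock; have q1' := lt0r_neq0 q1.
apply: (mulIf (expf_neq0 2 q1')).
have -> : (2 * m / (1 + q) + kappa * (2 * m / (1 + q)) ^+ 2) * (1 + q) ^+ 2 =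
  2 * m * (1 + q) + m * (4 * kappa * m) by field.
have -> : 4 * kappa * m = q ^+ 2 - 1 by rewrite qq; ring.
ring.
Qed.

Lemma heat_clock_speed r : 1 + 2 * kappa * r <= expR (2 * kappa * r).
Proof. exact: expR_ge1Dx. Qed.

(** Write [u] for [heat_clock], [L] for the generator and [P_r] for the semigroup. The curve
    [q_r = P_r gam(u(r))] has velocity [L q_r + u' P_r gam']. Contraction and [speed_le_generator]
    bound its squared norm by [u'^2 e^(-2 kappa r) F'(u)] minus twice the derivative of the entropy.
    Since [u' = 1 + 2 kappa r <= e^(2 kappa r)], this is at most the derivative of
    [F(u(r)) - 2 H(q_r)], [H] being the entropy. *)
Lemma heat_link gam r0 r1 A : 0 <= r0 -> r0 < r1 ->
  controlled gam (heat_clock r0) (heat_clock r1) A ->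
  link r0 r1
    (A - 2 * (entropy pi (heat Q r1 (gam (heat_clock r1)))
              - entropy pi (heat Q r0 (gam (heat_clock r0)))))
    (heat Q r0 (gam (heat_clock r0))) (heat Q r1 (gam (heat_clock r1))).
Proof.
move=> r00 r01 [_ gC gd [F [F' [Fc Fd FA]]]].
have [uC uE] := C1_heat_clock.
pose p r x := gam (heat_clock r) x.
have pC x := C1_comp (gC x) uC.
have hC x := C1_heat_path x (fun y => (pC y).1).
pose q r := heat Q r (p r).
have uitv r : r0 <= r <= r1 -> heat_clock r0 <= heat_clock r <= heat_clock r1.
  move=> /andP[h1 h2]; rewrite !heat_clock_le //.
  exact: le_trans h1.
have uitv' r : r0 < r < r1 -> heat_clock r0 < heat_clock r < heat_clock r1.
  move=> /andP[h1 h2]; rewrite !heat_clock_lt //.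
  exact/ltW/(le_lt_trans r00).
have qd r : r0 <= r <= r1 -> density pi (q r).
  move=> h; apply: heat_density; first by have /andP[/(le_trans r00)] := h.
  exact/gd/uitv.
have q0 r : r0 < r < r1 -> forall x, 0 < q r x.
  move=> h x; apply: heat_density_gt0.
    by have /andP[/(le_lt_trans r00)] := h.
  by apply: gd; have /andP[h1 h2] := uitv' _ h; rewrite !ltW.
exists q; split => //; split => //; first by move=> x; exact: (hC x).1.
pose w r x := derive1 (gam ^~ x) (heat_clock r).
have dq r : (fun x => derive1 (q ^~ x) r) =
    (fun x => generator Q (q r) x + (1 + 2 * kappa * r) * heat Q r (w r) x).
  apply/funext => x; rewrite (hC x).2 -heatZ; congr (_ + _).
  by congr heat; apply/funext => y; rewrite (pC y).2 uE mulrC.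
exists (fun r => F (heat_clock r) - 2 * entropy pi (q r)).
exists (fun r => F' (heat_clock r) * (1 + 2 * kappa * r)
   - 2 * inner pi (fun x => ln (q r x) + 1) (fun x => derive1 (q ^~ x) r)).
split.
- move=> r; apply: cvgB.
    apply: continuous_comp; last exact: Fc.
    exact: (is_derive_continuous (is_derive_heat_clock r)).
  apply: cvgMr; apply: cvg_entropy => x.
  exact: (is_derive_continuous (is_derive_C1 r (hC x).1)).
- move=> r h; have [Fdr vn] := Fd _ (uitv' r h); split.
    apply: is_deriveB; first exact: is_derive_chain (is_derive_heat_clock r).
    apply: is_deriveMl; apply: is_derive_entropy; first exact: q0.
    by move=> x; exact: is_derive_C1 (hC x).1.
  have /andP[h1 h2] := h; have r_gt0 := le_lt_trans r00 h1.
  have gdr : density pi (gam (heat_clock r)).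
    by apply: gd; have /andP[k1 k2] := uitv' r h; rewrite !ltW.
  have H1 := heat_speed_le Q_ge0 pi_ge0 rev be (ltW r_gt0) gdr.1
    (fun x => heat_density_gt0 x r_gt0 gdr) vn.
  have H2 := speed_le_generator Q_ge0 pi_gt0 rev (1 + 2 * kappa * r) (q0 r h) H1.
  (* The velocity has mean zero, so the constant 1 in the differential [ln + 1] of the entropy drops
     out. *)
  rewrite dq; have m0 := speed_le_mean0 H2.
  rewrite innerDl inner1 m0 addr0; apply: speed_leW H2.
  rewrite lerD2r; have F0 := speed_le_ge0 vn.
  have c0 : 0 <= 1 + 2 * kappa * r by rewrite addr_ge0 ?mulr_ge0 // ltW.
  rewrite expr2 -mulrA [leRHS]mulrC ler_wpM2l // mulrA ler_piMl //.
  by rewrite expRN ler_pdivrMr ?expR_gt0 // mul1r heat_clock_speed.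
- by move: FA; rewrite /q /p; lra.
Qed.

Lemma heat_route a b A f g r0 r1 : route a b A f g ->
  0 <= r0 -> heat_clock r0 = a -> 0 <= r1 -> heat_clock r1 = b ->
  route r0 r1 (A - 2 * (entropy pi (heat Q r1 g) - entropy pi (heat Q r0 f)))
    (heat Q r0 f) (heat Q r1 g).
Proof.
have lt r r' : 0 <= r' -> heat_clock r < heat_clock r' -> r < r'.
  by move=> r'0; apply: contraTT; rewrite -!leNgt; exact: heat_clock_le.
move=> rt; elim: rt r0 r1 => {a b A f g} [a b A f g [gam [gc ga gb _]] r0 r1 r00 ea r10 eb|].
  subst; apply: route_link; apply: heat_link => //.
  by apply: lt => //; have [] := gc.
move=> a m b A B f g h l r IH r0 r1 r00 ea r10 eb.
have m0 : 0 <= m.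
  have [gam [[am _ _ _] _ _ _]] := l; apply: ltW; apply: le_lt_trans am.
  by rewrite -ea addr_ge0 // mulr_ge0 // sqr_ge0.
have [rm rm0 em] := heat_clock_surj m0.
have [gam [gc ga gb _]] := l.
have := IH rm r1 rm0 em r10 eb.
have L : link r0 rm (A - 2 * (entropy pi (heat Q rm g) - entropy pi (heat Q r0 f)))
    (heat Q r0 f) (heat Q rm g).
  subst; apply: heat_link => //.
  by apply: lt => //; have [] := gc.
move=> /(route_cons L); apply: routeW; lra.
Qed.

(** The heat flow itself, seen as the progressive heating of the constant curve at [f], whose action
    is 0. It joins a density that may vanish to a positive one at a cost that tends to 0 with
    [r]. *)
Lemma heat_start_link r f : 0 < r -> density pi f ->
  link 0 r (2 * (entropy pi f - entropy pi (heat Q r f))) f (heat Q r f).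
Proof.
move=> r0 fd; have u0 : heat_clock 0 = 0 by rewrite /heat_clock expr0n /= mulr0 addr0.
have kC (k : R) : C1 (fun=> k) /\ forall t, derive1 (fun=> k) t = 0.
  by apply: C1_is_derive; move=> t; exact: cvg_cst.
have ct : controlled (fun=> f) (heat_clock 0) (heat_clock r) 0.
  split; first exact: heat_clock_lt.
  - by move=> x; exact: (kC (f x)).1.
  - by [].
  exists (fun=> 0), (fun=> 0); split; last by rewrite subr0.
    by move=> t; exact: cvg_cst.
  move=> t _; split; first exact: is_derive_cst.
  move=> phi; rewrite /inner big1 => [|x _]; last by rewrite (kC (f x)).2 mulr0 mul0r.
  by rewrite mulr0 sub0r oppr_le0 energy_ge0.
have := heat_link (lexx 0) r0 ct.
have -> : heat Q 0 f = f by apply/funext => x; exact: heat0.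
by apply: linkW; lra.
Qed.

Definition speed_sq gam t :=
  energy Q pi (gam t) (potential Q pi (gam t) (fun x => derive1 (gam ^~ x) t)).

Lemma derive_density_mean0 gam a b t : (forall x, C1 (gam ^~ x)) ->
  (forall t, a < t < b -> density pi (gam t)) -> a < t < b ->
  \sum_x derive1 (gam ^~ x) t * pi x = 0.
Proof.
move=> gC gd /andP[at_ tb].
have H1 : is_derive t 1 (fun t => \sum_x gam t x * pi x)
    (\sum_x derive1 (gam ^~ x) t * pi x).
  by apply: is_derive_bigsum => x; apply: is_deriveMr; exact: is_derive_C1.
have H2 : is_derive t 1 (fun t => \sum_x gam t x * pi x) 0.
  apply: (@near_eq_is_derive R R R (fun=> 1)).
  near=> u; have [] // := gd u _; apply/andP; split.
    by near: u; exact: lt_nbhsr.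
  by near: u; exact: lt_nbhsl.
by rewrite -(@derive_val _ _ _ _ _ _ _ H1) (@derive_val _ _ _ _ _ _ _ H2).
Unshelve. all: by end_near. Qed.

Lemma cvg_speed_sq (T : Type) (F : set_system T) {FF : Filter F} gam
    (u : T -> R) t : (forall x, C1 (gam ^~ x)) -> (forall x, 0 < gam t x) ->
  u @ F --> t -> (fun z => speed_sq gam (u z)) @ F --> speed_sq gam t.
Proof.
move=> gC g0 ut.
have gcvg x : (fun z => gam (u z) x) @ F --> gam t x.
  exact: (cvg_comp _ _ ut (is_derive_continuous (is_derive_C1 t (gC x)))).
apply: cvg_energy => // x; apply: cvg_potential => // y.
by have [_ dc] := gC y; exact: (cvg_comp _ _ ut (dc t)).
Qed.

Lemma positive_link gam a b : a < b -> (forall x, C1 (gam ^~ x)) ->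
  (forall t, a <= t <= b -> density pi (gam t)) ->
  (forall t, a <= t <= b -> forall x, 0 < gam t x) ->
  exists2 A, (\int[mu]_(t in `[a, b]) (speed_sq gam t)%:E)%E = A%:E &
    link a b A (gam a) (gam b).
Proof.
move=> ab gC gd g0.
(* Positivity, hence continuity of the speed, is known on [[a, b]] only; clamping the time extends
   it to the line as [exists_primitive] requires. *)
have nc : continuous (fun t => speed_sq gam (clamp a b t)).
  move=> t; apply: cvg_speed_sq => //; first exact/g0/clamp_itv/ltW.
  exact: continuous_clamp.
have [F [Fc Fd FE]] := exists_primitive ab nc.
exists (F b - F a).
  rewrite -FE; apply: eq_integral => t; rewrite inE /= in_itv /= => h.
  by rewrite clamp_id.
have oc t : a < t < b -> a <= t <= b by move=> /andP[h1 h2]; rewrite !ltW.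
exists gam; split => //; last by move=> t /oc; exact: g0.
split => //; exists F, (fun t => speed_sq gam (clamp a b t)); split => // t h.
split; first exact: Fd.
rewrite clamp_id; last exact: oc.
apply: speed_le_potential => //; first exact/g0/oc.
by apply: (derive_density_mean0 gC _ h) => s /oc /gd.
Qed.

End HeatedRoutes.

(** * From admissible curves to routes, by heating *)

Section AdmissibleCurves.
Context {R : realType} {X : finType}.
Variables (Q : X -> X -> R) (pi : X -> R) (kappa : R).
Implicit Types (f g h v : X -> R) (a b m A B s t r e : R).
Implicit Types (rho psi gam : R -> X -> R).
Hypothesis Q_ge0 : forall x y, 0 <= Q x y.
Hypothesis pi_gt0 : forall x, 0 < pi x.
Hypothesis pi_sum : \sum_x pi x = 1.
Hypothesis rev : forall x y, Q x y * pi x = Q y x * pi y.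
Hypothesis irr : forall x y, connect (fun x y => 0 < Q x y) x y.
Hypothesis kappa_ge0 : 0 <= kappa.
Hypothesis be : forall a, 0 <= a <= 1 -> bochner Q pi kappa (smean a) (smean1 a).

Let pi_ge0 x : 0 <= pi x. Proof. exact: ltW. Qed.

Notation route := (route Q pi).
Notation link := (link Q pi).
Notation mu := (@lebesgue_measure R).

(* No measurability is needed: the integral of a nonnegative function is a
   supremum over simple functions. *)
Lemma ge0_le_integral_nonmeasurable (D : set R) (f1 f2 : R -> \bar R) :
  (forall x, D x -> 0 <= f1 x)%E -> (forall x, D x -> f1 x <= f2 x)%E ->
  (\int[mu]_(x in D) f1 x <= \int[mu]_(x in D) f2 x)%E.
Proof.
move=> f10 f12; rewrite !ge0_integralE //; last first.
  by move=> x Dx; exact: le_trans (f10 x Dx) (f12 x Dx).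
apply: ereal_sup_le => _ [k kf <-]; exists k => // x.
exact: le_trans (kf x) (lee_restrict f12 x).
Qed.

Lemma derive1_near (f g : R -> R) t : (\near t, f t = g t) ->
  derive1 f t = derive1 g t.
Proof. by move=> fg; rewrite !derive1E; exact: near_eq_derive. Qed.

Lemma measurable_continuous_oo (f g : R -> R) a b :
  (forall t, a < t < b -> f t = g t) ->
  (forall t, a < t < b -> {for t, continuous g}) ->
  measurable_fun `[a, b] f.
Proof.
move=> fg gc; apply: (@measurable_fun_itv_cc _ _ _ false true).
apply: (@eq_measurable_fun _ _ _ _ _ g).
  by move=> t; rewrite inE /= in_itv /= => h; rewrite fg.
apply: open_continuous_measurable_fun; first exact: interval_open.
by move=> t; rewrite inE /= in_itv /= => h; exact: gc.
Qed.

Lemma integral_itv_split (f : R -> \bar R) a m b : a <= m -> m <= b ->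
  measurable_fun `[a, b] f -> (forall t, 0 <= f t)%E ->
  (\int[mu]_(t in `[a, b]) f t =
   \int[mu]_(t in `[a, m]) f t + \int[mu]_(t in `[m, b]) f t)%E.
Proof.
move=> am mb mf f0.
have U : `[a, b]%classic = `[a, m[%classic `|` `[m, b]%classic.
  by rewrite -itv_bndbnd_setU ?bnd_simp.
rewrite [in LHS]U ge0_integral_setU //.
- congr (_ + _)%E; apply: integral_itv_bndo_bndc.
  apply: measurable_funS mf => //; rewrite U; exact: subsetUl.
- by rewrite -U.
- apply/disj_setPS => t /= []; rewrite !in_itv /= => /andP[_ tm] /andP[mt _].
  by rewrite ltNge mt in tm.
Qed.

Lemma measurable_itv_split (f : R -> R) a m b : a <= m -> m <= b ->
  measurable_fun `[a, m] f -> measurable_fun `[m, b] f ->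
  measurable_fun `[a, b] f.
Proof.
move=> am mb f1 f2.
have -> : `[a, b]%classic = `[a, m[%classic `|` `[m, b]%classic.
  by rewrite -itv_bndbnd_setU ?bnd_simp.
apply/measurable_funU => //; split => //.
by apply: measurable_funS f1 => //; exact: subset_itv_co_cc.
Qed.

Lemma continuous_speed_sq gam t : (forall x, C1 (gam ^~ x)) ->
  (forall x, 0 < gam t x) -> {for t, continuous (speed_sq Q pi gam)}.
Proof.
by move=> gC g0; apply: (@cvg_speed_sq _ _ Q pi Q_ge0 pi_gt0 pi_sum rev irr R
  (nbhs t) _ gam (fun z => z) t gC g0); exact: cvg_id.
Qed.

Definition action_density rho psi t := energy Q pi (rho t) (psi t).

Lemma action_densityE rho psi t :
  \sum_x \sum_y (psi t x - psi t y) ^+ 2 * logmean (rho t x) (rho t y)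
    * Q x y * pi x = 2 * action_density rho psi t.
Proof.
rewrite /action_density /energy /dform mulrA divff // mul1r.
apply: eq_bigr => x _; apply: eq_bigr => y _; ring.
Qed.

(** The second half of [piecewise_C1] with a variable left end, for induction on the partition. *)
Definition pieces a (s : seq R) rho :=
  forall i, (i < size s)%N -> forall x, exists2 g, C1 g &
    forall t : R, t \in `[nth 0 (a :: s) i, nth 0 s i] -> rho t x = g t.

Definition continuity_eq rho psi t := forall x,
  derive1 (rho ^~ x) t
  + \sum_y (psi t y - psi t x) * logmean (rho t x) (rho t y) * Q x y = 0.

Lemma continuity_eqE rho psi t : continuity_eq rho psi t <->
  (fun x => derive1 (rho ^~ x) t) = weighted_div Q (rho t) (psi t).
Proof.
have E x : \sum_y (psi t y - psi t x) * logmean (rho t x) (rho t y) * Q x y =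
    - weighted_div Q (rho t) (psi t) x.
  by rewrite /weighted_div -sumrN; apply: eq_bigr => y _; ring.
split=> [H|H x].
  by apply/funext => x; apply/eqP; rewrite -subr_eq0 -E H.
by rewrite E -H subrr.
Qed.

Section Regularize.
Variables (rho psi : R -> X -> R) (e : R).
Hypothesis e_gt0 : 0 < e.

Let n0 t := energy Q pi (heat Q e (rho t)) (potential Q pi (heat Q e (rho t))
  (heat Q e (fun x => derive1 (rho ^~ x) t))).

(* Truncated to be a lower bound of the action density even at break points. *)
Let n t := if n0 t <= action_density rho psi t then n0 t else 0.

Let n_ge0 t : 0 <= n t.
Proof. by rewrite /n; case: ifP => _; [exact: energy_ge0|exact: lexx]. Qed.

(** The heated velocity has a dual norm bounded by the original action. Testing that bound at its
    own potential [p] gives [2 E(p) - E(p) = E(p)], with [E] the energy; the contraction factor is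
    at most 1 as [kappa >= 0]. *)
Lemma heat_action_le t : density pi (rho t) -> continuity_eq rho psi t ->
  n0 t <= action_density rho psi t.
Proof.
move=> rd /continuity_eqE E; rewrite /n0 E.
have vn := speed_le_weighted_div Q_ge0 pi_gt0 rev (psi t) rd.1.
have h0 x := heat_density_gt0 Q_ge0 irr x e_gt0 rd.
have H := heat_speed_le Q_ge0 pi_ge0 rev be (ltW e_gt0) rd.1 h0 vn.
have m0 := speed_le_mean0 H.
have := H (potential Q pi (heat Q e (rho t)) (heat Q e (weighted_div Q (rho t) (psi t)))).
rewrite (inner_potential Q_ge0 pi_gt0 pi_sum rev irr h0 m0) mulr_natl mulr2n addrK.
move=> /le_trans; apply.
rewrite ler_piMl ?energy_ge0 // -expR0 ler_expR oppr_le0.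
by rewrite !mulr_ge0 // ltW.
Qed.

(** A piece agrees on [[a, b]] with functions that are C1 on the line. Heating these gives a
    positive C1 curve whose velocity at interior times is the heated velocity of [rho], however
    irregular [psi] is. *)
Lemma heat_piece_link a b : a < b ->
  (forall x, exists2 g, C1 g & forall t : R, t \in `[a, b] -> rho t x = g t) ->
  (forall t, a <= t <= b -> density pi (rho t)) ->
  (forall t, a < t < b -> continuity_eq rho psi t) ->
  measurable_fun `[a, b] n /\
  exists2 A, (\int[mu]_(t in `[a, b]) (n t)%:E)%E = A%:E &
    link a b A (heat Q e (rho a)) (heat Q e (rho b)).
Proof.
move=> ab /= rg rd req.
have [g gP] := @choice X (R -> R) (fun x (g : R -> R) => C1 g /\
    forall t : R, t \in `[a, b] -> rho t x = g t)
  (fun x => let: ex_intro2 g h1 h2 := rg x in ex_intro _ g (conj h1 h2)).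
pose gam t := heat Q e (fun y => g y t).
have oc t : a < t < b -> a <= t <= b by move=> /andP[h1 h2]; rewrite !ltW.
have gamE t : a <= t <= b -> gam t = heat Q e (rho t).
  move=> h; congr heat; apply/funext => y; rewrite (gP y).2 //.
have gamC x : C1 (gam ^~ x) /\ forall t, derive1 (gam ^~ x) t =
    heat Q e (fun y => derive1 (g y) t) x.
  apply: C1_is_derive => t.
    apply: is_derive_bigsum => y; apply: is_deriveMl.
    by apply: is_derive_C1; exact: (gP y).1.
  apply: cvg_bigsum => y; apply: cvgMr.
  by have [[_ gc] _] := gP y; exact: gc.
have gamd t : a <= t <= b -> density pi (gam t).
  by move=> h; rewrite gamE //; apply: heat_density => //; [exact: ltW|exact: rd].
have gam0 t : a <= t <= b -> forall x, 0 < gam t x.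
  by move=> h x; rewrite gamE //; apply: heat_density_gt0 => //; exact: rd.
have nE t : a < t < b -> n t = speed_sq Q pi gam t.
  move=> h; rewrite /n heat_action_le; last exact: req; last exact/rd/oc.
  rewrite /n0 /speed_sq gamE; last exact: oc.
  congr (energy _ _ _ (potential _ _ _ _)); apply/funext => x; rewrite (gamC x).2.
  congr heat; apply/funext => y; have /andP[h1 h2] := h.
  apply: derive1_near; near=> u; apply: (gP y).2; rewrite in_itv /=.
  by apply/andP; split; apply: ltW; near: u; [exact: lt_nbhsr|exact: lt_nbhsl].
have nc t : a < t < b -> {for t, continuous (speed_sq Q pi gam)}.
  move=> h; apply: continuous_speed_sq; last exact/gam0/oc.
  by move=> x; exact: (gamC x).1.
have mn : measurable_fun `[a, b] n by exact: measurable_continuous_oo nE nc.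
split => //.
have [A AE L] := positive_link Q_ge0 pi_gt0 pi_sum rev irr ab (fun x => (gamC x).1) gamd gam0.
exists A; last by rewrite -!gamE // lexx ltW.
rewrite -AE; apply: eq_integral_itv_bounded.
- by apply: measurable_funS mn => //; exact: subset_itv_oo_cc.
- apply: open_continuous_measurable_fun; first exact: interval_open.
  by move=> t; rewrite inE /= in_itv /=; exact: nc.
- by move=> t; rewrite in_itv /=; exact: nE.
Unshelve. all: by end_near. Qed.

Lemma heat_pieces_route (s : seq R) a b : s <> [::] -> itv_partition a b s ->
  pieces a s rho ->
  (forall t, a <= t <= b -> density pi (rho t)) ->
  (forall t, a < t < b -> t \notin s -> continuity_eq rho psi t) ->
  measurable_fun `[a, b] n /\
  exists2 A, (\int[mu]_(t in `[a, b]) (n t)%:E)%E = A%:E &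
    route a b A (heat Q e (rho a)) (heat Q e (rho b)).
Proof.
elim: s a => // m s IH a _ sp pc rd req.
have [/= /andP[am ps] lm] := sp; have sp' : itv_partition m b s by split.
have mb := itv_partition_le sp'.
have req1 t : a < t < m -> continuity_eq rho psi t.
  move=> /andP[h1 h2]; apply: req; first by rewrite h1 (lt_le_trans h2).
  rewrite inE negb_or lt_eqF //=; apply/negP => ts.
  have /allP /(_ _ ts) := lt_path_min ps.
  by rewrite ltNge (ltW h2).
have rd1 t : a <= t <= m -> density pi (rho t).
  by move=> /andP[h1 h2]; apply: rd; rewrite h1 (le_trans h2).
have [mn [A AE L]] := heat_piece_link am (pc 0%N isT) rd1 req1.
have [s0|/eqP s0] := eqVneq s [::].
  have bm : b = m by move: lm; rewrite s0 /= => /eqP.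
  by rewrite bm; split => //; exists A => //; exact: route_link.
have [||mn' [B BE rt]] := IH m s0 sp' (fun i si => pc i.+1 si).
- by move=> t /andP[h1 h2]; apply: rd; rewrite h2 (le_trans (ltW am)).
- move=> t /andP[h1 h2] ts; apply: req; first by rewrite h2 (lt_trans am).
  by rewrite inE negb_or ts gt_eqF.
have mn2 := measurable_itv_split (ltW am) mb mn mn'.
split => //; exists (A + B); last exact: route_cons rt.
by rewrite (integral_itv_split (ltW am) mb) ?AE ?BE //; exact/measurable_EFinP.
Qed.

Lemma route_of_admissible f0 f1 A : admissible Q pi f0 f1 rho psi ->
  (curve_action Q pi rho psi <= A%:E)%E ->
  route 0 1 A (heat Q e f0) (heat Q e f1).
Proof.
move=> [rd [mpsi [[s [sp pc] req] [r0 r1]]]] cA.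
have s0 : s <> [::].
  by move=> s0; move: sp; rewrite s0 => /itv_partition_nil /eqP; rewrite eq_sym oner_eq0.
have [||mn [B BE rt]] := heat_pieces_route s0 sp pc.
- by move=> t h; apply: rd; rewrite in_itv.
- by move=> t h ts; apply: req => //; rewrite in_itv.
rewrite -r0 -r1; apply: routeW rt; rewrite -lee_fin; apply: le_trans cA.
rewrite -BE /curve_action.
have -> : (\int[mu]_(t in `[0%R, 1%R]) (n t)%:E =
    2^-1%:E * \int[mu]_(t in `[0%R, 1%R]) (2%:E * (n t)%:E))%E.
  rewrite ge0_integralZl_EFin //; last exact/measurable_EFinP.
    by rewrite muleA -EFinM mulVf // mul1e.
  by move=> t _; rewrite lee_fin.
apply: lee_wpmul2l; first by rewrite lee_fin.
apply: ge0_le_integral_nonmeasurable => t _; rewrite -EFinM lee_fin ?mulr_ge0 //.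
rewrite action_densityE ler_pM2l // /n; case: ifP => [h|_]; first exact: h.
exact: energy_ge0.
Qed.

End Regularize.

End AdmissibleCurves.

(** * From routes back to admissible curves *)

Section CurvesFromRoutes.
Context {R : realType} {X : finType}.
Variables (Q : X -> X -> R) (pi : X -> R).
Implicit Types (f g h v : X -> R) (a b m A B s t r e : R).
Implicit Types (rho psi gam : R -> X -> R).
Hypothesis Q_ge0 : forall x y, 0 <= Q x y.
Hypothesis pi_gt0 : forall x, 0 < pi x.
Hypothesis pi_sum : \sum_x pi x = 1.
Hypothesis rev : forall x y, Q x y * pi x = Q y x * pi y.
Hypothesis irr : forall x y, connect (fun x y => 0 < Q x y) x y.

Let pi_ge0 x : 0 <= pi x. Proof. exact: ltW. Qed.

Notation route := (route Q pi).
Notation link := (link Q pi).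
Notation mu := (@lebesgue_measure R).
Notation action_density := (action_density Q pi).

Record curve_on a b A f g rho psi (s : seq R) : Prop := CurveOn {
  curve_partition : itv_partition a b s;
  curve_pieces : pieces a s rho;
  curve_density : forall t, a <= t <= b -> density pi (rho t);
  curve_eq : forall t, a < t < b -> t \notin s -> continuity_eq Q rho psi t;
  curve_measurable : forall x, measurable_fun `[a, b] (fun t => psi t x);
  curve_start : rho a = f;
  curve_end : rho b = g;
  curve_action_measurable : measurable_fun `[a, b] (action_density rho psi);
  curve_action_le : (\int[mu]_(t in `[a, b]) (action_density rho psi t)%:E <= A%:E)%E
}.

Lemma curve_of_link a b A f g : link a b A f g ->
  exists rho psi, curve_on a b A f g rho psi [:: b] /\ forall x, C1 (rho ^~ x).
Proof.
move=> [gam [[ab gC gd [F [F' [Fc Fd FA]]]] ga gb g0]].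
have oc t : a < t < b -> a <= t <= b by move=> /andP[h1 h2]; rewrite !ltW.
pose psi t := potential Q pi (gam t) (fun x => derive1 (gam ^~ x) t).
have m0 t : a < t < b -> \sum_x derive1 (gam ^~ x) t * pi x = 0.
  by move=> h; apply: (derive_density_mean0 gC _ h) => u /oc /gd.
have sc t : a < t < b -> {for t, continuous (action_density gam psi)}.
  move=> h; apply: (continuous_speed_sq Q_ge0 pi_gt0 pi_sum rev irr gC).
  exact: g0.
have ms : measurable_fun `[a, b] (action_density gam psi).
  by apply: measurable_continuous_oo sc.
exists gam, psi; split => //; split => //.
- exact: itv_partition1.
- move=> i; rewrite ltnS leqn0 => /eqP -> x; exists (gam ^~ x) => //; exact: gC.
- move=> t h _; apply/continuity_eqE; apply/funext => x.
  rewrite potentialE //; [exact: g0|exact: m0].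
- move=> x; apply: measurable_continuous_oo (_ : forall t, a < t < b -> psi t x = psi t x) _ => //.
  move=> t h; apply: (@cvg_potential _ _ Q pi Q_ge0 pi_gt0 pi_sum rev irr R (nbhs t)) => [||y].
  + exact: g0.
  + by move=> y; exact: (is_derive_continuous (is_derive_C1 t (gC y))).
  + by have [_ dc] := gC y; exact: dc.
- rewrite (@integral_itv_bndoo _ _ _ _ true false); last first.
    apply/measurable_EFinP; apply: measurable_funS ms => //.
  apply: (@le_trans _ _ (F b - F a)%:E); last by rewrite lee_fin.
  apply: (@integral_le_increment _ F F') => //.
    by move=> t /Fd[].
  (* The speed bound tested at the potential [psi t] itself: its left side is then exactly the
     action density. *)
  move=> t h; have [_ vn] := Fd t h; apply/andP; split; first exact: energy_ge0.
  have := vn (psi t); rewrite (inner_potential Q_ge0 pi_gt0 pi_sum rev irr (g0 t h) (m0 t h)).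
  by rewrite mulr_natl mulr2n addrK.
Qed.

Lemma curve_of_route a b A f g : route a b A f g ->
  exists rho psi (s : seq R), curve_on a b A f g rho psi s.
Proof.
elim=> {a b A f g} [a b A f g /curve_of_link[rho [psi [H _]]]|].
  by exists rho, psi, [:: b].
move=> a m b A B f g h l rt [rho2 [psi2 [s [sp2 pc2 d2 e2 m2 st2 en2 am2 al2]]]].
have [rho1 [psi1 [[sp1 pc1 d1 e1 m1 st1 en1 am1 al1] C1rho]]] := curve_of_link l.
have am : a < m by move: sp1 => [] /= /andP[].
have mb : m < b by exact: route_lt rt.
(* The densities agree at [m]. The potentials may not, but [m] is a break point, where no equation
   is asked. *)
pose rho t := if t <= m then rho1 t else rho2 t.
pose psi t := if t < m then psi1 t else psi2 t.
have rho1E t : t <= m -> rho t = rho1 t by rewrite /rho => ->.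
have rho2E t : m <= t -> rho t = rho2 t.
  rewrite le_eqVlt => /predU1P[<-|mt]; first by rewrite /rho lexx en1 st2.
  by rewrite /rho leNgt mt.
have psi1E t : t < m -> psi t = psi1 t by rewrite /psi => ->.
have psi2E t : m <= t -> psi t = psi2 t by rewrite /psi ltNge => ->.
have glue (u u1 u2 : R -> R) : (forall t, t < m -> u t = u1 t) ->
    (forall t, m <= t -> u t = u2 t) -> measurable_fun `[a, m] u1 ->
    measurable_fun `[m, b] u2 ->
    measurable_fun `[a, m] u /\ measurable_fun `[m, b] u.
  move=> h1 h2 mu1 mu2; split.
    apply: (@measurable_fun_itv_cc _ _ _ true true).
    apply: (@eq_measurable_fun _ _ _ _ _ u1).
      by move=> t; rewrite inE /= in_itv /= => /andP[_ tm]; rewrite h1.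
    by apply: measurable_funS mu1 => //; exact: subset_itv_co_cc.
  apply: (@eq_measurable_fun _ _ _ _ _ u2) => //.
  by move=> t; rewrite inE /= in_itv /= => /andP[mt _]; rewrite h2.
have E1 t : t < m -> action_density rho psi t = action_density rho1 psi1 t.
  by move=> h1; rewrite /action_density rho1E ?psi1E // ltW.
have E2 t : m <= t -> action_density rho psi t = action_density rho2 psi2 t.
  by move=> h1; rewrite /action_density rho2E ?psi2E.
have [ms1 ms2] := glue _ _ _ E1 E2 am1 am2.
have ms := measurable_itv_split (ltW am) (ltW mb) ms1 ms2.
exists rho, psi, (m :: s); split => //.
- exact: (itv_partition_cat (itv_partition1 am) sp2).
- move=> [_ x|i si x].
    exists (rho1 ^~ x) => // t; rewrite /= in_itv /= => /andP[_ tm].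
    by rewrite rho1E.
  have [g0 g0C g0E] := pc2 i si x; exists g0 => // t tin; rewrite rho2E ?g0E //.
  have := itv_partition_nth_ge (leqW si : (i < (size s).+1)%N) sp2.
  rewrite (set_nth_default 0) /= ?ltnS 1?ltnW // => /le_trans; apply.
  by move: tin; rewrite in_itv /= => /andP[].
- move=> t /andP[h1 h2]; have [tm|mt] := leP t m.
    by rewrite rho1E //; apply: d1; rewrite h1.
  by rewrite rho2E ?(ltW mt) //; apply: d2; rewrite h2 ltW.
- move=> t /andP[h1 h2]; rewrite inE negb_or => /andP[tm ts].
  have [{}tm|{}tm|te] := ltgtP t m; last by rewrite te eqxx in tm.
    move=> x; rewrite (@derive1_near _ (rho ^~ x) (rho1 ^~ x)).
      rewrite rho1E ?psi1E ?(ltW tm) //; apply: e1; first by rewrite h1.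
      by rewrite inE lt_eqF.
    by near=> u; rewrite rho1E //; apply: ltW; near: u; exact: lt_nbhsl.
  move=> x; rewrite (@derive1_near _ (rho ^~ x) (rho2 ^~ x)).
    by rewrite rho2E ?psi2E ?(ltW tm) //; apply: e2 => //; rewrite tm.
  by near=> u; rewrite rho2E //; apply: ltW; near: u; exact: lt_nbhsr.
- move=> x; have [||k1 k2] := glue (fun t => psi t x) (fun t => psi1 t x)
    (fun t => psi2 t x) _ _ (m1 x) (m2 x).
  + by move=> t tm; rewrite psi1E.
  + by move=> t tm; rewrite psi2E.
  exact: measurable_itv_split (ltW am) (ltW mb) k1 k2.
- by rewrite rho1E // ltW.
- by rewrite rho2E // ltW.
- have S0 t : (0 <= (action_density rho psi t)%:E)%E by rewrite lee_fin energy_ge0.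
  rewrite (integral_itv_split (ltW am) (ltW mb)) //; last exact/measurable_EFinP.
  rewrite EFinD; apply: leeD; [apply: le_trans al1|apply: le_trans al2].
    rewrite le_eqVlt; apply/orP; left; apply/eqP; apply: eq_integral_itv_bounded.
    + by apply: measurable_funS ms1 => //; exact: subset_itv_oo_cc.
    + by apply: measurable_funS am1 => //; exact: subset_itv_oo_cc.
    + by move=> t; rewrite in_itv /= => /andP[_ tm]; exact: E1.
  rewrite le_eqVlt; apply/orP; left; apply/eqP; apply: eq_integral => t.
  by rewrite inE /= in_itv /= => /andP[mt _]; rewrite E2.
Unshelve. all: by end_near. Qed.

Lemma admissible_of_route A f g : route 0 1 A f g ->
  exists rho psi, admissible Q pi f g rho psi /\
    (curve_action Q pi rho psi <= A%:E)%E.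
Proof.
move=> /curve_of_route[rho [psi [s [sp pc d e mp st en am al]]]].
exists rho, psi; split.
  split; first by move=> t; rewrite in_itv; exact: d.
  split => //; split; last by split.
  exists s; first by split.
  by move=> t; rewrite in_itv /=; exact: e.
rewrite /curve_action.
under eq_integral do rewrite action_densityE EFinM.
rewrite ge0_integralZl_EFin //; last exact/measurable_EFinP.
  by rewrite muleA -EFinM mulVf // mul1e.
by move=> t _; rewrite lee_fin energy_ge0.
Qed.

End CurvesFromRoutes.

(** * Convexity of the entropy along geodesics *)

Section GeodesicConvexity.
Context {R : realType} {X : finType}.
Variables (Q : X -> X -> R) (pi : X -> R) (kappa : R).
Implicit Types (f g s : X -> R) (a b d e h t : R).
Hypothesis Q_ge0 : forall x y, 0 <= Q x y.
Hypothesis pi_gt0 : forall x, 0 < pi x.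
Hypothesis pi_sum : \sum_x pi x = 1.
Hypothesis rev : forall x y, Q x y * pi x = Q y x * pi y.
Hypothesis irr : forall x y, connect (fun x y => 0 < Q x y) x y.
Hypothesis kappa_ge0 : 0 <= kappa.
Hypothesis be : forall a, 0 <= a <= 1 -> bochner Q pi kappa (smean a) (smean1 a).

Let pi_ge0 x : 0 <= pi x. Proof. exact: ltW. Qed.

Notation route := (route Q pi).
Notation link := (link Q pi).
Notation H := (entropy pi).

Definition sqW f g : \bar R := ereal_inf [set a | exists rho psi,
    admissible Q pi f g rho psi /\ a = curve_action Q pi rho psi].

Lemma sqW_le a f g : route 0 1 a f g -> (sqW f g <= a%:E)%E.
Proof.
move=> /(admissible_of_route Q_ge0 pi_gt0 pi_sum rev irr)[rho [psi [ad cA]]].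
by apply: le_trans cA; apply: ereal_inf_lbound; exists rho, psi.
Qed.

(** The inequality is strict because the infimum need not be attained; the endpoints are heated
    because the regularisation acts on the whole curve. *)
Lemma route_of_sqW a e f g : 0 < e -> (sqW f g < a%:E)%E ->
  route 0 1 a (heat Q e f) (heat Q e g).
Proof.
move=> e0 /ereal_inf_lt[_ [rho [psi [ad ->]]] /ltW cA].
exact: (route_of_admissible Q_ge0 pi_gt0 pi_sum rev irr kappa_ge0 be e0 ad cA).
Qed.

Lemma sqW_ge0 f g : (0 <= sqW f g)%E.
Proof.
apply: le_ereal_inf_tmp => _ [rho [psi [_ ->]]]; rewrite mule_ge0 ?lee_fin //.
apply: integral_ge0 => t _; rewrite action_densityE lee_fin mulr_ge0 //.
exact: energy_ge0.
Qed.

Lemma W_sqW f g : W Q pi f g = sqrte (sqW f g).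
Proof. by []. Qed.

Lemma start_route e f : 0 < e -> density pi f ->
  route 0 e (2 * (H f - H (heat Q e f))) f (heat Q e f).
Proof.
move=> e0 fd; apply: route_link.
exact: (heat_start_link Q_ge0 pi_gt0 rev irr kappa_ge0 be e0 fd).
Qed.

(** An explicit curve: heat [f] during [[0, 1]], follow the segment between the two heated, hence
    positive, densities during [[1, 2]], then run the heat flow of [g] backwards during [[2, 3]]. *)
Lemma sqW_lty f g : density pi f -> density pi g -> (sqW f g < +oo)%E.
Proof.
move=> fd gd; have e0 : (0 : R) < 1 by [].
pose gam t x := (2 - t) * heat Q 1 f x + (t - 1) * heat Q 1 g x.
have gC x : C1 (gam ^~ x).
  apply: (C1_is_derive (df := fun=> heat Q 1 g x - heat Q 1 f x) _ _).1 => t.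
    have D1 := is_deriveMr (heat Q 1 f x)
      (is_deriveB (is_derive_cst (2 : R) t 1) (is_derive_id t 1)).
    have D2 := is_deriveMr (heat Q 1 g x)
      (is_deriveB (is_derive_id t 1) (is_derive_cst (1 : R) t 1)).
    by apply: (is_derive_eq (is_deriveD D1 D2)); ring.
  exact: cvg_cst.
have hf := heat_density Q_ge0 rev ler01 fd.
have hg := heat_density Q_ge0 rev ler01 gd.
have gd' t : 1 <= t <= 2 -> density pi (gam t).
  move=> /andP[h1 h2]; split=> [x|].
    by rewrite addr_ge0 // mulr_ge0 ?subr_ge0 //; [exact: hf.1|exact: hg.1].
  rewrite /gam; under eq_bigr do rewrite mulrDl -!mulrA.
  by rewrite big_split /= -!mulr_sumr hf.2 hg.2; ring.
have g0 t : 1 <= t <= 2 -> forall x, 0 < gam t x.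
  move=> /andP[h1 h2] x; have f0 := heat_density_gt0 Q_ge0 irr x e0 fd.
  have gg0 := heat_density_gt0 Q_ge0 irr x e0 gd.
  have [t1|t1] := eqVneq t 1.
    by rewrite /gam t1 subrr mul0r addr0 mulr_gt0 // subr_gt0 ltr1n.
  rewrite ltr_wpDl ?mulr_ge0 ?subr_ge0 ?(ltW f0) // mulr_gt0 // subr_gt0.
  by rewrite lt_neqAle eq_sym t1.
have l12 : (1 : R) < 2 by rewrite ltr1n.
have [B _ L] := positive_link Q_ge0 pi_gt0 pi_sum rev irr l12 gC gd' g0.
have ga : gam 1 = heat Q 1 f by apply/funext => x; rewrite /gam; ring.
have gb : gam 2 = heat Q 1 g by apply/funext => x; rewrite /gam; ring.
rewrite ga gb in L.
have r3 : route 2 3 (1 * (2 * (H g - H (heat Q 1 g)))) (heat Q 1 g) g.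
  apply: (route_affine Q_ge0 pi_gt0 (c := - 3) ltr01 _ _
    (route_rev Q_ge0 pi_gt0 (start_route e0 gd))); ring.
have rt := route_cat (start_route e0 fd) (route_cons L r3).
have k0 : 3 * 0 + 0 = 0 :> R by ring.
have k1 : 3 * 1 + 0 = 3 :> R by ring.
have k3 : 0 < 3 :> R by [].
have rt1 := route_affine Q_ge0 pi_gt0 k3 k0 k1 rt.
by apply: le_lt_trans (sqW_le rt1) _; rewrite ltry.
Qed.

(** The heat flow first repairs the endpoint [f] in time [e]. A nearly optimal curve from [f] to
    [s], heated by [e], is then traversed on [[0, heat_clock kappa h]], heated progressively up to
    time [h], and rescaled from duration [h] to [t], whence the factor [h / t]. *)
Lemma half_route f s t d e h : density pi f -> density pi s -> 0 < t -> 0 < e ->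
  0 < h -> (sqW f s <= (t ^+ 2 * d)%:E)%E ->
  route 0 (e + t) (2 * (H f - H (heat Q e f)) +
    h / t * ((t ^+ 2 * d + e) / heat_clock kappa h
      - 2 * (H (heat Q h (heat Q e s)) - H (heat Q e f))))
    f (heat Q h (heat Q e s)).
Proof.
move=> fd sd t0 e0 h0 le.
have u0 : 0 < heat_clock kappa h.
  by rewrite ltr_pwDl // mulr_ge0 // sqr_ge0.
have r1 : route 0 1 (t ^+ 2 * d + e) (heat Q e f) (heat Q e s).
  by apply: route_of_sqW => //; apply: le_lt_trans le _; rewrite lte_fin ltrDl.
have r2 : route 0 (heat_clock kappa h) ((t ^+ 2 * d + e) / heat_clock kappa h)
    (heat Q e f) (heat Q e s).
  rewrite mulrC; apply: (route_affine Q_ge0 pi_gt0 (c := 0) _ _ _ r1).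
  - by rewrite invr_gt0.
  - by rewrite mulr0 addr0.
  - by rewrite mulVf ?addr0 // gt_eqF.
have c0 : heat_clock kappa 0 = 0 by rewrite /heat_clock expr0n /= mulr0 addr0.
have r3 := heat_route Q_ge0 pi_gt0 rev irr kappa_ge0 be r2 (lexx 0) c0 (ltW h0) erefl.
have e00 k : heat Q 0 k = k by apply/funext => x; exact: heat0.
rewrite e00 in r3.
have r4 : route e (e + t) (h / t * ((t ^+ 2 * d + e) / heat_clock kappa h
      - 2 * (H (heat Q h (heat Q e s)) - H (heat Q e f))))
    (heat Q e f) (heat Q h (heat Q e s)).
  apply: (route_affine Q_ge0 pi_gt0 (c := - (h / t * e)) _ _ _ r3).
  - by rewrite divr_gt0.
  - by rewrite subrr.
  - by field; rewrite gt_eqF.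
exact: route_cat (start_route e0 fd) r4.
Qed.

Lemma cvg_heat0 f x : (fun e => heat Q e f x) @ (0 : R)^'+ --> f x.
Proof.
have := @cvg_heat R X Q Q_ge0 R ((0 : R)^'+) _ (fun e => e) (fun=> f) 0 f x.
rewrite heat0; apply; last by move=> y; exact: cvg_cst.
by apply: cvg_at_right_filter; exact: cvg_id.
Qed.

(** The half routes from [f0] and [f1] meet at the heated [s]. Joined and rescaled from duration
    [1 + 2 e] they compete with the optimal action [d]. As [e] tends to 0 the two actions add up to
    [d / (1 + kappa h)], because [heat_clock kappa h = h (1 + kappa h)]; its deficit from [d] must
    be made up by the entropy terms. *)
Lemma convexity_heat f0 f1 s t d h : density pi f0 -> density pi f1 ->
  density pi s -> 0 < t < 1 -> 0 < h -> 
  sqW f0 f1 = d%:E -> (sqW f0 s <= (t ^+ 2 * d)%:E)%E ->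
  (sqW f1 s <= ((1 - t) ^+ 2 * d)%:E)%E ->
  H (heat Q h s) <= (1 - t) * H f0 + t * H f1
    - kappa / 2 * t * (1 - t) * (d / (1 + kappa * h)).
Proof.
move=> d0 d1 ds /andP[t0 t1] h0 dE le0 le1; have t1' : 0 < 1 - t by rewrite subr_gt0.
pose C f t e := 2 * (H f - H (heat Q e f)) +
    h / t * ((t ^+ 2 * d + e) / heat_clock kappa h
      - 2 * (H (heat Q h (heat Q e s)) - H (heat Q e f))).
have bound e : 0 < e -> d <= (1 + 2 * e) * (C f0 t e + C f1 (1 - t) e).
  move=> e0; have ra := half_route d0 ds t0 e0 h0 le0.
  have rb := route_rev Q_ge0 pi_gt0 (half_route d1 ds t1' e0 h0 le1).
  have rb' : route (e + t) (1 + 2 * e) (1 * C f1 (1 - t) e) (heat Q h (heat Q e s)) f1.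
    by apply: (route_affine Q_ge0 pi_gt0 (c := - (1 + 2 * e)) ltr01 _ _ rb); ring.
  have rc := route_cat ra rb'; rewrite -lee_fin -dE; apply: sqW_le.
  rewrite -[C f1 _ _]mul1r; apply: (route_affine Q_ge0 pi_gt0 (c := 0) _ _ _ rc).
  - by rewrite ltr_pwDl // mulr_ge0 // ltW.
  - ring.
  - ring.
have limC f t' : (fun e => C f t' e) @ (0 : R)^'+ -->
    h / t' * ((t' ^+ 2 * d) / heat_clock kappa h - 2 * (H (heat Q h s) - H f)).
  have L1 : (fun e => H (heat Q e f)) @ (0 : R)^'+ --> H f.
    by apply: cvg_entropy => x; exact: cvg_heat0.
  have L2 : (fun e => H (heat Q h (heat Q e s))) @ (0 : R)^'+ --> H (heat Q h s).
    apply: cvg_entropy => x; apply: cvg_heat => //; first exact: cvg_cst.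
    by move=> y; exact: cvg_heat0.
  have L3 : (fun e : R => e) @ (0 : R)^'+ --> (0 : R).
    by apply: cvg_at_right_filter; exact: cvg_id.
  have -> : h / t' * ((t' ^+ 2 * d) / heat_clock kappa h - 2 * (H (heat Q h s) - H f)) =
    2 * (H f - H f) + h / t' * ((t' ^+ 2 * d + 0) / heat_clock kappa h
      - 2 * (H (heat Q h s) - H f)) by rewrite subrr mulr0 add0r addr0.
  apply: cvgD; first by apply: cvgMr; apply: cvgB => //; exact: cvg_cst.
  apply: cvgMr; apply: cvgB.
    by apply: cvgMl; apply: cvgD => //; exact: cvg_cst.
  by apply: cvgMr; exact: cvgB.
have lim : (fun e => (1 + 2 * e) * (C f0 t e + C f1 (1 - t) e)) @ (0 : R)^'+ -->
    (1 + 2 * 0) * (h / t * ((t ^+ 2 * d) / heat_clock kappa h - 2 * (H (heat Q h s) - H f0))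
     + h / (1 - t) * (((1 - t) ^+ 2 * d) / heat_clock kappa h - 2 * (H (heat Q h s) - H f1))).
  apply: cvgM; last by apply: cvgD; exact: limC.
  apply: cvgD; first exact: cvg_cst.
  by apply: cvgMr; apply: cvg_at_right_filter; exact: cvg_id.
have key : d <= (1 + 2 * 0) *
    (h / t * ((t ^+ 2 * d) / heat_clock kappa h - 2 * (H (heat Q h s) - H f0))
     + h / (1 - t) * (((1 - t) ^+ 2 * d) / heat_clock kappa h - 2 * (H (heat Q h s) - H f1))).
  apply: (cvgr_to_ge lim); near=> e; apply: bound; near: e; exact: nbhs_right_gt.
have k0 : 0 < 1 + kappa * h by rewrite ltr_pwDl // mulr_ge0 // ltW.
move: key; set Hs := H (heat Q h s); rewrite mulr0 addr0 mul1r => key.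
(* The entropy terms carry the weights [2 h / t] and [2 h / (1 - t)], that is, [1 - t] and [t] times
   this number. *)
have ht : 0 < 2 * h / (t * (1 - t)) by rewrite divr_gt0 ?mulr_gt0.
rewrite -(ler_pM2l ht) -subr_ge0.
have := key; rewrite -subr_ge0; congr (_ <= _).
rewrite /heat_clock; field.
have -> : h + kappa * h ^+ 2 = h * (1 + kappa * h) by ring.
by rewrite !gt_eqF // mulr_gt0.
Unshelve. all: by end_near. Qed.

Lemma convexity f0 f1 s t d : density pi f0 -> density pi f1 ->
  density pi s -> 0 < t < 1 ->
  sqW f0 f1 = d%:E -> (sqW f0 s <= (t ^+ 2 * d)%:E)%E ->
  (sqW f1 s <= ((1 - t) ^+ 2 * d)%:E)%E ->
  H s <= (1 - t) * H f0 + t * H f1 - kappa / 2 * t * (1 - t) * d.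
Proof.
move=> d0 d1 ds t01 dE le0 le1.
have lim : (fun h => (1 - t) * H f0 + t * H f1
    - kappa / 2 * t * (1 - t) * (d / (1 + kappa * h)) - H (heat Q h s)) @ (0 : R)^'+ -->
    (1 - t) * H f0 + t * H f1 - kappa / 2 * t * (1 - t) * (d / (1 + kappa * 0)) - H s.
  apply: cvgB; last by apply: cvg_entropy => x; exact: cvg_heat0.
  apply: cvgB; first exact: cvg_cst.
  apply: cvgMr; apply: cvgMr; apply: cvgV; first by rewrite mulr0 addr0 oner_neq0.
  apply: cvgD; first exact: cvg_cst.
  by apply: cvgMr; apply: cvg_at_right_filter; exact: cvg_id.
rewrite -subr_ge0; move: lim; rewrite mulr0 addr0 divr1 => lim.
apply: (cvgr_to_ge lim); near=> h; rewrite subr_ge0; apply: convexity_heat => //.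
Unshelve. all: by end_near. Qed.

Theorem Ric_ge_of_bochner : Ric_ge Q pi kappa.
Proof.
move=> rho [rd geo] t t01.
have i0 : (0 : R) \in `[0, 1] by rewrite in_itv /= lexx ler01.
have i1 : (1 : R) \in `[0, 1] by rewrite in_itv /= lexx ler01.
have d0 := rd _ i0; have d1 := rd _ i1; have dt := rd _ t01.
have sqfin f g : density pi f -> density pi g -> sqW f g = (fine (sqW f g))%:E.
  move=> fd gd; rewrite fineK // ge0_fin_numE ?sqW_ge0 //; exact: sqW_lty.
set d := fine (sqW (rho 0) (rho 1)).
have dE : sqW (rho 0) (rho 1) = d%:E by exact: sqfin.
have d_ge0 : 0 <= d by rewrite -lee_fin -dE sqW_ge0.
(* The geodesic identity squared. Taking [u = 0] and [u = 1] measures both halves towards [rho t],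
   the direction in which the half routes run. *)
have sub u : u \in `[0, 1] -> (sqW (rho u) (rho t) <= ((u - t) ^+ 2 * d)%:E)%E.
  move=> u01; have := geo u t u01 t01; rewrite !W_sqW dE sqfin //; last exact: rd.
  set v := fine _ => /= -[E]; have v0 : 0 <= v by rewrite -lee_fin -sqfin ?sqW_ge0 //; exact: rd.
  by rewrite lee_fin -(sqr_sqrtr v0) E exprMn sqr_sqrtr // real_normK // num_real.
have WE : (W Q pi (rho 0%R) (rho 1%R) ^+ 2 = d%:E)%E.
  by rewrite W_sqW sqr_sqrte ?sqW_ge0.
rewrite WE -EFinM -EFinB lee_fin.
have [->|tn0] := eqVneq t 0.
  by rewrite subr0 mul1r mul0r addr0 mulr0 !mul0r subr0.
have [->|tn1] := eqVneq t 1.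
  by rewrite subrr mul0r mul1r add0r mulr0 mul0r subr0.
have /andP[t0 t1] : 0 <= t <= 1 by move: t01; rewrite in_itv.
apply: convexity => //.
- by rewrite !lt_neqAle t0 t1 tn1 eq_sym tn0.
- by have := sub 0 i0; rewrite sub0r sqrrN.
- exact: sub.
Qed.

End GeodesicConvexity.

(** * Positivity of Bochner terms on squares and edges *)

Section CornerTerms.
Context {R : realType} {X : finType}.
Variables (th th1 : R -> R -> R).
Hypothesis thC : forall s t, th s t = th t s.
Hypothesis th_gt0 : forall s t, 0 < th s t.
Hypothesis th_euler : forall s t, 0 < s -> 0 < t ->
  th1 s t * s + th1 t s * t = th s t.
Hypothesis th_tangent : forall s t u v, 0 < s -> 0 < t -> 0 < u -> 0 < v ->
  th u v <= th1 s t * u + th1 t s * v.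
Variables (rho psi : X -> R).
Hypothesis rho_gt0 : forall x, 0 < rho x.

(* Half of the Bochner integrand at [x] for the pair of moves [x -> y] and
   [x -> z]. *)
Definition corner x y z :=
  2^-1 * (th1 (rho x) (rho y) * (rho z - rho x)) * (psi y - psi x) ^+ 2
  + th (rho x) (rho y) * (psi y - psi x) * (psi z - psi x).

(** With [D] and [D'] the increments of [psi] along the parallel edges [pq] and [rs], Euler's
    identity turns the sum into [D^2] and [D'^2] times tangent gaps plus a positive multiple of
    [(D - D')^2]. *)
Lemma corner_square_ge0 p q r s :
  0 <= corner p q r + corner q p s + corner r s p + corner s r q.
Proof.
rewrite /corner (thC (rho q)) (thC (rho s)).
have T1 := th_tangent (rho_gt0 p) (rho_gt0 q) (rho_gt0 r) (rho_gt0 s).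
have T2 := th_tangent (rho_gt0 r) (rho_gt0 s) (rho_gt0 p) (rho_gt0 q).
have E1 := th_euler (rho_gt0 p) (rho_gt0 q).
have E2 := th_euler (rho_gt0 r) (rho_gt0 s).
set D := psi q - psi p; set D' := psi s - psi r.
have -> : psi p - psi q = - D by rewrite opprB.
have -> : psi r - psi s = - D' by rewrite opprB.
have -> : psi p - psi r = - (psi r - psi p) by rewrite opprB.
have -> : psi s - psi q = psi r - psi p + D' - D by rewrite /D /D'; ring.
have -> : psi q - psi s = - (psi r - psi p) - D' + D by rewrite /D /D'; ring.
rewrite -subr_ge0 in T1; rewrite -subr_ge0 in T2; move: T1 T2.
have := th_gt0 (rho p) (rho q); have := th_gt0 (rho r) (rho s); rewrite -E1 -E2.
set a1 := th1 (rho p) (rho q); set a2 := th1 (rho q) (rho p).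
set b1 := th1 (rho r) (rho s); set b2 := th1 (rho s) (rho r) => t2 t1 T1 T2.
set T := psi r - psi p.
rewrite [leRHS](_ : _ = 2^-1 * D ^+ 2 * (a1 * rho r + a2 * rho s - (b1 * rho r + b2 * rho s))
   + 2^-1 * D' ^+ 2 * (b1 * rho p + b2 * rho q - (a1 * rho p + a2 * rho q))
   + 2^-1 * ((a1 * rho p + a2 * rho q) + (b1 * rho r + b2 * rho s)) * (D - D') ^+ 2); last by field.
by rewrite !addr_ge0 // mulr_ge0 ?sqr_ge0 // mulr_ge0 ?sqr_ge0 // ltW // addr_gt0.
Qed.

(** The same decomposition without a fourth vertex. It bounds the negative part of two corners at
    [x] by the return moves [y -> x] and [z -> x], and so prices the part of the weight that no
    square can carry. *)
Lemma corner_pair_ge0 x y z :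
  0 <= corner x y z + corner x z y + (corner y x x + corner z x x).
Proof.
rewrite /corner (thC (rho y)) (thC (rho z)).
have T1 := th_tangent (rho_gt0 x) (rho_gt0 y) (rho_gt0 z) (rho_gt0 x).
have T2 := th_tangent (rho_gt0 x) (rho_gt0 z) (rho_gt0 y) (rho_gt0 x).
have E1 := th_euler (rho_gt0 x) (rho_gt0 y).
have E2 := th_euler (rho_gt0 x) (rho_gt0 z).
rewrite thC -subr_ge0 in T1; rewrite thC -subr_ge0 in T2.
have := th_gt0 (rho x) (rho y); have := th_gt0 (rho x) (rho z).
have -> : psi x - psi y = - (psi y - psi x) by rewrite opprB.
have -> : psi x - psi z = - (psi z - psi x) by rewrite opprB.
move: T1 T2; rewrite -E1 -E2.
set D := psi y - psi x; set E := psi z - psi x.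
set a1 := th1 (rho x) (rho y); set a2 := th1 (rho y) (rho x).
set b1 := th1 (rho x) (rho z); set b2 := th1 (rho z) (rho x) => T1 T2 t2 t1.
rewrite [leRHS](_ : _ = 2^-1 * D ^+ 2 * (a1 * rho z + a2 * rho x - (b1 * rho x + b2 * rho z))
   + 2^-1 * E ^+ 2 * (b1 * rho y + b2 * rho x - (a1 * rho x + a2 * rho y))
   + 2^-1 * ((a1 * rho x + a2 * rho y) + (b1 * rho x + b2 * rho z)) * (D + E) ^+ 2); last by field.
by rewrite !addr_ge0 // mulr_ge0 ?sqr_ge0 // mulr_ge0 ?sqr_ge0 // ltW // addr_gt0.
Qed.

(** The two orientations of one edge together exceed its energy by half of [D^2] times a tangent
    gap, [D] being the increment of [psi]. This is the source of positive curvature. *)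
Lemma corner_cross_ge x y :
  2 * (th (rho x) (rho y) * (psi y - psi x) ^+ 2) <= corner x y y + corner y x x.
Proof.
rewrite /corner (thC (rho y)).
have T1 := th_tangent (rho_gt0 x) (rho_gt0 y) (rho_gt0 y) (rho_gt0 x).
have E1 := th_euler (rho_gt0 x) (rho_gt0 y).
rewrite thC -subr_ge0 -E1 in T1; rewrite -E1.
have -> : psi x - psi y = - (psi y - psi x) by rewrite opprB.
set D := psi y - psi x; rewrite -subr_ge0.
move: T1; set a1 := th1 (rho x) (rho y); set a2 := th1 (rho y) (rho x) => T1.
rewrite [leRHS](_ : _ = 2^-1 * D ^+ 2 *
  (a1 * rho y + a2 * rho x - (a1 * rho x + a2 * rho y))); last by field.
by rewrite mulr_ge0 // mulr_ge0 ?sqr_ge0 ?invr_ge0.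
Qed.

Hypothesis th1_ge0 : forall s t, 0 < s -> 0 <= th1 s t.

Lemma corner_cross_ge0 x y : 0 <= corner x y y.
Proof.
rewrite /corner -(th_euler (rho_gt0 x) (rho_gt0 y)).
have a1 := th1_ge0 (rho y) (rho_gt0 x); have a2 := th1_ge0 (rho x) (rho_gt0 y).
have x0 := ltW (rho_gt0 x); have y0 := ltW (rho_gt0 y).
set D := psi y - psi x.
rewrite [leRHS](_ : _ = 2^-1 * D ^+ 2 * (th1 (rho x) (rho y) * rho y
  + th1 (rho x) (rho y) * rho x + 2 * (th1 (rho y) (rho x) * rho y))); last by field.
apply: mulr_ge0; first by rewrite mulr_ge0 ?invr_ge0 ?sqr_ge0.
by do ?[apply: addr_ge0|apply: mulr_ge0].
Qed.

(* The four corners of each square, exchanged by [s1] and [s2], carry the same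
   weight. *)
Lemma sum_corner_ge0 (I : finType) (M : I -> R) (s1 s2 : I -> I)
    (p q r s : I -> X) :
  involutive s1 -> involutive s2 ->
  (forall i, p (s1 i) = q i) -> (forall i, q (s1 i) = p i) ->
  (forall i, r (s1 i) = s i) ->
  (forall i, p (s2 i) = r i) -> (forall i, q (s2 i) = s i) ->
  (forall i, r (s2 i) = p i) -> (forall i, s (s2 i) = q i) ->
  (forall i, 0 <= M i) -> (forall i, M (s1 i) = M i) ->
  (forall i, M (s2 i) = M i) ->
  0 <= \sum_i M i * corner (p i) (q i) (r i).
Proof.
move=> s1K s2K p1 q1 r1 p2 q2 r2 s2E M0 M1 M2.
set S := \sum_i _.
have S1 : S = \sum_i M i * corner (q i) (p i) (s i).
  rewrite /S (reindex_inj (inv_inj s1K)); apply: eq_bigr => i _.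
  by rewrite M1 p1 q1 r1.
have S2 : S = \sum_i M i * corner (r i) (s i) (p i).
  rewrite /S (reindex_inj (inv_inj s2K)); apply: eq_bigr => i _.
  by rewrite M2 p2 q2 r2.
have S3 : S = \sum_i M i * corner (s i) (r i) (q i).
  rewrite S1 (reindex_inj (inv_inj s2K)); apply: eq_bigr => i _.
  by rewrite M2 p2 q2 s2E.
rewrite -(@pmulr_rge0 _ 4) //.
have -> : 4 * S = S + S + S + S by ring.
rewrite {2}S1 {2}S2 {2}S3 -!big_split /=; apply: sumr_ge0 => i _.
by rewrite -!mulrDr mulr_ge0 // corner_square_ge0.
Qed.

End CornerTerms.

(** * The Bochner inequality for conjugacy-invariant moves *)

Section GroupBochner.
Context {R : realType} {gT : finGroupType}.
Variables (G : {set gT}) (c : gT -> gT -> R) (pi : gT -> R).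
Hypothesis Ginv : forall d : gT, d \in G -> d^-1%g \in G.
Hypothesis Gconj : forall d g : gT, d \in G -> (g * d * g^-1)%g \in G.
Hypothesis cpos : forall x d : gT, d \in G -> 0 < c x d.
Hypothesis pi_ge0 : forall x, 0 <= pi x.
Hypothesis crev : forall x d : gT, d \in G ->
       c x d * pi x = c (d * x)%g d^-1%g * pi (d * x)%g.

Let cG x d := if d \in G then c x d else 0.

Let cG_ge0 x d : 0 <= cG x d.
Proof. by rewrite /cG; case: ifP => // dG; rewrite ltW // cpos. Qed.

Let GV d : (d^-1%g \in G) = (d \in G).
Proof. by apply/idP/idP => /Ginv //; rewrite invgK. Qed.

Let GJ d g : ((g * d * g^-1)%g \in G) = (d \in G).
Proof.
apply/idP/idP => [H|]; last exact: Gconj.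
by have := Gconj g^-1%g H; rewrite invgK !mulgA mulVg mul1g mulgKV.
Qed.

(** The hypothesis on [F] accounts for the loop at [x], which [group_rates] discards and the sum
    over moves contains when the unit lies in [G]. *)
Lemma sum_group_rates x (F : gT -> R) : F x = 0 ->
  \sum_y group_rates G c x y * F y = \sum_d cG x d * F (d * x)%g.
Proof.
move=> Fx; rewrite [RHS](partition_big (fun d => (d * x)%g) xpredT) //=.
apply: eq_bigr => y _; rewrite /group_rates; case: eqP => [->|_].
  by rewrite mul0r big1 // => d /eqP ->; rewrite Fx mulr0.
rewrite mulr_suml [in RHS]big_mkcond [in LHS]big_mkcond /=; apply: eq_bigr => d _.
rewrite /cG; case: (d \in G) => /=; case: eqP => [->|] //.
by rewrite mul0r.
Qed.

Let w x d := cG x d * pi x.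

Let w_ge0 x d : 0 <= w x d. Proof. by rewrite mulr_ge0. Qed.

Let wrev x d : w (d * x)%g d^-1%g = w x d.
Proof.
by rewrite /w /cG GV; case: ifP => [dG|_]; rewrite ?mul0r // -crev.
Qed.

Let P (i : gT * gT * gT) := pi i.1.1 * cG i.1.1 i.1.2 * cG i.1.1 i.2.

(** Excludes the pairs of twice the same involution, for which the square collapses to one edge.
    Those pairs are kept aside as the positive contribution. *)
Let good (i : gT * gT * gT) := ~~ ((i.1.2 == i.2) && (i.1.2 == i.1.2^-1%g)).

Let P0 i := if good i then P i else 0.

Let sw (i : gT * gT * gT) := (i.1.1, i.2, i.1.2).
(** For [i = (x, d, e)] the square has vertices [x], [dx], [ex], [dex]. Its corner at [dx] uses the
    moves [d^-1] and [d e d^-1], the latter allowed by conjugacy invariance. Thus [s1] crosses the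
    square along [d], and [s2] along [e]. *)
Let s1 (i : gT * gT * gT) :=
  ((i.1.2 * i.1.1)%g, i.1.2^-1%g, (i.1.2 * i.2 * i.1.2^-1)%g).
Let s2 (i : gT * gT * gT) := ((i.2 * i.1.1)%g, i.1.2, i.2^-1%g).

Let s1K : involutive s1.
Proof. by move=> [[x d] e]; rewrite /s1 /= !invgK mulKg !mulgA mulVg mul1g mulgKV. Qed.

Let s2K : involutive s2.
Proof. by move=> [[x d] e]; rewrite /s2 /= invgK mulKg. Qed.

Let s12 i : s1 (s2 i) = s2 (s1 i).
Proof.
by case: i => [[x d] e]; rewrite /s1 /s2 /= !invMg !invgK !mulgA mulgKV.
Qed.

Let good_s1 i : good (s1 i) = good i.
Proof.
case: i => [[x d] e]; rewrite /good /= invgK; congr (~~ _).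
have -> : (d^-1 == d * e * d^-1)%g = (e == d^-1%g).
  apply/eqP/eqP => [E|->]; last by rewrite mulgV mul1g.
  by rewrite -[e](mulKg d) -[(d * e)%g](mulgK d^-1%g) -E invgK mulVg mulg1.
by rewrite [d^-1%g == d]eq_sym; case: (d =P d^-1%g) => [<-|]; rewrite ?andbF // eq_sym.
Qed.

Let good_s2 i : good (s2 i) = good i.
Proof.
case: i => [[x d] e]; rewrite /good /=; congr (~~ _).
case: (d =P d^-1%g) => [E|]; rewrite ?andbF // !andbT.
by apply/eqP/eqP => [H|<-] //; rewrite -[e]invgK -H.
Qed.

Let good_sw i : good (sw i) = good i.
Proof.
case: i => [[x d] e]; rewrite /good /=; congr (~~ _).
by rewrite eq_sym; case: (d =P e) => [->|].
Qed.

Let P_sw i : P (sw i) = P i.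
Proof. by case: i => [[x d] e]; rewrite /P /= mulrAC. Qed.

Let P_ge0 i : 0 <= P i.
Proof. by rewrite !mulr_ge0. Qed.

Let P_out i : ~~ ((i.1.2 \in G) && (i.2 \in G)) -> P i = 0.
Proof.
by rewrite /P /cG; case: (i.1.2 \in G); case: (i.2 \in G) => //= _; rewrite ?(mulr0, mul0r).
Qed.

Let P0_ge0 i : 0 <= P0 i.
Proof. by rewrite /P0; case: ifP. Qed.

Let P0_sw i : P0 (sw i) = P0 i.
Proof. by rewrite /P0 good_sw P_sw. Qed.

(** The largest weight that all four corners of a square can carry in common. *)
Let M i := Num.min (Num.min (P0 i) (P0 (s1 i)))
  (Num.min (P0 (s2 i)) (P0 (s1 (s2 i)))).

Let M_s1 i : M (s1 i) = M i.
Proof.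
by rewrite /M s1K -!s12 s1K; congr Num.min; exact: minC.
Qed.

Let M_s2 i : M (s2 i) = M i.
Proof. by rewrite /M !s2K minC. Qed.

Let M_ge0 i : 0 <= M i.
Proof. by rewrite /M !le_min !P0_ge0. Qed.

Let M_le i : M i <= P0 i.
Proof. by rewrite /M !ge_min lexx. Qed.

(** Crossing a square along an edge changes the weight by a factor at most [q]. A share [1 - q^-2]
    of the weight may then be left unmatched, and [dominated] asks the degenerate pairs to pay for
    it and for [kappa]. At a move that is no involution this forces [q = 1] and [kappa = 0]. *)
Variables (kappa q : R).
Hypothesis kappa_ge0 : 0 <= kappa.
Hypothesis q_ge1 : 1 <= q.
Hypothesis ratio : forall x d e : gT, d \in G -> e \in G ->
  ~~ ((d == e) && (d == d^-1%g)) ->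
  c x e <= q * c (d * x)%g (d * e * d^-1)%g /\ c x d <= q * c (e * x)%g d.
Hypothesis dominated : forall x d : gT, d \in G ->
  (1 - q ^- 2) * \sum_(e in G | ~~ ((d == e) && (d == d^-1%g))) c x e + kappa / 2
  <= (d == d^-1%g)%:R * c (d * x)%g d.

Let q_gt0 : 0 < q. Proof. exact: lt_le_trans q_ge1. Qed.

Let P0_s1 i : P0 i <= q * P0 (s1 i).
Proof.
rewrite /P0 good_s1; case: ifP => [g|]; last by rewrite mulr0.
have [iG|iG] := boolP ((i.1.2 \in G) && (i.2 \in G)); last first.
  by rewrite (P_out iG) mulr_ge0 // ltW.
have /andP[dG eG] := iG; have [H _] := ratio i.1.1 dG eG g.
have -> : P (s1 i) = w i.1.1 i.1.2 * c (i.1.2 * i.1.1)%g (i.1.2 * i.2 * i.1.2^-1)%g.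
  by rewrite /P /= -wrev /w; rewrite {2}/cG GJ eG; ring.
have -> : P i = w i.1.1 i.1.2 * c i.1.1 i.2 by rewrite /P {2}/cG eG /w; ring.
by rewrite mulrCA ler_wpM2l.
Qed.

Let P0_s2 i : P0 i <= q * P0 (s2 i).
Proof.
rewrite /P0 good_s2; case: ifP => [g|]; last by rewrite mulr0.
have [iG|iG] := boolP ((i.1.2 \in G) && (i.2 \in G)); last first.
  by rewrite (P_out iG) mulr_ge0 // ltW.
have /andP[dG eG] := iG; have [_ H] := ratio i.1.1 dG eG g.
have -> : P (s2 i) = w i.1.1 i.2 * c (i.2 * i.1.1)%g i.1.2.
  by rewrite /P /= -wrev /w; rewrite {1}/cG dG; ring.
have -> : P i = w i.1.1 i.2 * c i.1.1 i.1.2 by rewrite /P {1}/cG dG /w; ring.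
by rewrite mulrCA ler_wpM2l.
Qed.

(** Every corner is reached by at most two crossings, each of which costs a factor [q]. *)
Let M_ge i : q ^- 2 * P0 i <= M i.
Proof.
have b1 := P0_s1 i; have b2 := P0_s2 i; have b3 := P0_s1 (s2 i).
have b4 : P0 i <= q ^+ 2 * P0 (s1 (s2 i)).
  by rewrite (le_trans b2) // expr2 -mulrA ler_wpM2l // ltW.
have qq x : 0 <= x -> q * x <= q ^+ 2 * x.
  by move=> x0; rewrite ler_wpM2r // ler_eXnr.
rewrite /M !le_min !ler_pdivrMl ?exprn_gt0 // b4 andbT.
apply/andP; split; last exact: le_trans b2 (qq _ (P0_ge0 _)).
by rewrite (le_trans b1 (qq _ (P0_ge0 _))) andbT ler_peMl ?exprn_ege1.
Qed.

Let sum3 (F : gT * gT * gT -> R) :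
  \sum_x \sum_d \sum_e F (x, d, e) = \sum_i F i.
Proof.
transitivity (\sum_(p : gT * gT) \sum_e F (p, e)).
  by rewrite pair_bigA; apply: eq_bigr => -[x d].
by rewrite pair_bigA; apply: eq_bigr => -[p e].
Qed.

Let sum_w x (F : gT -> R) : F x = 0 ->
  \sum_y F y * (group_rates G c x y * pi x) = \sum_d w x d * F (d * x)%g.
Proof.
move=> Fx; transitivity (\sum_y group_rates G c x y * (F y * pi x)).
  by apply: eq_bigr => y _; rewrite mulrCA.
rewrite sum_group_rates ?Fx ?mul0r //.
by apply: eq_bigr => d _; rewrite /w; ring.
Qed.

Let dominated_sum x d :
  kappa / 2 * w x d + (1 - q ^- 2) * \sum_e P0 (x, d, e) <=
  (d == d^-1%g)%:R * (w x d * cG (d * x)%g d).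
Proof.
have [dG|dG] := boolP (d \in G); last first.
  rewrite big1 => [|e _]; last by rewrite /P0 P_out ?if_same //= (negbTE dG).
  by rewrite /w /cG (negbTE dG) !(mul0r, mulr0) addr0.
have -> : \sum_e P0 (x, d, e) =
    w x d * \sum_(e in G | ~~ ((d == e) && (d == d^-1%g))) c x e.
  rewrite mulr_sumr [RHS]big_mkcond; apply: eq_bigr => e _ /=.
  rewrite /P0 /good /P /w /=; case: (_ && _); rewrite ?andbF // andbT.
  by rewrite {2}/cG; case: ifP => _; rewrite ?mulr0 // [cG x d * _]mulrC.
have := ler_wpM2l (w_ge0 x d) (dominated x dG); rewrite [cG (d * x)%g d]/cG dG.
by set S := \sum_(e in G | _) _; move=> H; lra.
Qed.

Lemma group_bochner a : 0 <= a <= 1 ->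
  bochner (group_rates G c) pi kappa (smean a) (smean1 a).
Proof.
move=> a01 rho psi rho0.
set U := corner (smean a) (smean1 a) rho psi.
have thC := @smeanC R a; have th0 := @smean_gt0 R a.
have thE := @smean_euler R a; have th1 := fun s t => @smean1_ge0 R a s t a01.
have thT s t u v := @smean_tangent R a s t u v a01.
pose C x d := U (d * x)%g x x.
have C0 x d : 0 <= C x d by exact: corner_cross_ge0.
pose T x d := smean a (rho x) (rho (d * x)%g) * (psi (d * x)%g - psi x) ^+ 2.
have dformE : 2 * kappa * dform (group_rates G c) pi (smean a) rho psi psi =
    kappa * \sum_x \sum_d w x d * T x d.
  rewrite /dform mulrACA divff // mul1r; congr (_ * _).
  apply: eq_bigr => x _; rewrite sum_w; last by rewrite subrr !mul0r.
  by apply: eq_bigr => d _; rewrite /T; ring.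
have GammaE : \sum_x \sum_y (smean1 a (rho x) (rho y) * generator (group_rates G c) rho x
    * (psi x - psi y) ^+ 2 - 2 * smean a (rho x) (rho y) * (psi x - psi y)
    * generator (group_rates G c) psi x) * (group_rates G c x y * pi x)
    = 2 * \sum_i P i * U i.1.1 (i.1.2 * i.1.1)%g (i.2 * i.1.1)%g.
  rewrite -sum3 mulr_sumr; apply: eq_bigr => x _.
  rewrite sum_w; last by rewrite subrr expr0n /= !(mulr0, mul0r) subrr.
  rewrite mulr_sumr; apply: eq_bigr => d _ /=.
  have gE f : generator (group_rates G c) f x = \sum_e cG x e * (f (e * x)%g - f x).
    by rewrite /generator (@sum_group_rates x (fun y => f y - f x)) // subrr.
  rewrite !gE !(mulr_sumr, mulr_suml) -sumrB !mulr_sumr.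
  by apply: eq_bigr => e _; rewrite /P /U /corner /w /=; field.
rewrite dformE GammaE.
pose pairU (i : gT * gT * gT) := U i.1.1 (i.1.2 * i.1.1)%g (i.2 * i.1.1)%g
   + U i.1.1 (i.2 * i.1.1)%g (i.1.2 * i.1.1)%g.
have swK : involutive sw by move=> [[]].
have sumM : 0 <= \sum_i M i * pairU i.
  under eq_bigr do rewrite mulrDr; rewrite big_split addr_ge0 //=.
    apply: (@sum_corner_ge0 _ _ _ _ thC th0 thE thT rho psi rho0 _ M s1 s2
      (fun i => i.1.1) (fun i => i.1.2 * i.1.1)%g (fun i => i.2 * i.1.1)%g
      (fun i => i.1.2 * i.2 * i.1.1)%g) => //;
      move=> [[x d] e] /=; by rewrite ?mulgA ?mulgKV ?mulKg ?mulVg ?mul1g.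
  apply: (@sum_corner_ge0 _ _ _ _ thC th0 thE thT rho psi rho0 _ M s2 s1
      (fun i => i.1.1) (fun i => i.2 * i.1.1)%g (fun i => i.1.2 * i.1.1)%g
      (fun i => i.1.2 * i.2 * i.1.1)%g) => //;
      move=> [[x d] e] /=; by rewrite ?mulgA ?mulgKV ?mulKg ?mulVg ?mul1g.
have sumP0 : - (1 - q ^- 2) * \sum_i P0 i * C i.1.1 i.1.2 <=
    \sum_i P0 i * U i.1.1 (i.1.2 * i.1.1)%g (i.2 * i.1.1)%g.
  have E1 : 2 * \sum_i P0 i * U i.1.1 (i.1.2 * i.1.1)%g (i.2 * i.1.1)%g =
      \sum_i P0 i * pairU i.
    rewrite mulr_natl mulr2n {2}(reindex_inj (inv_inj swK)) -big_split /=.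
    by apply: eq_bigr => i _; rewrite P0_sw -mulrDr.
  have E2 : 2 * \sum_i P0 i * C i.1.1 i.1.2 =
      \sum_i P0 i * (C i.1.1 i.1.2 + C i.1.1 i.2).
    rewrite mulr_natl mulr2n {2}(reindex_inj (inv_inj swK)) -big_split /=.
    by apply: eq_bigr => i _; rewrite P0_sw -mulrDr.
  rewrite -(ler_pM2l (_ : 0 < 2)) // mulrCA E1 E2 mulr_sumr.
  rewrite -subr_ge0; apply: (le_trans sumM); rewrite -sumrB; apply: ler_sum => i _.
  rewrite -subr_ge0.
  have H := @corner_pair_ge0 _ _ _ _ thC th0 thE thT rho psi rho0 i.1.1
    (i.1.2 * i.1.1)%g (i.2 * i.1.1)%g.
  rewrite -/U -/(pairU i) -/(C _ _) -/(C _ _) in H.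
  (* The unmatched weight [P0 - M] is paid for by [corner_pair_ge0]; what remains of the cross terms
     has the nonnegative coefficient [M - q^-2 P0]. *)
  have -> : P0 i * pairU i - - (1 - q ^- 2) * (P0 i * (C i.1.1 i.1.2 + C i.1.1 i.2)) - M i * pairU i
    = (P0 i - M i) * (pairU i + (C i.1.1 i.1.2 + C i.1.1 i.2))
      + (M i - q ^- 2 * P0 i) * (C i.1.1 i.1.2 + C i.1.1 i.2) by ring.
  by apply: addr_ge0; apply: mulr_ge0; rewrite ?subr_ge0 ?M_le ?M_ge // addr_ge0.
(* The pairs outside [good] have [d = e = d^-1]; translating [x] by [d] writes their corners as
   return moves [C], the terms that have to absorb the defect. *)
have splitP : \sum_i P i * U i.1.1 (i.1.2 * i.1.1)%g (i.2 * i.1.1)%g =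
   \sum_i P0 i * U i.1.1 (i.1.2 * i.1.1)%g (i.2 * i.1.1)%g +
   \sum_x \sum_d (d == d^-1%g)%:R * (w x d * cG (d * x)%g d) * C x d.
  have -> : \sum_x \sum_d (d == d^-1%g)%:R * (w x d * cG (d * x)%g d) * C x d =
    \sum_x \sum_d (d == d^-1%g)%:R * P (x, d, d) * U x (d * x)%g (d * x)%g.
    rewrite exchange_big [RHS]exchange_big /=; apply: eq_bigr => d _.
    rewrite [RHS](reindex_inj (mulgI d)) /=; apply: eq_bigr => x _.
    case: eqP => [dV|_]; last by rewrite !mul0r.
    have -> : (d * (d * x))%g = x by rewrite {1}dV mulKg.
    by rewrite -wrev -dV /C /w /P /=; ring.
  rewrite -!sum3 -big_split; apply: eq_bigr => x _; rewrite -big_split /=.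
  apply: eq_bigr => d _.
  rewrite [X in _ = _ + X](_ : _ = \sum_e ((d == e) && (d == d^-1%g))%:R * P (x, d, e)
      * U x (d * x)%g (e * x)%g).
    rewrite -big_split; apply: eq_bigr => e _; rewrite /P0 /good /=.
    by case: (_ && _); rewrite /= ?mul0r ?add0r ?addr0 ?mul1r.
  rewrite (bigD1 d) //= eqxx /= [X in _ = _ + X]big1 ?addr0 // => e ed.
  by rewrite eq_sym (negbTE ed) !mul0r.
rewrite splitP.
have sumC : kappa / 2 * \sum_x \sum_d w x d * C x d +
   (1 - q ^- 2) * (\sum_i P0 i * C i.1.1 i.1.2) <=
   \sum_x \sum_d (d == d^-1%g)%:R * (w x d * cG (d * x)%g d) * C x d.
  rewrite -sum3 !mulr_sumr -big_split; apply: ler_sum => x _ /=.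
  rewrite !mulr_sumr -big_split; apply: ler_sum => d _ /=.
  rewrite -mulr_suml !mulrA -mulrDl; apply: ler_wpM2r => //.
  by have := dominated_sum x d; rewrite /w !mulrA.
(* By reversibility the return moves and the forward moves have the same weighted sum, so
   [corner_cross_ge] may be applied to half of both. *)
have TC : \sum_x \sum_d w x d * T x d <= \sum_x \sum_d w x d * C x d.
  rewrite -(ler_pM2l (_ : 0 < 2)) //.
  have E : \sum_x \sum_d w x d * C x d =
      \sum_x \sum_d w x d * U x (d * x)%g (d * x)%g.
    rewrite !pair_bigA /= (reindex_inj (h := fun p => ((p.2 * p.1)%g, p.2^-1%g))) /=.
      by apply: eq_bigr => -[x d] _ /=; rewrite wrev /C /= mulKg.
    move=> [x d] [y e] /= [+ /invg_inj de]; rewrite de => /mulgI -> //.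
  rewrite [leRHS](_ : _ = \sum_x \sum_d w x d * C x d +
    \sum_x \sum_d w x d * U x (d * x)%g (d * x)%g); last by rewrite -E; ring.
  rewrite -big_split mulr_sumr; apply: ler_sum => x _ /=.
  rewrite -big_split mulr_sumr; apply: ler_sum => d _ /=.
  rewrite mulrCA -mulrDr ler_wpM2l // addrC /T.
  exact: corner_cross_ge.
have := ler_wpM2l kappa_ge0 TC; move: sumC sumP0 => H1 H2 H3.
apply: (le_trans H3); move: H1 H2; lra.
Qed.

End GroupBochner.

(** * Suprema and infima of finite families *)

Section FiniteExtrema.
Context {R : realType}.

Lemma le_sup_finite (I : finType) (F : I -> R) (S : set R) r :
  (forall r, S r -> exists i, r = F i) -> S r -> r <= sup S.
Proof.
move=> SF Sr; apply: ub_le_sup => //; exists (\sum_i `|F i|) => _ /SF[i ->].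
by rewrite (bigD1 i) //= ler_wpDr ?sumr_ge0 // ler_norm.
Qed.

Lemma ge_inf_nneg (S : set R) r : (forall r, S r -> 0 <= r) -> S r -> inf S <= r.
Proof. by move=> S0 Sr; apply: ge_inf => //; exists 0 => u /S0. Qed.

Lemma inf_nneg (S : set R) : (forall r, S r -> 0 <= r) -> 0 <= inf S.
Proof.
move=> S0; have [->|/set0P Sn] := eqVneq S set0; first by rewrite inf0.
by apply: lb_le_inf => // u /S0.
Qed.

End FiniteExtrema.

(** * The group chain, its constants and the two curvature bounds *)

Section GroupChain.
Context {R : realType} {gT : finGroupType}.
Variables (G : {set gT}) (c : gT -> gT -> R) (pi : gT -> R).
Hypothesis Ggen : <<G>>%g = [set: gT]%SET.
Hypothesis Ginv : forall d : gT, d \in G -> d^-1%g \in G.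
Hypothesis Gconj : forall d g : gT, d \in G -> (g * d * g^-1)%g \in G.
Hypothesis cpos : forall x d : gT, d \in G -> 0 < c x d.
Hypothesis piprob : is_prob pi.
Hypothesis crev : forall x d : gT, d \in G ->
       c x d * pi x = c (d * x)%g d^-1%g * pi (d * x)%g.

Lemma group_rates_ge0 x y : 0 <= group_rates G c x y.
Proof.
rewrite /group_rates; case: ifP => // _.
by apply: sumr_ge0 => d /andP[dG _]; rewrite ltW // cpos.
Qed.

Lemma group_rates_rev x y :
  group_rates G c x y * pi x = group_rates G c y x * pi y.
Proof.
rewrite /group_rates eq_sym; case: eqP => _; first by rewrite !mul0r.
rewrite !mulr_suml [RHS](reindex_inj invg_inj) /=; apply: eq_big => d.
  have -> : (d^-1%g \in G) = (d \in G).
    by apply/idP/idP => /Ginv //; rewrite invgK.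
  congr (_ && _); apply/eqP/eqP => [<-|<-]; first by rewrite mulKg.
  by rewrite mulKVg.
by move=> /andP[dG /eqP <-]; exact: crev.
Qed.

(** The elements [g] such that [g z] is reachable from every [z] form a subgroup containing [G],
    hence all of the group. *)
Lemma group_rates_connect x y :
  connect (fun x y => 0 < group_rates G c x y) x y.
Proof.
set e := (fun x y => _).
pose H : {set gT} := [set g | [forall x, connect e x (g * x)%g]]%SET.
have gH : group_set H.
  apply/group_setP; split.
    by rewrite inE; apply/forallP => z; rewrite mul1g connect0.
  move=> g h; rewrite !inE => /forallP gc /forallP hc; apply/forallP => z.
  by rewrite -mulgA; exact: connect_trans (hc z) (gc _).
have GH : G \subset H.
  apply/fintype.subsetP => d dG; rewrite inE; apply/forallP => z.
  have [->|dz] := eqVneq (d * z)%g z; first exact: connect0.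
  apply: connect1; rewrite /e /group_rates (negbTE dz) (bigD1 d) /=; last first.
    by rewrite dG eqxx.
  rewrite ltr_wpDr ?cpos // sumr_ge0 // => d' /andP[/andP[d'G _] _].
  by rewrite ltW // cpos.
have : (y * x^-1)%g \in <<G>>%g by rewrite Ggen inE.
have /fintype.subsetP sub : <<G>>%g \subset Group gH by rewrite gen_subG.
by move=> /sub; rewrite inE => /forallP /(_ x); rewrite mulgKV.
Qed.

(** Positivity holds somewhere, as the total mass is 1, and spreads along edges by reversibility. *)
Lemma stationary_gt0 x : 0 < pi x.
Proof.
have [pi0 pi1] := piprob.
have [y py] : exists y, 0 < pi y.
  apply/not_existsP => H; move: pi1; rewrite big1 => [/eqP|y _].
    by rewrite eq_sym oner_eq0.
  by apply/eqP; rewrite eq_le pi0 andbT leNgt; apply/negP; exact: H.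
have /connectP[p] := group_rates_connect y x.
elim: p y py => [|z p IH] y py /=; first by move=> _ ->.
move=> /andP[yz pz]; apply: (IH z) => //.
have := mulr_gt0 yz py; rewrite group_rates_rev => H.
rewrite lt_neqAle pi0 andbT; apply/eqP => z0.
by move: H; rewrite -z0 mulr0 ltxx.
Qed.

Lemma rate_le_alpha1 x d : d \in G -> d != d^-1%g ->
  c (d * x)%g d <= expR (alpha1 G c) * c x d.
Proof.
move=> dG dV; rewrite -ler_pdivrMr ?cpos // -[leLHS]lnK; last first.
  by rewrite posrE divr_gt0 ?cpos.
rewrite ler_expR; apply: (@le_sup_finite _ (gT * gT)%type
  (fun p => ln (c (p.2 * p.1)%g p.2 / c p.1 p.2))).
  by move=> r [y [d' [_ _ ->]]]; exists (y, d').
by exists x, d.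
Qed.

Lemma alpha2_set_finite r : (exists x d e : gT,
    [/\ d \in G, e \in G, d != e, d != e^-1%g &
        r = ln (c (d * x)%g e / c x e) \/
        r = ln (c (d * x)%g (d * e * d^-1)%g / c x e)]) ->
  exists i : bool * (gT * gT * gT), r =
    ln (c (i.2.1.2 * i.2.1.1)%g (if i.1 then i.2.2
      else i.2.1.2 * i.2.2 * i.2.1.2^-1)%g / c i.2.1.1 i.2.2).
Proof.
by move=> [x [d [e [_ _ _ _ [->|->]]]]]; [exists (true, (x, d, e))|exists (false, (x, d, e))].
Qed.

Lemma rate_le_alpha2 x d e : d \in G -> e \in G -> d != e -> d != e^-1%g ->
  c (d * x)%g e <= expR (alpha2 G c) * c x e /\
  c (d * x)%g (d * e * d^-1)%g <= expR (alpha2 G c) * c x e.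
Proof.
move=> dG eG de dV; have eJ := Gconj d eG; split.
  rewrite -ler_pdivrMr ?cpos // -[leLHS]lnK; last by rewrite posrE divr_gt0 ?cpos.
  rewrite ler_expR; apply: le_sup_finite; first exact: alpha2_set_finite.
  by exists x, d, e; split => //; left.
rewrite -ler_pdivrMr ?cpos // -[leLHS]lnK; last by rewrite posrE divr_gt0 ?cpos.
rewrite ler_expR; apply: le_sup_finite; first exact: alpha2_set_finite.
by exists x, d, e; split => //; right.
Qed.

(* The sum of [c x e] over all [x] is invariant under translation by [d]. *)
Lemma translate_ratio_ge1 (k : R) d e : e \in G ->
  (forall x, c (d * x)%g e <= k * c x e) -> 1 <= k.
Proof.
move=> eG le; have s0 : 0 < \sum_x c x e.
  by rewrite (bigD1 1%g) //= ltr_wpDr ?cpos // sumr_ge0 // => x _; rewrite ltW ?cpos.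
rewrite -(ler_pM2r s0) mul1r {1}(reindex_inj (mulgI d)) /= mulr_sumr.
exact: ler_sum.
Qed.

Lemma alpha2_ge0 : 0 <= alpha2 G c.
Proof.
rewrite /alpha2; set S := [set r | _].
have [->|/set0P[r [x [d [e [dG eG de dV _]]]]]] := eqVneq S set0; first by rewrite sup0.
rewrite -ler_expR expR0; apply: (translate_ratio_ge1 (d := d) eG) => y.
by have [] := rate_le_alpha2 y dG eG de dV.
Qed.

Lemma rate_le_beta x d e : d \in G -> e \in G -> c x e <= beta G c * c x d.
Proof.
move=> dG eG; rewrite -ler_pdivrMr ?cpos //.
apply: (@le_sup_finite _ (gT * gT * gT)%type (fun i => c i.1.1 i.2 / c i.1.1 i.1.2)).
  by move=> r [y [d' [e' [_ _ ->]]]]; exists (y, d', e').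
by exists x, d, e.
Qed.

Lemma cmin_le x d : d \in G -> cmin G c <= c x d.
Proof.
move=> dG; apply: ge_inf_nneg; last by exists x, d.
by move=> r [y [d' [d'G ->]]]; rewrite ltW // cpos.
Qed.

Lemma cmin_ge0 : 0 <= cmin G c.
Proof. by apply: inf_nneg => r [y [d' [d'G ->]]]; rewrite ltW // cpos. Qed.

(** The bounds by [alpha2] are applied from the other end of an edge: from [dx] with the move
    [d^-1], which conjugates [d e d^-1] back to [e], and from [ex] with the move [e^-1]. *)
Lemma alpha2_ratio x d e : d \in G -> e \in G -> d != e -> d != e^-1%g ->
  c x e <= expR (alpha2 G c) * c (d * x)%g (d * e * d^-1)%g /\
  c x d <= expR (alpha2 G c) * c (e * x)%g d.
Proof.
move=> dG eG de dV; split.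
  have [] := @rate_le_alpha2 (d * x)%g d^-1%g (d * e * d^-1)%g.
  - exact: Ginv.
  - exact: Gconj.
  - apply: contra dV => /eqP E; apply/eqP/invg_inj.
    by rewrite invgK -[e](mulKg d) -[(d * e)%g](mulgK d^-1%g) -E invgK mulVg mulg1.
  - apply: contra de => /eqP E; apply/eqP/invg_inj.
    rewrite !invMg invgK mulgA in E.
    by rewrite -[(e^-1)%g](mulKg d) -[(d * e^-1)%g](mulgK d^-1%g) -E invgK mulVg mulg1.
  by move=> _; rewrite mulKg invgK !mulgA mulVg mul1g mulgKV.
have [||||] := @rate_le_alpha2 (e * x)%g e^-1%g d => //.
- exact: Ginv.
- by rewrite eq_sym.
- by rewrite (inj_eq invg_inj) eq_sym.
by rewrite mulKg.
Qed.

Lemma group_Ric_ge (kappa q : R) : 0 <= kappa -> 1 <= q ->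
  (forall x d e : gT, d \in G -> e \in G -> ~~ ((d == e) && (d == d^-1%g)) ->
    c x e <= q * c (d * x)%g (d * e * d^-1)%g /\ c x d <= q * c (e * x)%g d) ->
  (forall x d : gT, d \in G ->
    (1 - q ^- 2) * \sum_(e in G | ~~ ((d == e) && (d == d^-1%g))) c x e + kappa / 2
    <= (d == d^-1%g)%:R * c (d * x)%g d) ->
  Ric_ge (group_rates G c) pi kappa.
Proof.
move=> k0 q1 ratio dom; have [pi0 pi1] := piprob.
apply: Ric_ge_of_bochner => //.
- exact: group_rates_ge0.
- exact: stationary_gt0.
- exact: group_rates_rev.
- exact: group_rates_connect.
- by move=> a a01; exact: (group_bochner Ginv Gconj cpos pi0 crev k0 q1 ratio dom a01).
Qed.

(** Here [eps] is at least 1 as well: [expR (alpha1 G c) >= 1] by translation averaging, and the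
    other summand is nonnegative. Both are therefore extremal, and the claim reduces to the Bochner
    inequality with [q = 1] and [kappa = 0]. *)
Lemma Ric_ge_noninvolutive (d0 : gT) : d0 \in G -> d0 != d0^-1%g ->
  let eps := expR (alpha1 G c)
     + beta G c * (#|G|%:R - 2) * (expR (2 * alpha2 G c) - 1) in
  eps <= 1 -> Ric_ge (group_rates G c) pi ((1 - eps) * (2 * cmin G c)).
Proof.
move=> d0G d0V /= epsle.
have a1 : 1 <= expR (alpha1 G c).
  by apply: (translate_ratio_ge1 (d := d0) d0G) => x; exact: rate_le_alpha1.
have b1 : 1 <= beta G c.
  have := rate_le_beta 1%g d0G d0G.
  by rewrite -{1}[c _ _]mul1r ler_pM2r // cpos.
have sub : [set d0; d0^-1%g]%SET \subset G.
  by apply/fintype.subsetP => x; rewrite !inE => /orP[] /eqP -> //; exact: Ginv.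
have card2 : #|[set d0; d0^-1%g]%SET| = 2%N by rewrite cards2 d0V.
have G2 : 0 <= #|G|%:R - 2 :> R.
  by rewrite subr_ge0 ler_nat -card2 subset_leq_card.
have e2 : 0 <= expR (2 * alpha2 G c) - 1.
  by rewrite subr_ge0 -expR0 ler_expR mulr_ge0 // alpha2_ge0.
have T0 : 0 <= beta G c * (#|G|%:R - 2) * (expR (2 * alpha2 G c) - 1).
  by rewrite !mulr_ge0 // (le_trans ler01).
move: epsle T0; set T := beta G c * _ * _ => epsle T0.
have a1E : expR (alpha1 G c) = 1 by lra.
have TE : T = 0 by lra.
rewrite a1E TE addr0 subrr mul0r.
(* The second summand vanishes only if [alpha2 = 0] or [|G| = 2]; in the latter case [G] consists of
   [d0] and its inverse, and there is no such pair. *)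
have pair d e : d \in G -> e \in G -> d != e -> d != e^-1%g -> expR (alpha2 G c) = 1.
  move=> dG eG de dV; move: TE => /eqP; rewrite /T !mulf_eq0.
  rewrite gt_eqF ?(lt_le_trans ltr01) //= => /orP[|]; last first.
    rewrite subr_eq0 -{2}expR0 => /eqP /expR_inj /eqP.
    by rewrite mulf_eq0 pnatr_eq0 /= => /eqP ->; rewrite expR0.
  rewrite subr_eq0 eqr_nat -card2 => /eqP Gc.
  have GE : [set d0; d0^-1%g]%SET = G by apply/eqP; rewrite eqEcard sub Gc leqnn.
  move: dG eG de dV; rewrite -GE !inE => /orP[] /eqP -> /orP[] /eqP ->;
    by rewrite ?invgK ?eqxx.
(* The rate cannot increase under translation by [d], while its sum over the group is unchanged, so
   it is constant along the orbits. *)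
have inv1 x d : d \in G -> d != d^-1%g -> c (d * x)%g d = c x d.
  move=> dG dV; have le y : 0 <= c y d - c (d * y)%g d.
    by rewrite subr_ge0; have := rate_le_alpha1 y dG dV; rewrite a1E mul1r.
  have : \sum_y (c y d - c (d * y)%g d) == 0.
    by rewrite sumrB subr_eq0 {1}(reindex_inj (mulgI d)).
  rewrite psumr_eq0 // => /allP /(_ x (mem_index_enum x)) /=.
  by rewrite subr_eq0 => /eqP.
apply: (@group_Ric_ge 0 1) => // [x d e dG eG good|x d dG].
  rewrite !mul1r; have [de|de] := eqVneq d e.
    rewrite -de eqxx /= in good; rewrite -de mulgK -(inv1 x d) //.
  have [dE|dE] := eqVneq d e^-1%g; last first.
    have := alpha2_ratio x dG eG de dE; rewrite (pair _ _ dG eG de dE).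
    by rewrite !mul1r.
  have eE : e = d^-1%g by rewrite dE invgK.
  have eV : e != e^-1%g by rewrite -dE eq_sym.
  have dV : d != d^-1%g by rewrite -eE.
  split; first by rewrite eE mulgV mul1g -eE -{1}(mulKg d x) -eE (inv1 _ _ eG eV).
  by rewrite -(inv1 (e * x)%g d dG dV) eE mulKVg.
rewrite expr1n invr1 subrr !mul0r addr0 mulr_ge0 // ltW // cpos //.
Qed.

Lemma Ric_ge_involutive : (forall d : gT, d \in G -> d = d^-1%g) ->
  let eps' := beta G c * (#|G|%:R - 1) * (expR (2 * alpha2 G c) - 1) in
  eps' <= 1 -> Ric_ge (group_rates G c) pi ((1 - eps') * (2 * cmin G c)).
Proof.
move=> Ginvol /=; set eps' := beta G c * _ * _ => epsle.
pose q := expR (alpha2 G c).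
have q1 : 1 <= q by rewrite -expR0 ler_expR alpha2_ge0.
have q0 : 0 < q by exact: expR_gt0.
have q2 : expR (2 * alpha2 G c) = q ^+ 2 by rewrite mulr_natl mulr2n expRD expr2.
have rat x d e : d \in G -> e \in G -> d != e ->
    c x e <= q * c (d * x)%g (d * e * d^-1)%g /\ c x d <= q * c (e * x)%g d.
  by move=> dG eG de; apply: alpha2_ratio => //; rewrite -(Ginvol e eG).
apply: (@group_Ric_ge _ q) => // [|x d e dG eG|x d dG].
- by rewrite !mulr_ge0 ?subr_ge0 ?cmin_ge0.
- by move=> good; apply: rat => //; apply: contra good => de; rewrite de eq_sym -Ginvol //=.
have dV := Ginvol d dG; rewrite -dV eqxx mul1r.
(* Going from [x] to [dx] costs [q], exchanging [e] for [d] costs [beta], and weakening [q] to [q^2]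
   yields [(1 - q^-2) q^2 = q^2 - 1], the factor in [eps']. Summing over the [|G| - 1] moves other
   than [d] gives exactly [eps']. *)
have ce e : e \in G -> d != e ->
    (1 - q ^- 2) * c x e <= (q ^+ 2 - 1) * beta G c * c (d * x)%g d.
  move=> eG de; rewrite eq_sym in de; have [_ le1] := rat x e d eG dG de.
  have le2 := rate_le_beta (d * x)%g dG eG.
  have b0 : 0 <= beta G c * c (d * x)%g d.
    by apply: le_trans le2; rewrite ltW // cpos.
  have q20 : 0 <= 1 - q ^- 2 by rewrite subr_ge0 invf_le1 ?exprn_gt0 ?exprn_ege1.
  have -> : (q ^+ 2 - 1) * beta G c * c (d * x)%g d =
      (1 - q ^- 2) * (q ^+ 2 * (beta G c * c (d * x)%g d)).
    by field; rewrite gt_eqF.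
  rewrite ler_wpM2l // (le_trans le1) // expr2 -mulrA ler_wpM2l ?(ltW q0) //.
  by rewrite (le_trans le2) // ler_peMl.
have le : (1 - q ^- 2) * \sum_(e in G | ~~ ((d == e) && true)) c x e <=
    eps' * c (d * x)%g d.
  rewrite mulr_sumr.
  apply: (@le_trans _ _ (\sum_(e in (G :\ d)%SET) (q ^+ 2 - 1) * beta G c * c (d * x)%g d)).
    rewrite [leRHS](eq_bigl (fun e => (e \in G) && ~~ ((d == e) && true))).
      by apply: ler_sum => e /andP[eG]; rewrite andbT; exact: ce.
    by move=> e; rewrite !inE andbT eq_sym andbC.
  rewrite sumr_const -mulr_natl /eps' q2 (cardsD1 d G) dG natrD.
  have -> : true%:R + #|(G :\ d)%SET|%:R - 1 = #|(G :\ d)%SET|%:R :> R.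
    by rewrite addrAC subrr add0r.
  by set n := #|_|%:R; set k := c _ _; rewrite le_eqVlt; apply/orP; left; apply/eqP; ring.
have := cmin_le (d * x)%g dG; have := epsle; move: le.
set S := _ * \sum_(_ in _ | _) _; set k := c (d * x)%g d; set m := cmin G c => h1 h2 h3.
(* The defect uses the share [eps'] of [c (d * x) d]; the remaining share is at least
   [(1 - eps') * cmin], which is [kappa / 2]. *)
have : 0 <= (1 - eps') * (k - m) by rewrite mulr_ge0 ?subr_ge0.
lra.
Qed.

End GroupChain.

Local Close Scope classical_set_scope.

Theorem theorem3p11 (R : realType) (gT : finGroupType) (G : {set gT})
    (c : gT -> gT -> R) (pi : gT -> R)
    (Ggen : <<G>>%g = [set: gT]%SET)
    (Ginv : forall d : gT, d \in G -> d^-1%g \in G)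
    (Gconj : forall d g : gT, d \in G -> (g * d * g^-1)%g \in G)
    (cpos : forall x d : gT, d \in G -> 0 < c x d)
    (piprob : is_prob pi)
    (crev : forall x d : gT, d \in G ->
       c x d * pi x = c (d * x)%g d^-1%g * pi (d * x)%g) :
  ((exists2 d : gT, d \in G & d != d^-1%g) ->
   let eps := expR (alpha1 G c)
     + beta G c * (#|G|%:R - 2) * (expR (2 * alpha2 G c) - 1) in
   eps <= 1 ->
   Ric_ge (group_rates G c) pi ((1 - eps) * (2 * cmin G c)))
  /\
  ((forall d : gT, d \in G -> d = d^-1%g) ->
   let eps' := beta G c * (#|G|%:R - 1) * (expR (2 * alpha2 G c) - 1) in
   eps' <= 1 ->
   Ric_ge (group_rates G c) pi ((1 - eps') * (2 * cmin G c))).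
Proof.
split => [[d0 d0G d0V]|]; first exact:
  (Ric_ge_noninvolutive Ggen Ginv Gconj cpos piprob crev d0G d0V).
exact: (Ric_ge_involutive Ggen Ginv Gconj cpos piprob crev).
Qed.
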